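(* For all $d,m\in\mathbb{N}$ there exists a constant $\beta_0=\beta_0(d,m)>1$ such that the following holds. Let $H$ be a Hilbert space and let $K\subset H$ be a compact set such that, for some $q>1$, $$\limsup_{n\to\infty}\Omega_n(K,H)^{1/n}\le q^{-1}.$$ Then for every $f\in\mathscr{P}^m_d(H)$ and every integer $0\le\nu\le m-1$, $$\dim_e\big(f(\mathrm{Crit}_\nu(f)\cap K)\big)\le \nu+\frac{\ln\beta_0}{\ln q}.$$ In particular, if $q>\beta_0$, then $\mu\big(f(\mathrm{Crit}(f)\cap K)\big)=0$, where $\mu$ is Lebesgue measure on $\mathbb{R}^m$.
   Context: For a Hilbert space $H$ and $d,m\in\mathbb{N}$, $\mathscr{P}^m_d(H)$ is the set of maps $f:H\to\mathbb{R}^m$ that are $C^1$ in the Fréchet sense, whose differential $Df:H\to\mathcal{L}(H,\mathbb{R}^m)$ is weakly continuous (continuous from the weak topology of $H$ to the norm topology) and locally Lipschitz, and such that for every finite-dimensional linear subspace $E\subset H$ the restriction $f|_E$ is a polynomial map (each component is a polynomial in linear coordinates on $E$) of degree at most $d$. For $K\subset H$ and $n\in\mathbb{N}$, the Kolmogorov $n$-width is $\Omega_n(K,H)=\inf_{\dim E=n}\sup_{u\in K}\inf_{v\in E}\|u-v\|$, the infimum over $n$-dimensional linear subspaces $E\subset H$. For a $C^1$ map $f$, $\mathrm{Crit}_\nu(f)=\{x:\operatorname{rank}(D_xf)\le\nu\}$ and $\mathrm{Crit}(f)=\mathrm{Crit}_{m-1}(f)$. For a relatively compact $S\subset\mathbb{R}^m$,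 $M(\varepsilon,S)$ is the minimal number of closed balls of radius $\varepsilon$ covering $S$ and the entropy dimension is $\dim_e(S)=\limsup_{\varepsilon\to0^+}\ln M(\varepsilon,S)/\ln(1/\varepsilon)$. *)

(* Defs.v *)
From HB Require Import structures.
From mathcomp Require Import all_boot all_order all_algebra.
From mathcomp Require Import all_classical all_reals all_analysis.
From mathcomp Require Import Rstruct Rstruct_topology.


Set Implicit Arguments.
Unset Strict Implicit.
Unset Printing Implicit Defensive.

Import Order.TTheory GRing.Theory Num.Theory.
Import numFieldNormedType.Exports.

Local Open Scope classical_set_scope.
Local Open Scope ring_scope.

Notation RR := Rdefinitions.R.

(* A real Hilbert space: a complete normed space whose norm satisfies the
   parallelogram law (i.e. comes from an inner product, Jordan--von Neumann). *)
Definition parallelogram_law (V : normedModType RR) : Prop :=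
  forall x y : V, `|x + y| ^+ 2 + `|x - y| ^+ 2 = 2 * (`|x| ^+ 2 + `|y| ^+ 2).

Definition cont_lin_functional (V : normedModType RR) (phi : V -> RR) : Prop :=
  (forall (a : RR) (x y : V), phi (a *: x + y) = a * phi x + phi y)
  /\ continuous phi.

(* The differential D_x f is 'd f x : V -> 'rV_m.  Operator-norm estimates
   ||A - B||_op <= c are written  forall h, |A h - B h| <= c |h|. *)

Definition frechet_C1 (V : normedModType RR) (m : nat) (f : V -> 'rV[RR]_m) :=
  (forall x, differentiable f x) /\
  (forall (x : V) (eps : RR), 0 < eps -> exists2 del : RR, 0 < del &
     forall y : V, `|y - x| < del ->
       forall h : V, `|'d f y h - 'd f x h| <= eps * `|h|).

(* Df is continuous from the weak topology of V to the norm topology of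
   L(H,R^m): every point x has a basic weak neighbourhood
   {y | |phi_i (y - x)| < del, i < k} (phi_i continuous linear functionals)
   on which ||D_y f - D_x f||_op <= eps. *)
Definition weakly_continuous_diff (V : normedModType RR) (m : nat)
    (f : V -> 'rV[RR]_m) :=
  forall (x : V) (eps : RR), 0 < eps ->
    exists (k : nat) (phi : 'I_k -> V -> RR) (del : RR),
      [/\ forall i, cont_lin_functional (phi i), 0 < del &
          forall y : V, (forall i, `|phi i (y - x)| < del) ->
            forall h : V, `|'d f y h - 'd f x h| <= eps * `|h| ].

Definition locally_lipschitz_diff (V : normedModType RR) (m : nat)
    (f : V -> 'rV[RR]_m) :=
  forall x : V, exists (r L : RR), 0 < r /\
    forall y z : V, `|y - x| < r -> `|z - x| < r ->
      forall h : V, `|'d f y h - 'd f z h| <= L * `|y - z| * `|h|.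

Definition is_poly_deg_le (k d : nat) (g : ('I_k -> RR) -> RR) : Prop :=
  exists c : {ffun 'I_k -> 'I_d.+1} -> RR,
    (forall a : {ffun 'I_k -> 'I_d.+1}, (d < \sum_(i < k) (a i : nat))%N -> c a = 0) /\
    forall t : 'I_k -> RR,
      g t = \sum_(a : {ffun 'I_k -> 'I_d.+1}) c a * \prod_(i < k) t i ^+ a i.

Definition lin_indep (V : normedModType RR) (k : nat) (e : 'I_k -> V) : Prop :=
  forall t : 'I_k -> RR, \sum_(i < k) t i *: e i = 0 -> forall i, t i = 0.

Definition poly_on_fin_dim (V : normedModType RR) (m d : nat)
    (f : V -> 'rV[RR]_m) : Prop :=
  forall (k : nat) (e : 'I_k -> V), lin_indep e ->
    forall j : 'I_m, is_poly_deg_le d (fun t => f (\sum_(i < k) t i *: e i) ord0 j).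

Definition in_Pmd (V : normedModType RR) (m d : nat) (f : V -> 'rV[RR]_m) :=
  [/\ frechet_C1 f, weakly_continuous_diff f, locally_lipschitz_diff f
    & poly_on_fin_dim d f].

Definition rank_diff_le (V : normedModType RR) (m : nat) (f : V -> 'rV[RR]_m)
    (x : V) (nu : nat) : Prop :=
  exists w : 'I_nu -> 'rV[RR]_m, forall h : V,
    exists t : 'I_nu -> RR, 'd f x h = \sum_(i < nu) t i *: w i.

Definition Crit_nu (V : normedModType RR) (m : nat) (f : V -> 'rV[RR]_m)
    (nu : nat) : set V := [set x | rank_diff_le f x nu].

(* Crit(f) = Crit_{m-1}(f) (used only for m >= 1) *)
Definition Crit (V : normedModType RR) (m : nat) (f : V -> 'rV[RR]_m) : set V :=
  Crit_nu f m.-1.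

Definition dist_span (V : normedModType RR) (n : nat) (e : 'I_n -> V) (u : V) : RR :=
  inf [set `|u - \sum_(i < n) t i *: e i| | t in [set: 'I_n -> RR]].

(* Omega_n(K,H): inf over subspaces E of dimension <= n (spans of n vectors)
   of sup_{u in K} dist(u, E). *)
Definition kolmogorov_width (V : normedModType RR) (K : set V) (n : nat) : RR :=
  inf [set sup [set dist_span e u | u in K] | e in [set: 'I_n -> V]].

Definition eucl_dist (m : nat) (x y : 'rV[RR]_m) : RR :=
  Num.sqrt (\sum_(i < m) (x ord0 i - y ord0 i) ^+ 2).

Definition closed_eball (m : nat) (c : 'rV[RR]_m) (r : RR) : set 'rV[RR]_m :=
  [set y | eucl_dist c y <= r].

(* M(eps, S): the minimal number of closed balls of radius eps covering S
   (+oo if there is no finite cover) *)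
Definition covering_number (m : nat) (eps : RR) (S : set 'rV[RR]_m) : \bar RR :=
  ereal_inf [set ((k%:R : RR)%:E) | k in
    [set k : nat | exists c : 'I_k -> 'rV[RR]_m,
       S `<=` \bigcup_(i in [set: 'I_k]) closed_eball (c i) eps]].

Definition entropy_dim (m : nat) (S : set 'rV[RR]_m) : \bar RR :=
  limf_esup (fun eps : RR => match covering_number eps S with
                            | EFin M => (ln M / ln (eps^-1))%:E
                            | _ => +oo%E end) (0^'+).

Definition closed_box (m : nat) (a b : 'rV[RR]_m) : set 'rV[RR]_m :=
  [set y | forall i, a ord0 i <= y ord0 i <= b ord0 i].

Definition lebesgue_null (m : nat) (S : set 'rV[RR]_m) : Prop :=
  forall eps : RR, 0 < eps ->
    exists a b : nat -> 'rV[RR]_m,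
      [/\ forall n i, a n ord0 i <= b n ord0 i,
          S `<=` \bigcup_n closed_box (a n) (b n) &
          (\sum_(n <oo) ((\prod_(i < m) (b n ord0 i - a n ord0 i))%:E) <= eps%:E)%E].

(* Main.v *)
(* Sard's theorem is replaced by a count of points. Let N points of
   Crit_nu f `&` K have values that are pairwise at distance at least 4 eps.
   Cover K by finitely many balls on which Df is Lipschitz, and project the
   points of one ball on an n-dimensional space close to K: this gives points at
   which the polynomial p = f|_E has almost rank nu, i.e. for suitable rows s the
   function h(t, a) = sum_ij (d_i p_j - sum_l a_jl d_i p_(s l))^2 / eps^2 is
   bounded.

   For a target y close to the value of such a point and a base point s,
   minimise |p - y|^2 + eps^2 h + (eps / rho)^2 |z - s|^2. With
   w = (p - y) / eps the critical point equation reads Psi(z, w) = s,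
   Y(z, w) = y with polynomials Psi, Y in n + m variables of degree bounded
   independently of n. When y runs through a fine lattice, only few minimisers
   are almost degenerate zeros; the others are moved along the fibre of Psi to a
   grid in m of the coordinates, and by a Bezout bound each point of this grid is
   reached from at most (D + 1)^(n + m) clusters. In a cluster the targets lie
   close to a nu-plate, whence N <= C b^n eps^(-nu), with b depending on d and m
   only. Finally n is chosen proportional to ln (1 / eps), as the width decays
   like q^(-n). *)
Require Import Defs.
From HB Require Import structures.
From mathcomp Require Import all_boot all_order all_algebra.
From mathcomp Require Import all_classical all_reals all_analysis.
From mathcomp Require Import Rstruct Rstruct_topology.
From mathcomp Require Import perm ring lra zify.

Import Order.TTheory GRing.Theory Num.Theory.
Import numFieldNormedType.Exports.
Local Open Scope classical_set_scope.
Local Open Scope ring_scope.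

Set Implicit Arguments.
Unset Strict Implicit.
Unset Printing Implicit Defensive.

(** * Polynomial expressions *)

(** A ball of dimension n has about eps^-n cells of side eps, far more than b^n eps^-nu; hence the
    count never covers the domain. Only m coordinates are cut into cells, and all other directions
    are left to Bezout, whose bound is merely exponential in n. But Bezout needs equations with
    nondegenerate zeros, while almost critical points satisfy inequalities only: the minimisation
    produces the equations, and varying y and s over a lattice makes at least half of the zeros
    nondegenerate in a quantitative sense.

    The thresholds for the lattice and for the cell size depend on n, eps and the polynomials in an
    uncontrolled way. This is harmless because both sizes cancel in the final count.

    The origin of the base: h has degree at most 2d + 2 and Psi at most 2d + 3, so Bezout
    contributes (2d + 4)^n; the remaining dependence on the dimension is polynomial of degree at
    most 3m and is absorbed by 2^(3mn). The coefficients a are variables, and not part of the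
    choice, so that for each of the finitely many s there is a single polynomial h. *)

Lemma coord_le_norm (R : realType) n (x : 'rV[R]_n) i : `|x ord0 i| <= `|x|.
Proof.
rewrite [leRHS]mx_normrE.
by rewrite (le_trans _ (le_bigmax _ _ (ord0, i))).
Qed.

Lemma norm_le_coord (R : realType) n (x : 'rV[R]_n) c :
  0 <= c -> (forall i, `|x ord0 i| <= c) -> `|x| <= c.
Proof.
move=> c0 H; rewrite [leLHS]mx_normrE.
by apply/bigmax_leP; split => //= -[i j] _ /=; rewrite ord1.
Qed.

Lemma norm_coord_eq (R : realType) n (x : 'rV[R]_n) :
  x != 0 -> exists i, `|x ord0 i| = `|x|.
Proof.
move=> x0; have /mx_norm_neq0 [[i j] /=] : mx_norm x != 0.
  by apply: contra_neq x0 => /mx_norm_eq0.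
by rewrite ord1 => H; exists j.
Qed.

Lemma norm_mulmx_le (R : realType) n m (x : 'rV[R]_n) (A : 'M[R]_(n, m)) c :
  0 <= c -> (forall i j, `|A i j| <= c) -> `|x *m A| <= n%:R * c * `|x|.
Proof.
move=> c0 H; apply: norm_le_coord => [|j].
  by rewrite !mulr_ge0.
rewrite mxE (le_trans (ler_norm_sum _ _ _))//.
have -> : n%:R * c * `|x| = \sum_(i < n) (`|x| * c).
  by rewrite sumr_const card_ord -mulrA [c * _]mulrC mulr_natl.
apply: ler_sum => i _; rewrite normrM ler_pM//.
exact: coord_le_norm.
Qed.

(** Syntax trees rather than normal forms: derivatives, degree bounds and Taylor estimates go by
    structural recursion, and monomials appear only where they are counted. *)
Inductive pexp (R : Type) (n : nat) :=
| PC of R | PX of 'I_n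
| PAdd of pexp R n & pexp R n | PMul of pexp R n & pexp R n.
Arguments PC {R n}.
Arguments PX {R n}.

Fixpoint pev (R : realType) n (e : pexp R n) (x : 'rV[R]_n) : R :=
  match e with
  | PC c => c
  | PX i => x ord0 i
  | PAdd a b => pev a x + pev b x
  | PMul a b => pev a x * pev b x
  end.

Fixpoint pd (R : realType) n (i : 'I_n) (e : pexp R n) : pexp R n :=
  match e with
  | PC c => PC 0
  | PX j => PC (j == i)%:R
  | PAdd a b => PAdd (pd i a) (pd i b)
  | PMul a b => PAdd (PMul (pd i a) b) (PMul a (pd i b))
  end.

(* A syntactic upper bound of the degree; unlike the degree it does not drop
   under [pd]. *)
Fixpoint pdeg (R : realType) n (e : pexp R n) : nat :=
  match e with
  | PC c => 0
  | PX j => 1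
  | PAdd a b => maxn (pdeg a) (pdeg b)
  | PMul a b => pdeg a + pdeg b
  end.

Lemma pdeg_pd (R : realType) n i (e : pexp R n) : (pdeg (pd i e) <= pdeg e)%N.
Proof. by elim: e => //= [a IHa b IHb|a IHa b IHb]; lia. Qed.

(** One constant serves for value, increment and second-order error, so that the induction closes:
    in a product the second-order error consists of two such errors, each times a value, and of a
    product of two increments, whence [3 * K * L]. *)
Lemma pexp_taylor (R : realType) n (e : pexp R n) (r : R) :
  exists2 K : R, 0 <= K & forall x y : 'rV[R]_n, `|x| <= r -> `|y| <= r ->
   [/\ `|pev e x| <= K, `|pev e y - pev e x| <= K * `|y - x| &
    `|pev e y - pev e x - \sum_i (y - x) ord0 i * pev (pd i e) x|
       <= K * `|y - x| ^+ 2].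
Proof.
elim: e => [c|i|a [K K0 IHa] b [L L0 IHb]|a [K K0 IHa] b [L L0 IHb]] /=.
- exists `|c| => // x y _ _; split=> //; first by rewrite subrr normr0 mulr_ge0.
  rewrite subrr sub0r big1 ?oppr0 ?normr0 ?mulr_ge0// => i _.
  by rewrite mulr0.
- exists (Num.max 1 r) => [|x y xr yr]; first by rewrite le_max ler01.
  have m1 : 1 <= Num.max 1 r by rewrite le_max lexx.
  have m0 : 0 <= Num.max 1 r by rewrite (le_trans ler01).
  split.
  + by rewrite (le_trans (coord_le_norm _ _))// (le_trans xr)// le_max lexx orbT.
  + have := coord_le_norm (y - x) i; rewrite !mxE => h.
    by rewrite (le_trans h)// ler_peMl.
  + rewrite (bigD1 i)//= eqxx mulr1 big1 ?addr0.
      by rewrite !mxE subrr normr0 mulr_ge0// exprn_ge0.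
    by move=> j /negPf; rewrite eq_sym => ->; rewrite mulr0.
- exists (K + L) => [|x y xr yr]; first exact: addr_ge0.
  have [A1 A2 A3] := IHa x y xr yr; have [B1 B2 B3] := IHb x y xr yr.
  split.
  + by rewrite (le_trans (ler_normD _ _))// lerD.
  + have -> : pev a y + pev b y - (pev a x + pev b x) =
       (pev a y - pev a x) + (pev b y - pev b x) by ring.
    by rewrite (le_trans (ler_normD _ _))// mulrDl lerD.
  + under eq_bigr do rewrite mulrDr.
    rewrite big_split /=; set s1 := \sum_i _; set s2 := \sum_i _.
    have -> : pev a y + pev b y - (pev a x + pev b x) - (s1 + s2) =
       (pev a y - pev a x - s1) + (pev b y - pev b x - s2) by ring.
    by rewrite (le_trans (ler_normD _ _))// mulrDl lerD.
- exists (3 * K * L) => [|x y xr yr]; first by rewrite !mulr_ge0.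
  have [A1 A2 A3] := IHa x y xr yr; have [B1 B2 B3] := IHb x y xr yr.
  have [A1' _ _] := IHa y x yr xr; have [B1' _ _] := IHb y x yr xr.
  have KL : 0 <= K * L by rewrite mulr_ge0.
  split.
  + rewrite normrM (le_trans (ler_pM _ _ A1 B1))//; lra.
  + have -> : pev a y * pev b y - pev a x * pev b x =
       (pev a y - pev a x) * pev b y + pev a x * (pev b y - pev b x) by ring.
    rewrite (le_trans (ler_normD _ _))// !normrM.
    have h1 : `|pev a y - pev a x| * `|pev b y| <= K * `|y - x| * L by rewrite ler_pM.
    have h2 : `|pev a x| * `|pev b y - pev b x| <= K * (L * `|y - x|) by rewrite ler_pM.
    have h3 : 0 <= K * L * `|y - x| by rewrite mulr_ge0.
    apply: le_trans (lerD h1 h2) _.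
    have -> : K * `|y - x| * L + K * (L * `|y - x|) = 2 * (K * L * `|y - x|) by ring.
    have -> : 3 * K * L * `|y - x| = 3 * (K * L * `|y - x|) by ring.
    lra.
  + under eq_bigr do rewrite mulrDr mulrA [X in _ + X]mulrCA.
    rewrite big_split /= -mulr_suml -mulr_sumr.
    set s1 := \sum_i _; set s2 := \sum_i _.
    have -> : pev a y * pev b y - pev a x * pev b x - (s1 * pev b x + pev a x * s2) =
       (pev a y - pev a x - s1) * pev b x + pev a x * (pev b y - pev b x - s2)
       + (pev a y - pev a x) * (pev b y - pev b x) by ring.
    have h1 : `|pev a y - pev a x - s1| * `|pev b x| <= K * `|y - x| ^+ 2 * L
      by rewrite ler_pM.
    have h2 : `|pev a x| * `|pev b y - pev b x - s2| <= K * (L * `|y - x| ^+ 2)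
      by rewrite ler_pM.
    have h3 : `|pev a y - pev a x| * `|pev b y - pev b x| <= K * `|y - x| * (L * `|y - x|)
      by rewrite ler_pM.
    rewrite (le_trans (ler_normD _ _))// (le_trans (lerD (ler_normD _ _) (lexx _)))//.
    rewrite !normrM; apply: le_trans (lerD (lerD h1 h2) h3) _.
    rewrite le_eqVlt; apply/orP; left; apply/eqP; ring.
Qed.

Definition polymap (R : realType) n m (G : 'I_m -> pexp R n) (x : 'rV[R]_n) : 'rV[R]_m :=
  \row_i pev (G i) x.

(* Row-vector convention: [polymap G (x + v)] is [polymap G x + v *m pjac G x] to
   first order. *)
Definition pjac (R : realType) n m (G : 'I_m -> pexp R n) (x : 'rV[R]_n) :
  'M[R]_(n, m) := \matrix_(l, i) pev (pd l (G i)) x.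

Lemma ex2_ex T (P Q : T -> Prop) : (exists2 x, P x & Q x) -> exists x, P x /\ Q x.
Proof. by case=> x px qx; exists x. Qed.

Lemma polymap_taylor (R : realType) n m (G : 'I_m -> pexp R n) (r : R) :
  exists2 K : R, 0 < K & forall x y : 'rV[R]_n, `|x| <= r -> `|y| <= r ->
   [/\ forall l i, `|pjac G x l i| <= K,
       forall l i, `|pjac G y l i - pjac G x l i| <= K * `|y - x| ,
      `|polymap G y - polymap G x| <= K * `|y - x| &
    `|polymap G y - polymap G x - (y - x) *m pjac G x| <= K * `|y - x| ^+ 2].
Proof.
have [K1 hK1] := choice (fun i => ex2_ex (pexp_taylor (G i) r)).
have [K2 hK2] := choice (fun li : 'I_n * 'I_m => ex2_ex (pexp_taylor (pd li.1 (G li.2)) r)).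
pose S1 := \sum_i K1 i; pose S2 := \sum_li K2 li.
have S1i i : K1 i <= S1.
  by rewrite /S1 (bigD1 i)//= lerDl sumr_ge0// => j _; case: (hK1 j).
have S2i i : K2 i <= S2.
  by rewrite /S2 (bigD1 i)//= lerDl sumr_ge0// => j _; case: (hK2 j).
have S10 : 0 <= S1 by rewrite sumr_ge0// => j _; case: (hK1 j).
have S20 : 0 <= S2 by rewrite sumr_ge0// => j _; case: (hK2 j).
exists (S1 + S2 + 1) => [|x y xr yr]; first by lra.
split.
- move=> l i; rewrite mxE; have [_ /(_ x y xr yr) [h _ _]] := hK2 (l, i).
  by apply: le_trans h _; have := S2i (l, i); lra.
- move=> l i; rewrite !mxE; have [_ /(_ x y xr yr) [_ h _]] := hK2 (l, i).
  by apply: le_trans h _; apply: ler_wpM2r => //; have := S2i (l, i); lra.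
- apply: norm_le_coord => [|i]; first by rewrite mulr_ge0//; lra.
  rewrite !mxE; have [_ /(_ x y xr yr) [_ h _]] := hK1 i.
  by apply: le_trans h _; apply: ler_wpM2r => //; have := S1i i; lra.
- apply: norm_le_coord => [|i]; first by rewrite mulr_ge0 ?exprn_ge0//; lra.
  rewrite !mxE; have [_ /(_ x y xr yr) [_ _ h]] := hK1 i.
  rewrite (eq_bigr (fun l => (y - x) ord0 l * pev (pd l (G i)) x)); last first.
    by move=> l _; rewrite !mxE.
  apply: le_trans h _; apply: ler_wpM2r; first by rewrite exprn_ge0.
  by have := S1i i; lra.
Qed.

(** * A Bezout bound *)

Definition mono (R : realType) n (a : 'I_n -> nat) (x : 'rV[R]_n) : R :=
  \prod_i x ord0 i ^+ a i.

Lemma poly_fun_eq0 (R : realType) (q : {poly R}) : (forall x, q.[x] = 0) -> q = 0.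
Proof.
move=> H; apply/eqP; apply: contraT => q0.
have := @max_poly_roots _ q [seq k%:R | k <- iota 0 (size q)] q0.
rewrite size_map size_iota ltnn => -> //.
  by apply/allP => _ /mapP[k _ ->]; rewrite rootE H.
by rewrite map_inj_uniq ?iota_uniq// => i j /eqP; rewrite eqr_nat => /eqP.
Qed.

Lemma digits_inj (b n : nat) (f g : 'I_n -> nat) :
  (forall i, f i < b)%N -> (forall i, g i < b)%N ->
  (\sum_i f i * b ^ i = \sum_i g i * b ^ i)%N -> f =1 g.
Proof.
elim: n f g => [|n IH] f g fb gb; first by move=> _ [].
have b0 : (0 < b)%N by apply: leq_ltn_trans (fb ord0).
rewrite !big_ord_recl !expn0 !muln1.
have E (h : 'I_n.+1 -> nat) : (\sum_(i < n) h (lift ord0 i) * b ^ lift ord0 i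
    = (\sum_(i < n) h (lift ord0 i) * b ^ i) * b)%N.
  by rewrite big_distrl; apply: eq_bigr => i _; rewrite /= /bump /= add1n expnSr mulnA.
rewrite !E => H.
have H0 : f ord0 = g ord0.
  by move: (congr1 (modn^~ b) H); rewrite /= ![(_ + _ * b)%N]addnC !modnMDl !modn_small.
have H1 : (\sum_(i < n) f (lift ord0 i) * b ^ i = \sum_(i < n) g (lift ord0 i) * b ^ i)%N.
  move: (congr1 (divn^~ b) H).
  by rewrite /= ![(_ + _ * b)%N]addnC !divnMDl// !divn_small// !addn0.
move=> i; case: (unliftP ord0 i) => [j|] -> //.
exact: (IH (fun j => f (lift ord0 j)) (fun j => g (lift ord0 j))).
Qed.

(** Kronecker's substitution x_i = x^((K + 1)^i) turns distinct monomials with exponents at most [K]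
    into distinct powers of one variable, by uniqueness of digits in base K + 1. *)
Lemma mono_free (R : realType) n K (A : {pred n.-tuple 'I_K.+1})
    (c : n.-tuple 'I_K.+1 -> R) :
  (forall y, \sum_(a in A) c a * mono (tnth a) y = 0) ->
  forall a, a \in A -> c a = 0.
Proof.
move=> H a0 a0A.
pose w (a : n.-tuple 'I_K.+1) := (\sum_i tnth a i * K.+1 ^ i)%N.
have winj : injective w.
  move=> a b /digits_inj E; apply: eq_from_tnth => i; apply: val_inj.
  by apply: E => j; exact: ltn_ord.
pose q : {poly R} := \sum_(a in A) c a *: 'X^(w a).
have q0 : q = 0.
  apply: poly_fun_eq0 => x; rewrite /q horner_sum.
  rewrite -[RHS](H (\row_i x ^+ (K.+1 ^ i))); apply: eq_bigr => a _.
  rewrite hornerZ hornerXn /w expr_sum /mono; congr (_ * _).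
  by apply: eq_bigr => i _; rewrite mxE -exprM mulnC.
move/(congr1 (fun p : {poly R} => p`_(w a0))): q0.
rewrite coef0 /q coef_sum (bigD1 a0)//= coefZ coefXn eqxx mulr1 big1 ?addr0//.
move=> a /andP[_ na]; rewrite coefZ coefXn; case: eqP => [/winj E|]; rewrite ?mulr0//.
by rewrite E eqxx in na.
Qed.

(** * Monomial expansions and the dimension count *)

Definition mterm (R : realType) n := (R * {ffun 'I_n -> nat})%type.

Fixpoint mlist (R : realType) n (e : pexp R n) : seq (mterm R n) :=
  match e with
  | PC c => [:: (c, [ffun=> 0%N])]
  | PX i => [:: (1, [ffun j => nat_of_bool (j == i)])]
  | PAdd a b => mlist a ++ mlist b
  | PMul a b => [seq ((s : mterm R n).1 * (t : mterm R n).1,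
      [ffun i => ((s : mterm R n).2 i + (t : mterm R n).2 i)%N]) |
      s <- mlist a, t <- mlist b]
  end.

Lemma mlistE (R : realType) n (e : pexp R n) x :
  pev e x = \sum_(t <- mlist e) t.1 * mono t.2 x.
Proof.
elim: e => [c|i|a IHa b IHb|a IHa b IHb] /=.
- by rewrite big_seq1 /mono /= big1 ?mulr1// => i _; rewrite ffunE.
- rewrite big_seq1 /mono /= mul1r (bigD1 i)//= ffunE eqxx big1 ?mulr1//.
  by move=> j /negPf ji; rewrite ffunE ji.
- by rewrite big_cat /= IHa IHb.
- rewrite big_allpairs_dep /= IHa IHb mulr_suml; apply: eq_bigr => s _.
  rewrite mulr_sumr; apply: eq_bigr => t _; rewrite mulrACA; congr (_ * _).
  by rewrite /mono -big_split; apply: eq_bigr => i _; rewrite ffunE exprD.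
Qed.

Lemma mlist_deg (R : realType) n (e : pexp R n) t :
  t \in mlist e -> (\sum_i t.2 i <= pdeg e)%N.
Proof.
elim: e t => [c|i|a IHa b IHb|a IHa b IHb] t /=.
- by rewrite inE => /eqP -> /=; rewrite big1// => i _; rewrite ffunE.
- rewrite inE => /eqP -> /=; rewrite (bigD1 i)//= ffunE eqxx big1//.
  by move=> j /negPf ji; rewrite ffunE ji.
- by rewrite mem_cat => /orP[/IHa|/IHb] h; rewrite (leq_trans h)// leq_max leqnn ?orbT.
- case/allpairsPdep => s [u [/IHa hs /IHb hu ->]] /=.
  under eq_bigr do rewrite ffunE.
  by rewrite big_split leq_add.
Qed.

(** Otherwise the matrix of coefficients with respect to the monomials of degree at most [K] has
    more rows than columns, and a nonzero vector of its left kernel is a linear relation. *)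
Lemma free_pexp_card (R : realType) n K (T : finType) (E : T -> pexp R n) :
  (forall t, (pdeg (E t) <= K)%N) ->
  (forall c : T -> R, (forall x, \sum_t c t * pev (E t) x = 0) -> forall t, c t = 0) ->
  (#|T| <= 'C(n + K, n))%N.
Proof.
move=> dE fE; rewrite -card_partial_ord_partitions.
pose U := [set t : n.-tuple 'I_K.+1 | (\sum_(i <- t) i <= K)%N]%SET.
rewrite -/U leqNgt; apply/negP => lt.
pose ce t (u : n.-tuple 'I_K.+1) : R :=
  \sum_(s <- mlist (E t) | s.2 == [ffun i => nat_of_ord (tnth u i)]) s.1.
have evE t x : pev (E t) x = \sum_(u in U) ce t u * mono (tnth u) x.
  rewrite mlistE /ce; under [RHS]eq_bigr do rewrite mulr_suml big_mkcond.
  rewrite exchange_big /=; rewrite !big_seq; apply: eq_bigr => s sE.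
  have hs := leq_trans (mlist_deg sE) (dE t).
  have hsi i : (s.2 i < K.+1)%N.
    by rewrite ltnS (leq_trans _ hs)// (bigD1 i)//= leq_addr.
  pose u0 : n.-tuple 'I_K.+1 := [tuple inord (s.2 i) | i < n].
  have u0E i : tnth u0 i = s.2 i :> nat by rewrite tnth_mktuple inordK.
  have u0U : u0 \in U.
    rewrite inE big_tuple (leq_trans _ hs)//.
    by rewrite leq_eqVlt; apply/orP; left; apply/eqP; apply: eq_bigr => i _; rewrite u0E.
  rewrite (bigD1 u0)//= big1 ?addr0.
    rewrite ifT; last by apply/eqP/ffunP => i; rewrite ffunE u0E.
    by congr (_ * _); rewrite /mono; apply: eq_bigr => i _; rewrite u0E.
  move=> u /andP[_ uu0]; rewrite ifF//; apply: contraNF uu0 => /eqP su.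
  by apply/eqP/eq_from_tnth => i; apply: val_inj; rewrite /= u0E su ffunE.
pose C : 'M[R]_(#|T|, #|U|) := \matrix_(i, j) ce (enum_val i) (enum_val j).
have : kermx C != 0.
  by rewrite kermx_eq0 /row_free neq_ltn (leq_ltn_trans (rank_leq_col C)).
case/rowV0Pn => v /sub_kermxP vC v0.
have : v = 0.
  apply/rowP => j; rewrite mxE.
  have := fE (fun t => v ord0 (enum_rank t)) _ (enum_val j).
  rewrite enum_valK; apply => x.
  under eq_bigr do rewrite evE mulr_sumr.
  rewrite exchange_big /= big1// => u uU.
  under eq_bigr do rewrite mulrA.
  rewrite -mulr_suml (reindex_onto enum_val enum_rank) /=; last by move=> *; rewrite enum_rankK.
  move/rowP/(_ (enum_rank_in uU u)): vC; rewrite !mxE => vC.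
  rewrite [X in X * _](_ : _ = 0) ?mul0r// -[RHS]vC.
  apply: eq_big => [i|i _]; first by rewrite enum_valK eqxx.
  by rewrite enum_valK mxE enum_rankK_in.
by move/eqP; rewrite (negPf v0).
Qed.

Definition pprod (R : realType) n (s : seq (pexp R n)) : pexp R n :=
  foldr (@PMul R n) (PC 1) s.

Definition psum (R : realType) n (s : seq (pexp R n)) : pexp R n :=
  foldr (@PAdd R n) (PC 0) s.

Lemma pev_pprod (R : realType) n (s : seq (pexp R n)) x :
  pev (pprod s) x = \prod_(e <- s) pev e x.
Proof. by elim: s => [|e s IH] /=; rewrite ?big_nil// big_cons IH. Qed.

Lemma pdeg_pprod (R : realType) n (s : seq (pexp R n)) :
  pdeg (pprod s) = (\sum_(e <- s) pdeg e)%N.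
Proof. by elim: s => [|e s IH] /=; rewrite ?big_nil// big_cons IH. Qed.

Lemma pev_psum (R : realType) n (s : seq (pexp R n)) x :
  pev (psum s) x = \sum_(e <- s) pev e x.
Proof. by elim: s => [|e s IH] /=; rewrite ?big_nil// big_cons IH. Qed.

Lemma pev_pd_psum (R : realType) n (s : seq (pexp R n)) l x :
  pev (pd l (psum s)) x = \sum_(e <- s) pev (pd l e) x.
Proof. by elim: s => [|e s IH] /=; rewrite ?big_nil// big_cons IH. Qed.

(** The restriction of [e] to the line through [x] with direction [v], as a polynomial in the
    parameter: orders of vanishing at [x] become powers of the variable. *)
Fixpoint pline (R : realType) n (x v : 'rV[R]_n) (e : pexp R n) : {poly R} :=
  match e with
  | PC c => c%:P
  | PX i => (x ord0 i)%:P + v ord0 i *: 'X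
  | PAdd a b => pline x v a + pline x v b
  | PMul a b => pline x v a * pline x v b
  end.

Lemma plineE (R : realType) n (x v : 'rV[R]_n) e (t : R) :
  (pline x v e).[t] = pev e (x + t *: v).
Proof.
elim: e => [c|i|a IHa b IHb|a IHa b IHb] /=.
- by rewrite hornerC.
- by rewrite hornerD hornerC hornerZ hornerX !mxE mulrC.
- by rewrite hornerD IHa IHb.
- by rewrite hornerM IHa IHb.
Qed.

Lemma pline_deriv (R : realType) n (x v : 'rV[R]_n) e (t : R) :
  (pline x v e)^`().[t] = \sum_l v ord0 l * pev (pd l e) (x + t *: v).
Proof.
elim: e => [c|i|a IHa b IHb|a IHa b IHb] /=.
- by rewrite derivC horner0 big1// => l _; rewrite mulr0.
- rewrite derivD derivC add0r derivZ derivX hornerZ hornerC mulr1.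
  rewrite (bigD1 i)//= eqxx mulr1 big1 ?addr0// => l /negPf.
  by rewrite eq_sym => ->; rewrite mulr0.
- rewrite derivD hornerD IHa IHb -big_split; apply: eq_bigr => l _.
  by rewrite mulrDr.
- rewrite derivM hornerD !hornerM IHa IHb !plineE mulr_suml mulr_sumr -big_split.
  by apply: eq_bigr => l _ /=; rewrite mulrDr mulrA [in RHS]mulrCA.
Qed.

(** The falling factorials are compared factor by factor: n + E k - i <= E (n + k - i) for i < n. As
    this holds for every k, the Bezout bound can be read off without a limit in the degree. *)
Lemma leq_bin_scale (E k n : nat) : (0 < E)%N ->
  ('C(n + E * k, n) <= E ^ n * 'C(n + k, n))%N.
Proof.
move=> E0; rewrite -(leq_pmul2r (fact_gt0 n)) -mulnA !bin_ffact !ffact_prod.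
rewrite -[X in (E ^ X)%N]card_ord -prod_nat_const -big_split /=.
by apply: leq_prod => i _; have := ltn_ord i; nia.
Qed.

(* Let L_k be 1 at P_k and 0 at the other zeros. By comparing leading terms at
   the P_l, where G - t is a local coordinate system, the polynomials
   L_k * (G - t)^a with |a| <= N are linearly independent; their degree is at
   most (D + 1) * N, and one counts monomials. *)
Lemma bezout (R : realType) n D N (G : 'I_n -> pexp R n) (t : 'rV[R]_n)
    (P : 'I_N -> 'rV[R]_n) :
  (forall i, (pdeg (G i) <= D)%N) -> injective P ->
  (forall k, polymap G (P k) = t) -> (forall k, pjac G (P k) \in unitmx) ->
  (N <= D.+1 ^ n)%N.
Proof.
move=> dG Pinj PG Pu.
pose g i := PAdd (G i) (PC (- t ord0 i)).
have gP i k : pev (g i) (P k) = 0.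
  by rewrite /= -(PG k) mxE subrr.
(* An affine function of one coordinate in which [P k] and [P l] differ, equal to 1 at [P k] and to
   0 at [P l]. The default occurs only for [k = l]. *)
pose fac k l : pexp R n :=
  if [pick i | P k ord0 i != P l ord0 i] is Some i then
    PMul (PC (P k ord0 i - P l ord0 i)^-1) (PAdd (PX i) (PC (- P l ord0 i)))
  else PC 1.
have fac_deg k l : (pdeg (fac k l) <= 1)%N by rewrite /fac; case: pickP.
have fac1 k l : pev (fac k l) (P k) = 1.
  by rewrite /fac; case: pickP => //= i ni; rewrite mulVf// subr_eq0.
have fac0 k l : k != l -> pev (fac k l) (P l) = 0.
  rewrite /fac; case: pickP => [i ni|H] /=; first by rewrite subrr mulr0.
  case/eqP; apply: Pinj; apply/rowP => i.
  by have := H i; case: eqP.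
pose L k := pprod [seq fac k l | l <- enum 'I_N & l != k].
have Ldeg k : (pdeg (L k) <= N)%N.
  rewrite pdeg_pprod big_map (@leq_trans (\sum_(l <- enum 'I_N) 1)%N)//.
    rewrite big_filter big_mkcond; apply: leq_sum => l _.
    by case: ifP.
  by rewrite sum1_size size_enum_ord.
have L1 k : pev (L k) (P k) = 1.
  by rewrite pev_pprod big_map big1.
have L0 k l : k != l -> pev (L k) (P l) = 0.
  move=> kl; rewrite pev_pprod big_map (big_rem l)/=.
    by rewrite fac0// mul0r.
  by rewrite mem_filter mem_enum eq_sym kl.
(* The same [N] bounds the degree of [L k] and the exponents, so that the products have degree at
   most [D.+1 * N] and [leq_bin_scale] applies with [E = D.+1]. *)
pose A := {t : n.-tuple 'I_N.+1 | (\sum_(i <- t) i <= N)%N}.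
pose ga (a : A) := pprod (flatten [seq nseq (tnth (val a) i) (g i) | i <- enum 'I_n]).
pose sz (a : A) := (\sum_i tnth (val a) i)%N.
have gaE (a : A) x : pev (ga a) x = \prod_i pev (g i) x ^+ tnth (val a) i.
  rewrite pev_pprod big_flatten big_map big_enum; apply: eq_bigr => i _.
  by rewrite big_nseq iter_mulr_1.
have gadeg (a : A) : (pdeg (ga a) <= D * N)%N.
  rewrite pdeg_pprod big_flatten big_map big_enum /=.
  apply: (@leq_trans (\sum_i D * tnth (val a) i)%N).
    apply: leq_sum => i _; rewrite big_nseq iter_addn_0 leq_mul2r.
    by rewrite /= maxn0 dG orbT.
  by rewrite -big_distrr leq_mul2l -(big_tuple _ _ _ xpredT (@nat_of_ord _)) (valP a) orbT.
pose T := ('I_N * A)%type.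
pose E (q : T) := PMul (L q.1) (ga q.2).
have dE q : (pdeg (E q) <= D.+1 * N)%N.
  by rewrite /= mulSn leq_add.
have fE (c : T -> R) : (forall x, \sum_q c q * pev (E q) x = 0) -> forall q, c q = 0.
  (* Strong induction on the order of vanishing at the zeros: the coefficients of all terms of lower
     order are already known to vanish. *)
  move=> H; suff W r q : sz q.2 = r -> c q = 0 by move=> q; exact: (W _ q erefl).
  elim/ltn_ind: r q => r IH [l a0] /= sa0.
  have key (y : 'rV[R]_n) : \sum_(a | sz a == r) c (l, a) * mono (tnth (val a)) y = 0.
    (* In this direction [G - t] is [x * y] to first order in the parameter [x]. The coefficient of
       x^r at [P l] is thus a polynomial in the arbitrary vector [y], and [mono_free] applies to
       it. *)
    pose v := y *m invmx (pjac G (P l)).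
    pose gl i := pline (P l) v (g i).
    have gl0 i : root (gl i) 0.
      by rewrite rootE plineE scale0r addr0 gP.
    have /choice[s hs] i : exists s, gl i = s * 'X.
      by have /factor_theorem[s] := gl0 i; rewrite subr0 => ?; exists s.
    have s0 i : (s i).[0] = y ord0 i.
      have : (gl i)^`().[0] = (v *m pjac G (P l)) ord0 i.
        rewrite pline_deriv scale0r addr0 mxE; apply: eq_bigr => j _.
        by congr (_ * _); rewrite mxE /= addr0.
      by rewrite mulmxKV// hs derivM derivX mulr1 hornerD hornerMX mulr0 add0r.
    pose q1 : {poly R} := \sum_(q : T | (r <= sz q.2)%N) c q *:
      (pline (P l) v (L q.1) * \prod_i s i ^+ tnth (val q.2) i * 'X^(sz q.2 - r)).
    have : q1 * 'X^r = 0.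
      apply: poly_fun_eq0 => x; rewrite -[RHS](H (P l + x *: v)).
      rewrite (bigID (fun q : T => (r <= sz q.2)%N)) /= [X in _ + X]big1 ?addr0; last first.
        by move=> q; rewrite -ltnNge => qr; rewrite (IH _ qr)// mul0r.
      rewrite /q1 mulr_suml horner_sum; apply: eq_bigr => q rq.
      rewrite -scalerAl hornerZ; congr (_ * _).
      rewrite !hornerM plineE horner_prod !hornerXn gaE -!mulrA; congr (_ * _).
      rewrite -exprD subnK// /sz expr_sum -big_split; apply: eq_bigr => i _.
      by rewrite -[in RHS]plineE -/(gl i) hs /= hornerMX horner_exp exprMn.
    move/eqP; rewrite mulf_eq0 expf_eq0 polyX_eq0 andbF orbF => /eqP q10.
    move/(congr1 (fun p : {poly R} => p.[0])): q10; rewrite horner0 /q1 horner_sum => E0; rewrite -[RHS]E0.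
    (* At 0 the terms with another index vanish because of [L k], and those of order above [r]
       because of a remaining power of the variable. *)
    rewrite [RHS](bigID (fun q : T => (q.1 == l) && (sz q.2 == r))) /=.
    rewrite [X in _ = _ + X]big1 ?addr0; last first.
      move=> [k a] /= /andP[ra]; rewrite hornerZ !hornerM plineE scale0r addr0 => nn.
      have [kl|kl] := eqVneq k l; last by rewrite L0// !mul0r mulr0.
      move: nn; rewrite kl eqxx /= => nn.
      by rewrite hornerXn expr0n subn_eq0 leqNgt ltn_neqAle eq_sym nn ra !mulr0.
    rewrite [RHS](reindex_onto (fun a => (l, a)) snd) /=; last first.
      by move=> [k a] /= /andP[_ /andP[/eqP -> _]].
    apply: eq_big => [a|a /eqP sa].
      by rewrite !eqxx /= andbT; case: eqP => [->|]; rewrite ?leqnn ?andbF.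
    rewrite hornerZ !hornerM plineE scale0r addr0 L1 mul1r sa subnn expr0 hornerC mulr1.
    by rewrite horner_prod; congr (_ * _); apply: eq_bigr => i _; rewrite horner_exp s0.
  pose c' (a : n.-tuple 'I_N.+1) : R :=
    if insub a is Some a' then (if sz a' == r then c (l, a') else 0) else 0.
  have := @mono_free R n N [pred a : n.-tuple 'I_N.+1 | (\sum_(i <- a) i <= N)%N] c' _ (val a0) (valP a0).
  rewrite /c' valK sa0 eqxx; apply => y; rewrite -[RHS](key y).
  rewrite [RHS]big_mkcond /= [LHS](reindex_omap (val : A -> _) insub) /=; last first.
    by move=> a aA; rewrite insubT.
  apply: eq_big => [a|a _]; first by rewrite inE (valP a) valK eqxx.
  by rewrite valK; case: eqP => //; rewrite mul0r.
have := free_pexp_card dE fE.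
rewrite card_prod card_ord card_sig.
rewrite (_ : #|_| = 'C(n + N, n)); last first.
  rewrite -card_partial_ord_partitions cardsE; apply: eq_card => a.
  by rewrite !inE.
have : (0 < 'C(n + N, n))%N by rewrite bin_gt0 leq_addr.
move=> C0 /leq_trans/(_ (leq_bin_scale _ _ _)) => /(_ isT).
by rewrite leq_pmul2r.
Qed.

(** * Counting lemmas *)

Lemma card_le_fibers (T : finType) (U : eqType) (f : T -> U) (s : seq U)
    (A : {set T}) X :
  (forall x, x \in A -> f x \in s) ->
  (forall u, u \in s -> #|[set x in A | f x == u]%SET| <= X)%N ->
  (#|A| <= size s * X)%N.
Proof.
elim: s A => [|u s IH] A fs HX.
  by rewrite leqn0 cards_eq0; apply/eqP/setP => x; rewrite inE; apply: contraTF isT => /fs.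
rewrite -(cardsID [set x | f x == u]%SET A) mulSn leq_add//.
  have -> : (A :&: [set x | f x == u] = [set x in A | f x == u])%SET.
    by apply/setP => x; rewrite !inE.
  by apply: HX; rewrite mem_head.
apply: IH => [x|v vs].
  by rewrite !inE => /andP[/negPf xu /fs]; rewrite inE xu.
apply: leq_trans (HX v _); last by rewrite inE vs orbT.
apply/subset_leq_card/fintype.subsetP => x; rewrite !inE.
by move=> /andP[/andP[_ ->] ->].
Qed.

Lemma card_le_fibers_fin (T U : finType) (f : T -> U) (A : {set T}) X :
  (forall u, #|[set x in A | f x == u]%SET| <= X)%N -> (#|A| <= #|U| * X)%N.
Proof.
move=> HX; rewrite [#|U|]cardE; apply: (@card_le_fibers _ _ f) => // x _.
exact: mem_enum.
Qed.

(** Residues serve as coordinates. No box has to be located, only differences have to be small, and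
    smallness in one direction may be derived after equality in the others. *)
Lemma card_box_le n B (S : {set {ffun 'I_n -> 'I_B}}) (w : 'I_n -> nat) :
  (forall i, 0 < w i)%N ->
  (forall b b', b \in S -> b' \in S -> (forall i, b i = b' i %[mod w i]) -> b = b') ->
  (#|S| <= \prod_i w i)%N.
Proof.
move=> w0 H.
pose F (b : {ffun 'I_n -> 'I_B}) : {dffun forall i, 'I_(w i)} :=
  [ffun i => Ordinal (ltn_pmod (b i) (w0 i))].
have := @leq_card_in _ _ F S _; rewrite card_dep_ffun foldrE big_map big_enum /=.
under eq_bigr do rewrite card_ord.
apply=> b b' bS b'S Fb; apply: H => // i.
by move/ffunP/(_ i): Fb; rewrite !ffunE => /(congr1 val).
Qed.

Lemma truncn_eq_dist (R : realType) (x y : R) : 0 <= x -> 0 <= y ->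
  Num.truncn x = Num.truncn y -> `|x - y| <= 1.
Proof.
move=> x0 y0 E.
have /andP[h1 h2] := truncn_itv x0; have /andP[h3 h4] := truncn_itv y0.
rewrite E in h1 h2; rewrite -natr1 in h2; rewrite -natr1 in h4.
by rewrite ler_norml; apply/andP; split; lra.
Qed.

Lemma det_le (R : realType) n (M : 'M[R]_n) c :
  (forall i j, `|M i j| <= c) -> `|\det M| <= n`!%:R * c ^+ n.
Proof.
move=> H; rewrite (le_trans (ler_norm_sum _ _ _))//.
have -> : n`!%:R * c ^+ n = \sum_(s : {perm 'I_n}) c ^+ n.
  by rewrite mulr_natl sumr_const card_Sn.
apply: ler_sum => s _; rewrite normrM normr_sign mul1r normr_prod.
rewrite -[X in c ^+ X]card_ord -prodr_const; apply: ler_prod => i _.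
by rewrite normr_ge0 H.
Qed.

Lemma norm_normalize (R : realType) n (v : 'rV[R]_n) :
  v != 0 -> `|(`|v|^-1 *: v)| = 1.
Proof.
by move=> v0; rewrite normrZ normfV normr_id mulVf// normr_eq0.
Qed.

(** If all entries of the inverse were at most [eta^-1], the Leibniz formula would bound its
    determinant by n! eta^-n. So some row of the inverse is long, and normalising it gives the
    vector. *)
Lemma small_det_vector (R : realType) n (M : 'M[R]_n) (eta : R) : 0 < eta ->
  `|\det M| < eta ^+ n / n`!%:R -> exists2 u : 'rV[R]_n, `|u| = 1 & `|u *m M| <= eta.
Proof.
move=> eta0 dM.
have [d0|dn0] := boolP (\det M == 0).
  have /det0P[v v0 vM] := d0.
  exists (`|v|^-1 *: v); first exact: norm_normalize.
  by rewrite -scalemxAl vM scaler0 normr0 ltW.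
have Mu : M \in unitmx by rewrite unitmxE unitfE.
have [|] := pselect (forall i j, `|invmx M i j| <= eta^-1).
  move=> /det_le; rewrite det_inv normfV exprVn => h.
  suff : eta ^+ n / n`!%:R <= `|\det M| by rewrite leNgt dM.
  rewrite -lef_pV2 ?posrE ?normr_gt0// ?divr_gt0 ?exprn_gt0 ?ltr0n ?fact_gt0//.
  by rewrite invfM invrK mulrC.
move=> /existsNP[i /existsNP[j /negP]]; rewrite -ltNge => h.
pose u := row i (invmx M).
have uj : eta^-1 < `|u|.
  by rewrite (lt_le_trans h)//; have := coord_le_norm u j; rewrite mxE.
have u0 : u != 0.
  by rewrite -normr_gt0 (lt_trans _ uj)// invr_gt0.
exists (`|u|^-1 *: u); first exact: norm_normalize.
rewrite -scalemxAl -row_mul mulVmx// normrZ normfV normr_id.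
have h1 : `|row i (1%:M : 'M[R]_n)| <= 1.
  apply: norm_le_coord => // k; rewrite !mxE; case: (_ == _); rewrite ?normr1 ?normr0//.
have up : 0 < `|u| by rewrite normr_gt0.
rewrite ler_pdivrMl// (le_trans h1)//.
by rewrite -ler_pdivrMr// div1r ltW.
Qed.

Lemma eq_mod_near (R : realType) (a b m : nat) :
  a = b %[mod m] -> `|a%:R - b%:R : R| < m%:R -> a = b.
Proof.
move=> ab; wlog le : a b ab / (b <= a)%N => [W|].
  case/orP: (leq_total b a) => [/W|le]; first exact.
  by rewrite distrC => /W; move=> /(_ (esym ab) le).
rewrite -natrB// normr_nat ltr_nat => lt.
move/eqP: ab; rewrite eqn_mod_dvd// => /dvdn_leq; case: (posnP (a - b)) => [|p /(_ isT)].
  by move=> /eqP; rewrite subn_eq0 => l _; apply/eqP; rewrite eqn_leq l.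
by rewrite leqNgt lt.
Qed.

(* Cut the ball into O(h^-n) cubes of side h. If the Jacobian almost vanishes
   somewhere on a cube, then the image of the cube lies in a slab of width
   O(eta h), hence contains O(eta (h B)^n) lattice points. *)
Lemma lattice_sard (R : realType) n (G : 'I_n -> pexp R n) (r : R) : 0 < r ->
  exists2 eta : R, 0 < eta & exists B0 : nat, forall B, (B0 <= B)%N ->
  forall (o : 'rV[R]_n) (P : {ffun 'I_n -> 'I_B} -> 'rV[R]_n),
  (forall b, `|P b| <= r) ->
  (forall b, polymap G (P b) = \row_i (o ord0 i + (b i)%:R / B%:R)) ->
  (2 * #|[set b | (`|\det (pjac G (P b))| < eta)%R]%SET| <= B ^ n)%N.
Proof.
move=> r0; have [K' K'0 taylor] := polymap_taylor G r.
pose K := K' + 1.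
have K1 : 1 <= K by rewrite /K; lra.
have K'K : K' <= K by rewrite /K; lra.
clearbody K.
have [n0|n_gt0] := posnP n.
  exists 1 => //; exists 0%N => B _ o P _ _.
  rewrite eq_card0 ?muln0// => b; rewrite !inE; apply/negbTE; rewrite -leNgt.
  by subst n; rewrite det_mx00 normr1.
have nR : 1 <= n%:R :> R by rewrite ler1n.
(* Twice the constant of the final count: [(4 * r) ^+ n] comes from the number of cells,
   [(2 * K) ^+ n] and [5 * n%:R] from the sides of the slab in a cell. With [eta1 = c1^-1] at most
   half of the lattice is bad. *)
pose c1 : R := 10 * n%:R * (4 * r) ^+ n * (2 * K) ^+ n.
have c10 : 0 < c1 by rewrite !mulr_gt0 ?exprn_gt0 ?mulr_gt0//; lra.
pose eta1 := c1^-1.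
have e10 : 0 < eta1 by rewrite invr_gt0.
have e1c : c1 * eta1 = 1 by rewrite divff// gt_eqF.
clearbody eta1.
(* So many cells that [K * h <= eta1]: the quadratic Taylor remainder on a cell is then at most
   [h * eta1], the order of the linear part in the direction [u]. *)
pose E := (Num.truncn (2 * r * K / eta1)).+1.
pose h : R := 2 * r / E%:R.
have E0 : 0 < E%:R :> R by rewrite ltr0n.
have h0 : 0 < h by rewrite divr_gt0// mulr_gt0.
have Kh : K * h <= eta1.
  have q0 : 0 <= 2 * r * K / eta1 by rewrite !mulr_ge0// ?invr_ge0 ?ltW//; lra.
  have /andP[_] := truncn_itv q0; rewrite -/E ltr_pdivrMr// => /ltW h1.
  by rewrite /h mulrA ler_pdivrMr// [eta1 * _]mulrC (le_trans _ h1)// mulrC.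
have hE2 : h * E%:R = 2 * r by rewrite divfK// gt_eqF.
clearbody h.
exists (eta1 ^+ n / n`!%:R); first by rewrite divr_gt0 ?exprn_gt0 ?ltr0n ?fact_gt0.
exists ((Num.truncn h^-1).+1 + (Num.truncn (n%:R * h * eta1)^-1).+1)%N => B BB0 o P Pr PG.
(* [B] is so large that the added 1 in [X.+1] and in [Y.+1] costs only a constant factor. *)
have B1 : 1 <= h * B%:R.
  rewrite -ler_pdivrMl// mulr1.
  have hi : 0 <= h^-1 by rewrite invr_ge0 ltW.
  have /andP[_ /ltW/le_trans] := truncn_itv hi; apply.
  by rewrite ler_nat; move: BB0; clear; lia.
have B2 : 1 <= n%:R * h * eta1 * B%:R.
  have p0 : 0 < n%:R * h * eta1 by rewrite !mulr_gt0// ltr0n.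
  rewrite -ler_pdivrMl// mulr1.
  have hi : 0 <= (n%:R * h * eta1)^-1 by rewrite invr_ge0 ltW.
  have /andP[_ /ltW/le_trans] := truncn_itv hi; apply.
  by rewrite ler_nat; move: BB0; clear; lia.
have Bpos : 0 < B%:R :> R.
  by rewrite lt0r ler0n andbT; apply: contraTneq B1 => ->; rewrite mulr0 -ltNge ltr01.
set bad := [set b | _]%SET.
have cellP b i : (Num.truncn ((P b ord0 i + r) / h) < E.+1)%N.
  have := coord_le_norm (P b) i => /le_trans/(_ (Pr b)); rewrite ler_norml => /andP[l1 l2].
  have q0 : 0 <= (P b ord0 i + r) / h by rewrite divr_ge0 ?(ltW h0)//; lra.
  rewrite truncn_lt_nat// ltr_pdivrMr// -natr1 mulrDl mul1r [_ * h]mulrC hE2; lra.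
pose cell b : {ffun 'I_n -> 'I_E.+1} := [ffun i => Ordinal (cellP b i)].
have cell_dist b b' : cell b = cell b' -> `|P b - P b'| <= h.
  move=> /ffunP cE; apply: norm_le_coord => [|i]; first exact: ltW.
  have := cE i; rewrite !ffunE => /(congr1 val) /= tE.
  have q0 c : 0 <= (P c ord0 i + r) / h.
    rewrite divr_ge0 ?(ltW h0)//.
    have := coord_le_norm (P c) i => /le_trans/(_ (Pr c)); rewrite ler_norml; lra.
  have := truncn_eq_dist (q0 b) (q0 b') tE.
  rewrite -mulrBl normrM [X in _ * X]gtr0_norm ?invr_gt0// ler_pdivrMr// mul1r !mxE.
  by rewrite (_ : P b ord0 i + r - (P b' ord0 i + r) = P b ord0 i - P b' ord0 i)//; ring.
pose X := Num.truncn (K * h * B%:R).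
pose Y := Num.truncn (4 * n%:R * h * eta1 * B%:R).
have fib e : (#|[set b in bad | cell b == e]%SET| <= X.+1 ^ n.-1 * Y.+1)%N.
  set S := [set b in _ | _]%SET.
  have [->|[b0 b0S]] := set_0Vmem S; first by rewrite cards0.
  have SP b : b \in S -> `|P b - P b0| <= h.
    rewrite inE => /andP[_ /eqP ce]; apply: cell_dist.
    by move: b0S; rewrite inE ce => /andP[_ /eqP ->].
  have [u u1 uM] : exists2 u : 'rV_n, `|u| = 1 & `|u *m (pjac G (P b0))^T| <= eta1.
    apply: small_det_vector => //; rewrite det_tr.
    by move: b0S; rewrite inE => /andP[]; rewrite inE.
  (* The norm is the maximum norm, so some coordinate of [u] has modulus 1. When all other
     coordinates agree, the slab bounds the difference in this one. *)
  have [i0 ui0] : exists i, `|u ord0 i| = 1.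
    have u0 : u != 0 by rewrite -normr_gt0 u1.
    by have [i iE] := norm_coord_eq u0; exists i; rewrite iE.
  have bE (b : {ffun 'I_n -> 'I_B}) i : (b i)%:R = B%:R * (polymap G (P b) ord0 i - o ord0 i) :> R.
    by rewrite PG mxE addrC addKr mulrC divfK// gt_eqF.
  have dX (b b' : {ffun 'I_n -> 'I_B}) : b \in S -> b' \in S -> forall i, `|(b i)%:R - (b' i)%:R : R| <= K * h * B%:R.
    move=> bS b'S i; rewrite !bE -mulrBr opprB addrA subrK normrM [X in X * _]gtr0_norm// mulrC.
    rewrite ler_wpM2r ?(ltW Bpos)//.
    have [_ _ t2 _] := taylor _ _ (Pr b') (Pr b).
    have := coord_le_norm (polymap G (P b) - polymap G (P b')) i; rewrite !mxE => /le_trans; apply.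
    apply: le_trans t2 _; rewrite ler_pM//; first exact: ltW.
    apply: cell_dist; move: bS b'S; rewrite !inE => /andP[_ /eqP ->] /andP[_ /eqP ->//].
  have dY (b : {ffun 'I_n -> 'I_B}) : b \in S -> `|\sum_i u ord0 i * ((b i)%:R - (b0 i)%:R)| <= 2 * n%:R * h * eta1 * B%:R.
    move=> bS.
    have -> : \sum_i u ord0 i * ((b i)%:R - (b0 i)%:R) =
        B%:R * (\sum_i u ord0 i * (polymap G (P b) - polymap G (P b0)) ord0 i).
      rewrite mulr_sumr; apply: eq_bigr => i _; rewrite !bE [(_ - polymap _ _) _ _]mxE.
      rewrite [(- polymap _ _) _ _]mxE; ring.
    rewrite normrM [X in X * _]gtr0_norm// mulrC ler_wpM2r ?(ltW Bpos)//.
    have [_ _ _ t3] := taylor _ _ (Pr b0) (Pr b).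
    set v := P b - P b0 in t3; set J := pjac G (P b0) in t3 uM.
    set w := polymap G (P b) - polymap G (P b0) in t3 *.
    have -> : \sum_i u ord0 i * w ord0 i = \sum_i u ord0 i * (w - v *m J) ord0 i +
        \sum_l v ord0 l * (u *m J^T) ord0 l.
      have -> : \sum_l v ord0 l * (u *m J^T) ord0 l = \sum_i u ord0 i * (v *m J) ord0 i.
        have uE l : (u *m J^T) ord0 l = \sum_i u ord0 i * J l i.
          by rewrite mxE; apply: eq_bigr => i _; congr (_ * _); rewrite mxE.
        have vE i : (v *m J) ord0 i = \sum_l v ord0 l * J l i by rewrite mxE.
        under eq_bigr do rewrite uE mulr_sumr.
        under [RHS]eq_bigr do rewrite vE mulr_sumr.
        rewrite exchange_big /=; apply: eq_bigr => i _; apply: eq_bigr => l _.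
        by rewrite mulrCA.
      rewrite -big_split; apply: eq_bigr => i _ /=.
      by rewrite -mulrDr; congr (_ * _); rewrite [(w - _) _ _]mxE [(- (v *m J)) _ _]mxE subrK.
    have bnd (x y : 'rV[R]_n) a b' : `|x| <= a -> `|y| <= b' ->
        `|\sum_i x ord0 i * y ord0 i| <= n%:R * (a * b').
      move=> xa yb; rewrite (le_trans (ler_norm_sum _ _ _))//.
      rewrite mulr_natl -[X in _ *+ X]card_ord -sumr_const; apply: ler_sum => i _.
      by rewrite normrM ler_pM// (le_trans (coord_le_norm _ _)).
    have vh : `|v| <= h by exact: SP.
    rewrite (le_trans (ler_normD _ _))//.
    have r1 : `|\sum_i u ord0 i * (w - v *m J) ord0 i| <= n%:R * (1 * (K' * h ^+ 2)).
      apply: bnd; first by rewrite u1.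
      apply: le_trans t3 _; apply: ler_wpM2l; first exact: ltW.
      by apply: lerXn2r vh; rewrite nnegrE// ltW.
    have r2 := bnd _ _ _ _ vh uM.
    apply: le_trans (lerD r1 r2) _.
    have hh : K' * h ^+ 2 <= h * eta1.
      rewrite expr2 mulrA [leLHS]mulrC; apply: ler_wpM2l; first exact: ltW.
      by apply: le_trans Kh; apply: ler_wpM2r => //; exact: ltW.
    have := ler_wpM2l (ler0n R n) hh; rewrite mul1r; lra.
  pose w i := if i == i0 then Y.+1 else X.+1.
  have -> : (X.+1 ^ n.-1 * Y.+1 = \prod_i w i)%N.
    rewrite (bigD1 i0)//= {1}/w eqxx mulnC; congr (_ * _)%N.
    rewrite (eq_bigr (fun=> X.+1)) => [|i /negPf ne]; last by rewrite /w ne.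
    rewrite prod_nat_const; congr (_ ^ _)%N.
    by rewrite cardC1 card_ord.
  apply: card_box_le => [i|b b' bS b'S H]; first by rewrite /w; case: ifP.
  have e1 i : i != i0 -> b i = b' i.
    move=> ne; apply: val_inj; apply: (@eq_mod_near R) (H i) _; rewrite /w (negPf ne).
    apply: le_lt_trans (dX _ _ bS b'S i) _.
    have kh0 : 0 <= K * h * B%:R by rewrite !mulr_ge0// ltW//; lra.
    by have /andP[] := truncn_itv kh0.
  apply/ffunP => i; have [->|] := eqVneq i i0; last exact: e1.
  apply: val_inj; apply: (@eq_mod_near R) (H i0) _; rewrite /w eqxx.
  have y0 : 0 <= 4 * n%:R * h * eta1 * B%:R by rewrite !mulr_ge0// ltW//; lra.
  have /andP[_] := truncn_itv y0; apply: le_lt_trans.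
  have -> : `|(b i0)%:R - (b' i0)%:R : R| = `|\sum_i u ord0 i * ((b i)%:R - (b0 i)%:R) -
       \sum_i u ord0 i * ((b' i)%:R - (b0 i)%:R)|.
    rewrite -sumrB (bigD1 i0)//= big1 ?addr0 => [|j /e1 ->]; last by rewrite subrr.
    by rewrite -mulrBr normrM ui0 mul1r; congr (`|_|); ring.
  rewrite (le_trans (ler_normB _ _))// (le_trans (lerD (dY _ bS) (dY _ b'S)))//; lra.
have := card_le_fibers_fin fib; rewrite card_ffun !card_ord => tot.
rewrite -(ler_nat R) natrM.
have tot' : #|bad|%:R <= E.+1%:R ^+ n * (X.+1%:R ^+ n.-1 * Y.+1%:R) :> R.
  by rewrite -!natrX -!natrM ler_nat.
have hX : X.+1%:R <= 2 * K * h * B%:R.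
  have kh0 : 0 <= K * h * B%:R by rewrite !mulr_ge0// ltW//; lra.
  have /andP[hX1 _] := truncn_itv kh0.
  have : 1 * 1 <= K * (h * B%:R) by rewrite ler_pM.
  rewrite -natr1 /X; lra.
have hY : Y.+1%:R <= 5 * n%:R * h * eta1 * B%:R.
  have y0 : 0 <= 4 * n%:R * h * eta1 * B%:R by rewrite !mulr_ge0// ltW//; lra.
  have /andP[hY1 _] := truncn_itv y0.
  rewrite -natr1 /Y; lra.
have hE : E.+1%:R * h <= 4 * r.
  rewrite -natr1 mulrDl mulrC hE2 mul1r.
  have : 1 <= E%:R :> R by rewrite ler1n.
  by move/(ler_wpM2l (ltW h0)); rewrite hE2 mulr1; lra.
have fin : E.+1%:R ^+ n * (X.+1%:R ^+ n.-1 * Y.+1%:R) <=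
    (E.+1%:R * h) ^+ n * (2 * K) ^+ n.-1 * (5 * n%:R * eta1) * B%:R ^+ n :> R.
  have -> : (E.+1%:R * h) ^+ n * (2 * K) ^+ n.-1 * (5 * n%:R * eta1) * B%:R ^+ n =
     E.+1%:R ^+ n * ((2 * K * h * B%:R) ^+ n.-1 * (5 * n%:R * h * eta1 * B%:R)).
    rewrite -[in LHS](prednK n_gt0) -[in RHS](prednK n_gt0) /=.
    rewrite !exprMn !exprS; ring.
  rewrite ler_wpM2l ?exprn_ge0// ler_pM ?exprn_ge0// lerXn2r ?nnegrE//.
  by rewrite (le_trans _ hX).
rewrite natrX; apply: le_trans (ler_wpM2l _ (le_trans tot' fin)) _ => //.
have Bn : 0 <= B%:R ^+ n :> R by rewrite exprn_ge0.
rewrite mulrA -[leRHS]mul1r ler_wpM2r//.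
have f1 : (E.+1%:R * h) ^+ n <= (4 * r) ^+ n.
  by rewrite lerXn2r ?nnegrE ?mulr_ge0// ltW.
have f2 : (2 * K) ^+ n.-1 <= (2 * K) ^+ n.
  by rewrite ler_weXn2l ?leq_pred//; lra.
have f3 : (E.+1%:R * h) ^+ n * (2 * K) ^+ n.-1 <= (4 * r) ^+ n * (2 * K) ^+ n.
  by rewrite ler_pM ?exprn_ge0// ?mulr_ge0 ?(ltW h0)//; lra.
have f4 : 0 <= 5 * n%:R * eta1 by rewrite !mulr_ge0// ltW.
have := ler_wpM2r f4 f3.
have -> : (4 * r) ^+ n * (2 * K) ^+ n * (5 * n%:R * eta1) = c1 * eta1 / 2 by rewrite /c1; field.
rewrite e1c; lra.
Qed.

(** * Local solutions and fibre counting *)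

Lemma pev_continuous (R : realType) n (e : pexp R n) : continuous (pev e).
Proof.
elim: e => [c|i|a IHa b IHb|a IHa b IHb] x /=.
- exact: cst_continuous.
- exact: coord_continuous.
- exact: (@continuousD _ _ _ (pev a) (pev b) x (IHa x) (IHb x)).
- exact: (@continuousM _ _ (pev a) (pev b) x (IHa x) (IHb x)).
Qed.

Lemma pexp_min (R : realType) n (e : pexp R n) (c : 'rV[R]_n) (r : R) : 0 <= r ->
  exists2 x, `|x - c| <= r & forall y, `|y - c| <= r -> pev e x <= pev e y.
Proof.
move=> r0; pose A := [set x : 'rV[R]_n | `|x - c| <= r].
have A0 : A !=set0 by exists c; rewrite /A /= subrr normr0.
have cA : compact A.
  apply: bounded_closed_compact.
    exists (`|c| + r); split; first exact: num_real.
    move=> M cM x /= Ax; rewrite (le_trans _ (ltW cM))//.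
    by rewrite -(subrK c x) (le_trans (ler_normD _ _))// addrC lerD2l.
  rewrite (_ : A = closed_ball_ Num.norm c r); first exact: closed_closed_ball_.
  by apply/seteqP; split=> x; rewrite /A /closed_ball_ /= distrC.
have [x xA xmin] := EVT_min_rV A0 cA (continuous_subspaceT (@pev_continuous R n e)).
exists x; first by rewrite inE in xA.
by move=> y yA; apply: xmin; rewrite inE.
Qed.

(** Otherwise a step [- t * g] against the derivative [g] lowers the value by about t g^2, which for
    small t beats the Taylor remainder K (t g)^2 without leaving the ball. *)
Lemma pexp_crit (R : realType) n (e : pexp R n) (c x : 'rV[R]_n) (r : R) :
  `|x - c| < r -> (forall y, `|y - c| <= r -> pev e x <= pev e y) ->
  forall l, pev (pd l e) x = 0.
Proof.
move=> xr xmin l; set g := pev _ _; apply/eqP; apply: contraT => g0.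
have [K K0 taylor] := pexp_taylor e (`|c| + r).
pose t : R := Num.min (2 * (K + 1))^-1 ((r - `|x - c|) / (`|g| + 1)).
have t0 : 0 < t.
  rewrite lt_min; apply/andP; split; first by rewrite invr_gt0 mulr_gt0//; lra.
  by rewrite divr_gt0 ?subr_gt0//; have := normr_ge0 g; lra.
have tK : t * (2 * (K + 1)) <= 1.
  rewrite -ler_pdivlMr ?mul1r; last by lra.
  by rewrite /t ge_min lexx.
have tr : t * (`|g| + 1) <= r - `|x - c|.
  rewrite -ler_pdivlMr; last by have := normr_ge0 g; lra.
  by rewrite /t ge_min lexx orbT.
pose v : 'rV[R]_n := (- (t * g)) *: delta_mx ord0 l.
have vE i : v ord0 i = - (t * g) * (i == l)%:R by rewrite !mxE eqxx.
have vn : `|v| <= t * `|g|.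
  apply: norm_le_coord => [|i]; first by rewrite mulr_ge0// ltW.
  rewrite vE normrM normrN normrM gtr0_norm//.
  by case: (_ == _); rewrite ?normr1 ?normr0 ?mulr1// mulr0 mulr_ge0// ltW.
have yc : `|x + v - c| <= r.
  rewrite (_ : x + v - c = (x - c) + v); last by rewrite addrAC.
  rewrite (le_trans (ler_normD _ _))//; nra.
have bnd y : `|y - c| <= r -> `|y| <= `|c| + r.
  by move=> h; rewrite -(subrK c y) (le_trans (ler_normD _ _))// addrC lerD2l.
have [_ _] := taylor x (x + v) (bnd _ (ltW xr)) (bnd _ yc).
rewrite [x + v - x]addrC addKr (bigD1 l)//= big1 => [|i /negPf il]; last first.
  by rewrite vE il mulr0 mul0r.
rewrite addr0 vE eqxx mulr1 -/g ler_norml => /andP[_].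
have := xmin _ yc.
have v2 : K * `|v| ^+ 2 <= K * (t * `|g|) ^+ 2.
  by rewrite ler_wpM2l// lerXn2r ?nnegrE ?mulr_ge0// ltW.
have : (t * `|g|) ^+ 2 = t * (t * g ^+ 2).
  by rewrite exprMn real_normK ?num_real//; ring.
have g2 : 0 < g ^+ 2 by rewrite lt0r sqr_ge0 sqrf_eq0 g0.
have : 0 < t * g ^+ 2 by rewrite mulr_gt0.
move: v2 tK t0 K0; rewrite expr2.
set A := `|v| ^+ 2; set u := t * (g * g).
move=> h1 h2 h3 h4 h5 h6 h7 h8.
have : - (t * g) * g = - u by rewrite /u; ring.
have : K * (t * u) <= u / 2.
  have : (t * (2 * (K + 1))) * u <= u by rewrite -[leRHS]mul1r ler_wpM2r// ltW.
  have : 0 <= t * u by rewrite mulr_ge0// ltW.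
  nra.
rewrite h6 in h1; lra.
Qed.

Lemma inv_entry_bound (R : realType) n (M : 'M[R]_n) (c eta : R) :
  0 < eta -> 0 <= c -> (forall i j, `|M i j| <= c) -> eta <= `|\det M| ->
  M \in unitmx /\ forall i j, `|invmx M i j| <= n.-1`!%:R * c ^+ n.-1 / eta.
Proof.
move=> eta0 c0 Mc dM.
have Mu : M \in unitmx.
  by rewrite unitmxE unitfE -normr_gt0 (lt_le_trans eta0).
split=> // i j; rewrite /invmx Mu !mxE normrM mulrC ler_pM//.
  rewrite /cofactor normrM normrX normrN1 expr1n mul1r det_le// => a b.
  by rewrite !mxE.
by rewrite normfV lef_pV2// posrE (lt_le_trans eta0).
Qed.

(** A quantitative inverse function theorem without iteration. The sum of squares of [G - t] is
    minimised on a small ball around [x]; no minimum can lie on the sphere, and at an interior one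
    with invertible Jacobian the residual is 0. The constants are uniform in [x] and [t]. *)
Lemma local_solve (R : realType) n (G : 'I_n -> pexp R n) (r eta : R) : 0 < eta ->
  exists C tau : R, [/\ 0 < C, 0 < tau & forall x t : 'rV[R]_n, `|x| <= r ->
    eta <= `|\det (pjac G x)| -> `|t - polymap G x| <= tau ->
    exists x', [/\ `|x' - x| <= C * `|t - polymap G x|, `|x'| <= r + 1, polymap G x' = t &
      pjac G x' \in unitmx]].
Proof.
move=> eta0; have [K K0 taylor] := polymap_taylor G (r + 1).
pose La := n.-1`!%:R * K ^+ n.-1 / eta.
have La0 : 0 <= La by rewrite !mulr_ge0 ?exprn_ge0 ?invr_ge0// ltW.
pose L := n%:R * La + 1.
have L1 : 1 <= L by rewrite /L lerDr mulr_ge0.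
pose N1 : R := n%:R + 1.
have N11 : 1 <= N1 by rewrite /N1 lerDr.
(* On this radius, after multiplication by the bound [L] for the inverse, the variation of the
   Jacobian has norm at most 1/4, and so has the Taylor remainder relative to the displacement. *)
pose r1 := Num.min 1 (4 * N1 * K * L)^-1.
have p0 : 0 < 4 * N1 * K * L by rewrite !mulr_gt0//; lra.
have r10 : 0 < r1 by rewrite lt_min ltr01 invr_gt0.
have r1_1 : r1 <= 1 by rewrite ge_min lexx.
have r1K : r1 * (4 * N1 * K * L) <= 1.
  by rewrite -ler_pdivlMr// div1r ge_min lexx orbT.
clearbody r1.
pose tau := r1 / (4 * L * N1).
have q0 : 0 < 4 * L * N1 by rewrite !mulr_gt0//; lra.
have tau0 : 0 < tau by rewrite divr_gt0.
have tq : tau * (4 * L * N1) = r1 by rewrite /tau divfK// gt_eqF.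
clearbody tau.
exists (2 * L), tau; split=> //; first by lra.
move=> x t xr dx txt.
have xr' : `|x| <= r + 1 by lra.
have Jc i j : `|pjac G x i j| <= K by have [] := taylor x x xr' xr'.
have [Ju Jinv] := inv_entry_bound eta0 (ltW K0) Jc dx.
have lowJ (v : 'rV[R]_n) : `|v| <= L * `|v *m pjac G x|.
  have := norm_mulmx_le (v *m pjac G x) La0 Jinv; rewrite mulmxK// => /le_trans; apply.
  by rewrite ler_wpM2r// /L lerDl.
pose e := psum [seq PMul (PAdd (G i) (PC (- t ord0 i))) (PAdd (G i) (PC (- t ord0 i))) | i <- enum 'I_n].
have eE y : pev e y = \sum_i (pev (G i) y - t ord0 i) ^+ 2.
  by rewrite pev_psum big_map big_enum.
have [x' x'r x'min] := pexp_min e x (ltW r10).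
have x'r' : `|x'| <= r + 1.
  by rewrite -(subrK x x') (le_trans (ler_normD _ _))//; lra.
have [_ dJ dG tG] := taylor x x' xr' x'r'.
set v := x' - x in x'r dJ dG tG.
set tx := `|t - polymap G x| in txt *.
have tx0 : 0 <= tx by exact: normr_ge0.
have ex : pev e x <= n%:R * tau ^+ 2.
  rewrite eE mulr_natl -[X in _ *+ X]card_ord -sumr_const; apply: ler_sum => i _.
  rewrite -[leLHS]real_normK ?num_real// lerXn2r ?nnegrE// ?(ltW tau0)//.
  apply: le_trans txt; rewrite distrC; apply: le_trans (coord_le_norm _ i).
  by rewrite !mxE.
(* The residual at the minimum is at most [N1 * tau]. On the sphere, [L] times the length of
   [v *m pjac G x] would therefore be at most three quarters of [r1], but it is at least [r1]. *)
have x'lt : `|v| < r1.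
  rewrite lt_neqAle x'r andbT; apply/negP => /eqP vr.
  have h1 := lowJ v.
  have h2 : `|v *m pjac G x| <= `|polymap G x' - polymap G x| + K * r1 ^+ 2.
    rewrite -vr; apply: le_trans (lerD (lexx _) tG).
    rewrite -{1}(subKr (polymap G x' - polymap G x) (v *m pjac G x)).
    exact: ler_normB.
  have h3 : `|polymap G x' - polymap G x| <= `|polymap G x' - t| + tau.
    rewrite (_ : polymap G x' - polymap G x = (polymap G x' - t) + (t - polymap G x)).
      by rewrite (le_trans (ler_normD _ _))// lerD2l.
    by rewrite addrA subrK.
  have h4 : `|polymap G x' - t| ^+ 2 <= n%:R * tau ^+ 2.
    apply: le_trans (le_trans (x'min x _) ex); last by rewrite subrr normr0 ltW.
    have [->|nz] := eqVneq (polymap G x' - t) 0.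
      by rewrite normr0 expr0n /= eE sumr_ge0// => i _; exact: sqr_ge0.
    have [i <-] := norm_coord_eq nz.
    rewrite eE (bigD1 i)//= !mxE real_normK ?num_real// lerDl sumr_ge0// => j _.
    exact: sqr_ge0.
  have h5 : `|polymap G x' - t| <= N1 * tau.
    have N10 : 0 <= N1 by exact: le_trans N11.
    have nt : 0 <= N1 * tau by rewrite mulr_ge0// ltW.
    rewrite -(@ler_pXn2r _ 2) ?nnegrE//.
    apply: le_trans h4 _; rewrite exprMn ler_wpM2r ?exprn_ge0 ?(ltW tau0)//.
    rewrite /N1; have := ler0n R n; nra.
  have h6 : L * (N1 * tau) = r1 / 4 by rewrite -tq; field.
  have h7 : L * tau <= r1 / 4.
    rewrite -h6 ler_wpM2l//; first by lra.
    by rewrite -[leLHS]mul1r ler_wpM2r// ltW.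
  have h8 : L * (K * r1 ^+ 2) <= r1 / 4.
    have k1 : r1 * (4 * K * L) <= 1.
      apply: le_trans r1K; rewrite ler_wpM2l ?(ltW r10)//.
      rewrite -[4 * N1 * K * L]/(4 * N1 * K * L) -!mulrA ler_wpM2l//.
      by rewrite mulrA -[leLHS]mul1r -mulrA ler_wpM2r// mulr_ge0// ?ltW//; lra.
    have -> : L * (K * r1 ^+ 2) = (r1 * (4 * K * L)) * r1 / 4 by field.
    rewrite ler_wpM2r// -[leRHS]mul1r ler_wpM2r//; exact: ltW.
  have h9 : L * `|v *m pjac G x| <= L * (N1 * tau + tau + K * r1 ^+ 2).
    apply: ler_wpM2l; first by lra.
    by move: h2 h3 h5; clear; lra.
  rewrite !mulrDr h6 in h9; rewrite vr in h1; lra.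
have crit l : \sum_i (polymap G x' - t) ord0 i * pjac G x' l i = 0.
  have := pexp_crit x'lt x'min l.
  rewrite pev_pd_psum big_map big_enum /= => H.
  apply: (@mulfI _ 2); first by rewrite pnatr_eq0.
  rewrite mulr0 -[RHS]H mulr_sumr; apply: eq_bigr => i _.
  by rewrite !mxE; ring.
have J'u : pjac G x' \in unitmx.
  rewrite unitmxE unitfE; apply/negP => /det0P[u u0 uJ].
  have h1 := lowJ u.
  have h2 : `|u *m pjac G x| <= n%:R * (K * r1) * `|u|.
    have -> : u *m pjac G x = - (u *m (pjac G x' - pjac G x)).
      by rewrite mulmxBr uJ sub0r opprK.
    rewrite normrN; apply: norm_mulmx_le => [|i j]; first by rewrite mulr_ge0// ltW.
    rewrite [(_ - pjac _ _) _ _]mxE [(- pjac _ _) _ _]mxE (le_trans (dJ i j))//.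
    by rewrite ler_wpM2l// ltW.
  have up : 0 < `|u| by rewrite normr_gt0.
  have h3 : L * (n%:R * (K * r1)) <= 1 / 4.
    have -> : L * (n%:R * (K * r1)) = (r1 * (4 * n%:R * K * L)) / 4 by field.
    rewrite ler_wpM2r// (le_trans _ r1K)// ler_wpM2l ?(ltW r10)//.
    by rewrite ler_wpM2r ?ler_wpM2r ?ler_wpM2l ?lerDl// ?ltW//; lra.
  have h4 : L * `|u *m pjac G x| <= L * (n%:R * (K * r1) * `|u|).
    by rewrite ler_wpM2l//; lra.
  rewrite mulrA in h4; have := ler_wpM2r (ltW up) h3; lra.
have Gt : polymap G x' = t.
  apply/eqP; rewrite -subr_eq0; apply/eqP.
  have J'T : (pjac G x')^T \in unitmx by rewrite unitmx_tr.
  apply: (can_inj (mulmxK J'T)); rewrite mul0mx; apply/rowP => l.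
  rewrite [in RHS]mxE -[RHS](crit l) mxE; apply: eq_bigr => i _; congr (_ * _).
  by rewrite mxE.
exists x'; split=> //.
rewrite Gt -/tx in tG.
have h1 := lowJ v.
have h2 : `|v *m pjac G x| <= tx + K * `|v| ^+ 2.
  apply: le_trans (lerD (lexx _) tG).
  rewrite -{1}(subKr (t - polymap G x) (v *m pjac G x)).
  exact: ler_normB.
have h3 : L * `|v *m pjac G x| <= L * (tx + K * `|v| ^+ 2) by rewrite ler_wpM2l//; lra.
have h4 : L * (K * `|v| ^+ 2) <= `|v| / 4.
  have k1 : r1 * (4 * K * L) <= 1.
    apply: le_trans r1K; rewrite ler_wpM2l ?(ltW r10)// -!mulrA ler_wpM2l//.
    by rewrite -[leLHS]mul1r ler_wpM2r// mulr_ge0// ?ltW//; lra.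
  have -> : L * (K * `|v| ^+ 2) = (`|v| * (4 * K * L)) * `|v| / 4 by field.
  rewrite ler_wpM2r// -[leRHS]mul1r ler_wpM2r// (le_trans _ k1)// ler_wpM2r ?(ltW x'lt)//.
  by rewrite !mulr_ge0// ?ltW//; lra.
have h5 : 0 <= L * tx by rewrite mulr_ge0// (le_trans ler01).
rewrite mulrDr in h3; lra.
Qed.

(** * Coordinates transversal to a fibre *)

Definition coord_mx (R : realType) m k (ga : 'I_m -> 'I_k) : 'M[R]_(k, m) :=
  \matrix_(l, j) (l == ga j)%:R.

(** Multilinearity in the last [m] columns, each of them expanded in unit vectors. *)
Lemma det_row_mx_expand (R : realType) n m (A : 'M[R]_(n + m, n))
    (W : 'M[R]_(n + m, m)) :
  \det (row_mx A W) = \sum_(ga : {ffun 'I_m -> 'I_(n + m)})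
    (\prod_j W (ga j) j) * \det (row_mx A (coord_mx R ga)).
Proof.
rewrite -det_tr; under [RHS]eq_bigr do rewrite -det_tr /determinant mulr_sumr.
rewrite exchange_big /=; apply: eq_bigr => s _.
under [RHS]eq_bigr do rewrite mulrCA.
rewrite -mulr_sumr; congr (_ * _).
rewrite big_split_ord /=.
under eq_bigr do rewrite mxE row_mxEl.
under [X in _ * X = _]eq_bigr do rewrite mxE row_mxEr.
under [RHS]eq_bigr do rewrite big_split_ord /= mulrCA.
have -> : \prod_j W (s (rshift n j)) j = \prod_j \sum_l W l j * (s (rshift n j) == l)%:R.
  apply: eq_bigr => j _; rewrite (bigD1 (s (rshift n j)))//= eqxx mulr1 big1 ?addr0//.
  by move=> l /negPf; rewrite eq_sym => ->; rewrite mulr0.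
rewrite bigA_distr_bigA /= mulr_sumr; apply: eq_bigr => ga _.
congr (_ * _); first by apply: eq_bigr => i _; rewrite mxE row_mxEl.
rewrite -big_split; apply: eq_bigr => j _ /=; congr (_ * _).
by rewrite mxE row_mxEr mxE.
Qed.

(** Each of the (n + m)^m minors of the expansion is bounded by the largest one. Hence where [Psi]
    and [Y] are jointly nondegenerate, so are [Psi] and some [m] of the coordinates, up to a fixed
    factor. *)
Lemma exists_large_coord_det (R : realType) n m (A : 'M[R]_(n + m, n))
    (W : 'M[R]_(n + m, m)) K : (forall i j, `|W i j| <= K) ->
  exists ga : {ffun 'I_m -> 'I_(n + m)},
    (forall ga' : {ffun 'I_m -> 'I_(n + m)},
       `|\det (row_mx A (coord_mx R ga'))| <= `|\det (row_mx A (coord_mx R ga))|) /\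
    `|\det (row_mx A W)| <= ((n + m)%:R * K) ^+ m * `|\det (row_mx A (coord_mx R ga))|.
Proof.
move=> WK.
pose ga0 : {ffun 'I_m -> 'I_(n + m)} := [ffun j => rshift n j].
pose F (ga : {ffun 'I_m -> 'I_(n + m)}) : R := `|\det (row_mx A (coord_mx R ga))|.
have [ga _ gaP] := @arg_maxP _ _ _ ga0 xpredT F isT.
exists ga; split=> [ga'|]; first exact: gaP.
rewrite det_row_mx_expand (le_trans (ler_norm_sum _ _ _))//.
have -> : ((n + m)%:R * K) ^+ m * F ga =
    \sum_(ga' : {ffun 'I_m -> 'I_(n + m)}) K ^+ m * F ga.
  by rewrite sumr_const card_ffun !card_ord exprMn -mulrA -natrX mulr_natl.
apply: ler_sum => ga' _; rewrite normrM ler_pM//; last exact: gaP.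
rewrite normr_prod -[X in K ^+ X]card_ord -prodr_const; apply: ler_prod => j _.
by rewrite normr_ge0 WK.
Qed.

(** By Cramer's rule the entry is the quotient of the minors of [ga'] and [ga], where [ga'] takes
    the coordinate [l] in place of [ga j]. *)
Lemma cramer_max_entry (R : realType) n m (A : 'M[R]_(n + m, n))
    (ga : {ffun 'I_m -> 'I_(n + m)}) :
  let M ga := row_mx A (coord_mx R ga) in
  (forall ga' : {ffun 'I_m -> 'I_(n + m)}, `|\det (M ga')| <= `|\det (M ga)|) ->
  M ga \in unitmx -> forall j l, `|invmx (M ga) (rshift n j) l| <= 1.
Proof.
move=> M Mmax Mu j l.
pose ga' : {ffun 'I_m -> 'I_(n + m)} := [ffun i => if i == j then l else ga i].
have E : \det (M ga') = cofactor (M ga) l (rshift n j).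
  rewrite (expand_det_col _ (rshift n j)) (bigD1 l)//= big1 ?addr0.
    rewrite /M row_mxEr mxE ffunE !eqxx mul1r /cofactor; congr (_ * \det _).
    apply/matrixP => a b; rewrite !mxE.
    set c := lift _ b; have cb : c != rshift n j by rewrite eq_sym neq_lift.
    case: (splitP c) cb => k kE cb; rewrite ?mxE//.
    rewrite ffunE ifF//; apply: contraNF cb => /eqP kj.
    by apply/eqP/ord_inj; rewrite kE kj.
  by move=> i /negPf il; rewrite /M row_mxEr mxE ffunE eqxx il mul0r.
have d0 : 0 < `|\det (M ga)|.
  by rewrite normr_gt0; move: Mu; rewrite unitmxE unitfE.
rewrite /invmx Mu !mxE -E normrM normfV mulrC ler_pdivrMr// mul1r.
exact: Mmax.
Qed.

Definition fix_coords (R : realType) n m (Psi : 'I_n -> pexp R (n + m))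
    (ga : 'I_m -> 'I_(n + m)) (i : 'I_(n + m)) : pexp R (n + m) :=
  match fintype.split i with inl a => Psi a | inr j => PX (ga j) end.

Definition join_map (R : realType) n m k (Psi : 'I_n -> pexp R k)
    (Y : 'I_m -> pexp R k) (i : 'I_(n + m)) : pexp R k :=
  match fintype.split i with inl a => Psi a | inr j => Y j end.

Lemma polymap_join (R : realType) n m k (Psi : 'I_n -> pexp R k) (Y : 'I_m -> pexp R k) x :
  polymap (join_map Psi Y) x = row_mx (polymap Psi x) (polymap Y x).
Proof.
by apply/rowP => i; rewrite !mxE /join_map; case: (fintype.split i) => j; rewrite mxE.
Qed.

Lemma pjac_join (R : realType) n m k (Psi : 'I_n -> pexp R k) (Y : 'I_m -> pexp R k) x :
  pjac (join_map Psi Y) x = row_mx (pjac Psi x) (pjac Y x).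
Proof.
by apply/matrixP => l i; rewrite !mxE /join_map; case: (fintype.split i) => j; rewrite mxE.
Qed.

Lemma pjac_fix_coords (R : realType) n m (Psi : 'I_n -> pexp R (n + m)) ga x :
  pjac (fix_coords Psi ga) x = row_mx (pjac Psi x) (coord_mx R ga).
Proof.
rewrite -[fix_coords _ _]/(join_map Psi (fun j => PX (ga j))) pjac_join.
by congr row_mx; apply/matrixP => l j; rewrite !mxE eq_sym.
Qed.

Lemma polymap_fix_coords (R : realType) n m (Psi : 'I_n -> pexp R (n + m)) ga x :
  polymap (fix_coords Psi ga) x = row_mx (polymap Psi x) (\row_j x ord0 (ga j)).
Proof.
rewrite -[fix_coords _ _]/(join_map Psi (fun j => PX (ga j))) polymap_join.
by congr row_mx; apply/rowP => j; rewrite !mxE.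
Qed.

(* Since [ga] has the largest minor, Cramer's rule bounds the slopes of the
   fibre of [Psi] over the coordinates [ga] by 1, hence the constant m + 1. *)
Lemma cell_move (R : realType) n m (Psi : 'I_n -> pexp R (n + m)) (r eta : R)
    (ga : {ffun 'I_m -> 'I_(n + m)}) : 0 < eta ->
  exists2 h0 : R, 0 < h0 & forall (h : R) (x : 'rV[R]_(n + m)) (c : 'rV[R]_m),
    0 < h -> h <= h0 -> `|x| <= r -> eta <= `|\det (pjac (fix_coords Psi ga) x)| ->
    (forall ga' : {ffun 'I_m -> 'I_(n + m)}, `|\det (pjac (fix_coords Psi ga') x)| <=
        `|\det (pjac (fix_coords Psi ga) x)|) ->
    (forall j, `|c ord0 j - x ord0 (ga j)| <= h) ->
    exists x', [/\ `|x' - x| <= m.+1%:R * h,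
      polymap (fix_coords Psi ga) x' = row_mx (polymap Psi x) c &
      pjac (fix_coords Psi ga) x' \in unitmx].
Proof.
move=> eta0.
have [K K0 taylor] := polymap_taylor (fix_coords Psi ga) (r + 1).
have [C [tau [C0 tau0 solve]]] := local_solve (fix_coords Psi ga) r eta0.
pose La := (n + m).-1`!%:R * K ^+ (n + m).-1 / eta.
have La0 : 0 <= La by rewrite !mulr_ge0 ?exprn_ge0 ?invr_ge0// ltW.
(* Collects the second-order contributions; [h0] is chosen so that [c1 * h ^+ 2 <= h], which is the
   additional 1 in [m.+1]. *)
pose c1 := (n%:R * La + m%:R) * K * C ^+ 2.
have c10 : 0 <= c1.
  have h1 : 0 <= n%:R * La + m%:R by rewrite addr_ge0// mulr_ge0.
  by rewrite mulr_ge0 ?exprn_ge0 ?(ltW C0)// mulr_ge0// ltW.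
exists (Num.min tau (c1 + 1)^-1) => [|h x c h0 hle xr dx dmax hc].
  by rewrite lt_min tau0 invr_gt0 ltr_wpDl.
have htau : h <= tau by apply: le_trans hle _; rewrite ge_min lexx.
have hc1 : h * (c1 + 1) <= 1.
  by rewrite -ler_pdivlMr ?ltr_wpDl// div1r (le_trans hle)// ge_min lexx orbT.
set t := row_mx (polymap Psi x) c.
have tE : t - polymap (fix_coords Psi ga) x = row_mx 0 (c - \row_j x ord0 (ga j)).
  by rewrite polymap_fix_coords /t opp_row_mx add_row_mx subrr.
have th : `|t - polymap (fix_coords Psi ga) x| <= h.
  rewrite tE; apply: norm_le_coord => [|i]; first exact: ltW.
  rewrite mxE; case: (fintype.split i) => j; rewrite !mxE ?normr0 ?(ltW h0)//.
have [x' [x'x x'r Gx' Jx'u]] := solve x t xr dx (le_trans th htau).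
exists x'; split=> //.
have xr' : `|x| <= r + 1 by lra.
have [Jc _ _ tG] := taylor x x' xr' x'r.
have [Ju Jinv] := inv_entry_bound eta0 (ltW K0) Jc dx.
have Jinv1 j l : `|invmx (pjac (fix_coords Psi ga) x) (rshift n j) l| <= 1.
  move: Ju; rewrite !pjac_fix_coords => Ju; apply: cramer_max_entry => // ga'.
  by have := dmax ga'; rewrite !pjac_fix_coords.
rewrite Gx' in tG.
set J := pjac _ x in tG Jinv Jinv1 Ju.
set v := x' - x in x'x tG *.
set d := t - polymap _ x in tE th tG x'x.
have vh : `|v| <= C * h by apply: le_trans x'x _; rewrite ler_wpM2l// ltW.
have rem : `|v *m J - d| <= K * (C * h) ^+ 2.
  rewrite distrC; apply: le_trans tG _; rewrite ler_wpM2l ?(ltW K0)//.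
  by apply: lerXn2r vh; rewrite nnegrE// mulr_ge0// ltW.
set q := K * (C * h) ^+ 2 in rem.
have q0 : 0 <= q by rewrite mulr_ge0 ?exprn_ge0 ?mulr_ge0// ltW.
have remi i : `|(v *m J) ord0 i - d ord0 i| <= q.
  by apply: le_trans rem; have := coord_le_norm (v *m J - d) i; rewrite !mxE.
apply: norm_le_coord => [|l]; first by rewrite mulr_ge0// ltW.
rewrite -(mulmxK Ju v) mxE big_split_ord /=.
have s1 : `|\sum_(i < n) (v *m J) ord0 (lshift m i) * invmx J (lshift m i) l| <= n%:R * (q * La).
  rewrite (le_trans (ler_norm_sum _ _ _))//.
  rewrite mulr_natl -[X in _ *+ X]card_ord -sumr_const; apply: ler_sum => i _.
  rewrite normrM; apply: ler_pM => //.
  have d_i : d ord0 (lshift m i) = 0 by rewrite tE row_mxEl mxE.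
  by have := remi (lshift m i); rewrite d_i subr0.
have s2 : `|\sum_(j < m) (v *m J) ord0 (rshift n j) * invmx J (rshift n j) l| <= m%:R * ((h + q) * 1).
  rewrite (le_trans (ler_norm_sum _ _ _))//.
  rewrite mulr_natl -[X in _ *+ X]card_ord -sumr_const; apply: ler_sum => j _.
  rewrite normrM ler_pM//.
  rewrite -[X in `|X|](subrK (d ord0 (rshift n j))) (le_trans (ler_normD _ _))//.
  rewrite addrC lerD//; apply: le_trans th; exact: coord_le_norm.
rewrite (le_trans (ler_normD _ _))// (le_trans (lerD s1 s2))//.
have hh : c1 * h ^+ 2 <= h.
  rewrite expr2 mulrA -[leRHS]mul1r ler_wpM2r ?(ltW h0)// (le_trans _ hc1)//.
  by rewrite mulrC ler_wpM2l ?(ltW h0)// lerDl.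
have -> : n%:R * (q * La) + m%:R * ((h + q) * 1) = m%:R * h + c1 * h ^+ 2.
  by rewrite /q /c1; ring.
by rewrite -natr1 mulrDl mul1r lerD2l.
Qed.

Lemma finite_min (R : realType) (T : finType) (Q : T -> R -> Prop) :
  (forall t, exists2 h0 : R, 0 < h0 & forall h, 0 < h -> h <= h0 -> Q t h) ->
  exists2 h0 : R, 0 < h0 & forall h, 0 < h -> h <= h0 -> forall t, Q t h.
Proof.
move=> H; have [f fP] := choice (fun t => ex2_ex (H t)).
(* The inverse of a sum of inverses lies below every threshold [f t]; the added 1 keeps it
   meaningful for an empty [T]. *)
pose S : R := \sum_t (f t)^-1 + 1.
have S0 : 0 < S.
  by rewrite ltr_wpDl// sumr_ge0// => t _; rewrite invr_ge0; case: (fP t) => /ltW.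
exists S^-1; first by rewrite invr_gt0.
move=> h h0 hS t; have [ft0] := fP t; apply => //.
rewrite (le_trans hS)// -[leRHS]invrK lef_pV2 ?posrE ?invr_gt0//.
rewrite /S (bigD1 t)//= -addrA lerDl addr_ge0// sumr_ge0// => u _.
by rewrite invr_ge0; case: (fP u) => /ltW.
Qed.

Lemma card_seq_bezout (R : realType) n D (G : 'I_n -> pexp R n) (t : 'rV[R]_n)
    (s : seq 'rV[R]_n) :
  (forall i, (pdeg (G i) <= D)%N) -> uniq s ->
  (forall x, x \in s -> polymap G x = t) -> (forall x, x \in s -> pjac G x \in unitmx) ->
  (size s <= D.+1 ^ n)%N.
Proof.
move=> dG us sG sJ; pose P (i : 'I_(size s)) := nth 0 s i.
apply: (@bezout R n D (size s) G t P) => // [i j /eqP|i|i].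
- by rewrite /P nth_uniq// => /eqP /val_inj.
- by rewrite sG// mem_nth.
- by rewrite sJ// mem_nth.
Qed.

(** The factors count, in order, the choices [ga] of coordinates, the cells in these coordinates,
    and the points of the fibre over a corner of a cell. Points moved to the same place form a
    cluster of diameter at most [2 * (m.+1%:R * h)], which [X] bounds. The fixed coordinates have
    degree 1, hence [0 < D]. *)
Lemma fiber_count (R : realType) n m D (Psi : 'I_n -> pexp R (n + m))
    (Y : 'I_m -> pexp R (n + m)) (r eta : R) : 0 < eta -> (0 < D)%N ->
  (forall i, pdeg (Psi i) <= D)%N ->
  exists2 h0 : R, 0 < h0 & forall h : R, 0 < h -> h <= h0 ->
  forall (T : finType) (S : {set T}) (s : 'rV[R]_n) (P : T -> 'rV[R]_(n + m)) (X : nat),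
  (forall t, t \in S -> [/\ `|P t| <= r, polymap Psi (P t) = s &
     eta <= `|\det (pjac (join_map Psi Y) (P t))|]) ->
  (forall S' : {set T}, S' \subset S ->
     (forall t t', t \in S' -> t' \in S' -> `|P t - P t'| <= 2 * (m.+1%:R * h)) ->
     (#|S'| <= X)%N) ->
  (#|S| <= (n + m) ^ m * (Num.truncn (2 * r / h)).+1 ^ m * (D.+1 ^ (n + m) * X))%N.
Proof.
move=> eta0 D0 dPsi; have [K K0 taylor] := polymap_taylor Y r.
have [nm0|nm_gt0] := posnP (n + m)%N.
  exists 1 => // h hp _ T S s P X SP SX; have := SX S (subxx _).
  have n0 : n = 0%N by lia. have m0 : m = 0%N by lia.
  subst n m; rewrite !expn0 !mul1n; apply => t t' _ _.
  by rewrite (thinmx0 (P t - P t')) normr0 mulr_ge0// mulr_ge0// ltW.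
(* The size which [exists_large_coord_det] guarantees for the best minor. *)
pose eta2 := eta / ((n + m)%:R * K) ^+ m.
have nK : 0 < (n + m)%:R * K by rewrite mulr_gt0// ltr0n.
have eta20 : 0 < eta2 by rewrite divr_gt0// exprn_gt0.
have [h0 h00 hh] := finite_min (fun ga : {ffun 'I_m -> 'I_(n + m)} =>
   let: ex_intro2 h0 h00 H := cell_move Psi r ga eta20 in
   ex_intro2 _ _ h0 h00 (fun h a b x c => H h x c a b)).
exists h0 => // h h_gt0 hle T S s P X SP SX.
have gaP t : exists ga : {ffun 'I_m -> 'I_(n + m)}, t \in S ->
  [/\ (forall ga' : {ffun 'I_m -> 'I_(n + m)}, `|\det (pjac (fix_coords Psi ga') (P t))| <=
        `|\det (pjac (fix_coords Psi ga) (P t))|) &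
   eta2 <= `|\det (pjac (fix_coords Psi ga) (P t))|].
  have [tS|] := boolP (t \in S); last first.
    have [ga _] := @exists_large_coord_det R n m 0 0 0 (fun i j => ltac:(by rewrite mxE normr0)).
    by exists ga.
  have [Pr _ dP] := SP t tS; have [Jc _ _ _] := taylor _ _ Pr Pr.
  have [ga [g1 g2]] := exists_large_coord_det (pjac Psi (P t)) Jc.
  exists ga => _; split=> [ga'|]; rewrite !pjac_fix_coords; first exact: g1.
  rewrite /eta2 ler_pdivrMr ?exprn_gt0// mulrC (le_trans _ g2)//.
  by rewrite -pjac_join.
have [ga {}gaP] := choice gaP.
have r_ge0 t : t \in S -> 0 <= r by move=> /SP[/(le_trans (normr_ge0 _))].
pose Q := Num.truncn (2 * r / h).
have cellP t j : t \in S -> 0 <= (P t ord0 (ga t j) + r) / h /\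
    (Num.truncn ((P t ord0 (ga t j) + r) / h) < Q.+1)%N.
  move=> tS; have [Pr _ _] := SP t tS.
  have := coord_le_norm (P t) (ga t j) => /le_trans/(_ Pr); rewrite ler_norml => /andP[l1 l2].
  split; first by rewrite divr_ge0 ?(ltW h_gt0)//; lra.
  by rewrite ltnS le_truncn// ler_wpM2r ?invr_ge0 ?(ltW h_gt0)//; lra.
pose cell t : {ffun 'I_m -> 'I_Q.+1} :=
  [ffun j => inord (Num.truncn ((P t ord0 (ga t j) + r) / h))].
pose cl t := (ga t, cell t).
apply: (@leq_trans (#|{: {ffun 'I_m -> 'I_(n + m)} * {ffun 'I_m -> 'I_Q.+1}}| *
    (D.+1 ^ (n + m) * X))); last by rewrite card_prod !card_ffun !card_ord.
apply: (@card_le_fibers_fin _ _ cl) => -[g q].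
set Sc := [set x in _ | _]%SET.
(* The lower corner of the cell depends on the class only, so that all points of a class are moved
   into one finite fibre. *)
pose c : 'rV[R]_m := \row_j (- r + (q j)%:R * h).
have moveP t : exists x', t \in Sc -> [/\ `|x' - P t| <= m.+1%:R * h,
      polymap (fix_coords Psi g) x' = row_mx s c &
      pjac (fix_coords Psi g) x' \in unitmx].
  have [|] := boolP (t \in Sc); last by exists 0.
  rewrite inE => /andP[tS /eqP [gE qE]].
  have [Pr Ps _] := SP t tS; have [g1 g2] := gaP t tS.
  rewrite gE in g1 g2.
  have [|x' [x1 x2 x3]] := hh h h_gt0 hle g (P t) c Pr g2 g1.
    move=> j; have [c1 c2] := cellP t j tS.
    rewrite mxE -qE ffunE inordK// gE.
    rewrite gE in c1; have /andP[u1 u2] := truncn_itv c1.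
    set z := Num.truncn _ in u1 u2 *.
    move: u1 u2; rewrite ler_pdivlMr// ltr_pdivrMr// -natr1 mulrDl mul1r => u1 u2.
    by rewrite ler_norml; apply/andP; split; lra.
  by exists x' => _; split=> //; rewrite x2 Ps.
have [f fP] := choice moveP.
apply: leq_trans (@card_le_fibers _ _ f (undup [seq f t | t in Sc]) Sc X _ _) _.
- by move=> t tS; rewrite mem_undup; apply/fintype.imageP; exists t.
- move=> u _; apply: SX.
    by apply/fintype.subsetP => t; rewrite !inE => /andP[/andP[]].
  move=> t t'; rewrite !inE => /andP[tS /eqP ft] /andP[t'S /eqP ft'].
  have [d1 _ _] := fP t ltac:(by rewrite inE).
  have [d2 _ _] := fP t' ltac:(by rewrite inE).
  rewrite (_ : P t - P t' = (f t' - P t') - (f t - P t)); last by rewrite ft ft' opprB [RHS]addrC subrKA.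
  by rewrite (le_trans (ler_normB _ _))//; lra.
- rewrite leq_mul2r; apply/orP; right.
  apply: (@card_seq_bezout R _ D (fix_coords Psi g) (row_mx s c)).
  + by move=> i; rewrite /fix_coords; case: (fintype.split i).
  + exact: undup_uniq.
  + by move=> x; rewrite mem_undup => /fintype.imageP[t /fP[_ ? _] ->].
  + by move=> x; rewrite mem_undup => /fintype.imageP[t /fP[_ _ ?] ->].
Qed.

(** * Values at almost critical points of polynomials *)

Definition psumI (R : realType) n k (F : 'I_k -> pexp R n) : pexp R n :=
  psum [seq F i | i <- enum 'I_k].
Arguments psumI : simpl never.

Lemma pev_psumI (R : realType) n k (F : 'I_k -> pexp R n) x :
  pev (psumI F) x = \sum_i pev (F i) x.
Proof. by rewrite pev_psum big_map big_enum. Qed.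

Lemma pev_pd_psumI (R : realType) n k (F : 'I_k -> pexp R n) l x :
  pev (pd l (psumI F)) x = \sum_i pev (pd l (F i)) x.
Proof. by rewrite pev_pd_psum big_map big_enum. Qed.

Lemma pdeg_psumI (R : realType) n k (F : 'I_k -> pexp R n) D :
  (forall i, (pdeg (F i) <= D)%N) -> (pdeg (psumI F) <= D)%N.
Proof.
move=> H; rewrite /psumI; elim: (enum 'I_k) => //= i s IH.
by rewrite geq_max H.
Qed.

Definition psq (R : realType) n (e : pexp R n) := PMul e e.

(** At [z0] the three terms are at most eps^2, eps^2 and 4 eps^2, so at the minimiser each is at
    most 6 eps^2. This is the origin of 6, of 3 > sqrt 6 and of 12 = 3/2 * 6 + 3; the radius
    [3 * rho] exceeds sqrt 6 rho, hence the minimum is interior. The last equation is the vanishing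
    gradient times [rho ^+ 2 / (2 * eps ^+ 2)]. *)
Lemma penalized_min (R : realType) n m (p : 'I_m -> pexp R n) (h : pexp R n)
    (eps rho : R) (c0 s z0 : 'rV[R]_n) (y : 'rV[R]_m) :
  0 < eps -> 0 < rho -> (forall z, 0 <= pev h z) ->
  \sum_i (z0 ord0 i - c0 ord0 i) ^+ 2 <= rho ^+ 2 ->
  \sum_i (s ord0 i - c0 ord0 i) ^+ 2 <= rho ^+ 2 ->
  \sum_j (pev (p j) z0 - y ord0 j) ^+ 2 <= eps ^+ 2 -> pev h z0 <= 1 ->
  exists z : 'rV[R]_n, [/\ \sum_i (z ord0 i - c0 ord0 i) ^+ 2 <= 12 * rho ^+ 2,
    pev h z <= 6, forall j, `|pev (p j) z - y ord0 j| <= 3 * eps &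
    forall i, z ord0 i + rho ^+ 2 / eps *
      (\sum_j (pev (p j) z - y ord0 j) / eps * pev (pd i (p j)) z) +
      rho ^+ 2 / 2 * pev (pd i h) z = s ord0 i].
Proof.
move=> e0 r0 h_ge0 z0c sc z0y hz0.
pose Ph := PAdd (psumI (fun j => psq (PAdd (p j) (PC (- y ord0 j)))))
  (PAdd (PMul (PC (eps ^+ 2)) h)
    (PMul (PC ((eps / rho) ^+ 2)) (psumI (fun i => psq (PAdd (PX i) (PC (- s ord0 i))))))).
have PhE z : pev Ph z = \sum_j (pev (p j) z - y ord0 j) ^+ 2 + (eps ^+ 2 * pev h z +
    (eps / rho) ^+ 2 * \sum_i (z ord0 i - s ord0 i) ^+ 2).
  by rewrite /= !pev_psumI.
have PhdE z i : pev (pd i Ph) z = 2 * (\sum_j (pev (p j) z - y ord0 j) * pev (pd i (p j)) z) +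
    (eps ^+ 2 * pev (pd i h) z + (eps / rho) ^+ 2 * (2 * (z ord0 i - s ord0 i))).
  rewrite /= !pev_pd_psumI !mul0r !add0r.
  congr (_ + (_ + _ * _)).
    by rewrite mulr_sumr; apply: eq_bigr => j _ /=; ring.
  rewrite (bigD1 i)//= eqxx big1 => [|j /negPf ->]; rewrite ?mulr1n ?mulr0n; ring.
have z0s : \sum_i (z0 ord0 i - s ord0 i) ^+ 2 <= 4 * rho ^+ 2.
  have : \sum_i (z0 ord0 i - s ord0 i) ^+ 2 <=
      \sum_i (2 * (z0 ord0 i - c0 ord0 i) ^+ 2 + 2 * (s ord0 i - c0 ord0 i) ^+ 2).
    apply: ler_sum => i _.
    have := sqr_ge0 (z0 ord0 i - c0 ord0 i + (s ord0 i - c0 ord0 i)); nra.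
  rewrite big_split -!mulr_sumr /=; lra.
have er0 : 0 < eps / rho by rewrite divr_gt0.
have er : (eps / rho) ^+ 2 * rho ^+ 2 = eps ^+ 2 by rewrite -exprMn divfK// gt_eqF.
have e20 : 0 < eps ^+ 2 by rewrite exprn_gt0.
have er20 : 0 < (eps / rho) ^+ 2 by rewrite exprn_gt0.
have r20 : 0 < rho ^+ 2 by rewrite exprn_gt0.
have Phz0 : pev Ph z0 <= 6 * eps ^+ 2.
  rewrite PhE; have h1 : eps ^+ 2 * pev h z0 <= eps ^+ 2 by rewrite ger_pMr.
  have h2 : (eps / rho) ^+ 2 * \sum_i (z0 ord0 i - s ord0 i) ^+ 2 <= 4 * eps ^+ 2.
    by rewrite (le_trans (ler_wpM2l (ltW er20) z0s))// mulrCA er.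
  lra.
have sum_sq_le (k : nat) (f : 'I_k -> R) i : f i ^+ 2 <= \sum_j f j ^+ 2.
  by rewrite (bigD1 i)//= lerDl sumr_ge0// => j _; exact: sqr_ge0.
have sqr_le (x c : R) : 0 <= c -> x ^+ 2 <= c ^+ 2 -> `|x| <= c.
  by move=> c_ge0 H; rewrite -(@ler_pXn2r _ 2) ?nnegrE// real_normK// num_real.
have r3 : 0 <= 3 * rho by lra.
have z0in : `|z0 - s| <= 3 * rho.
  apply: norm_le_coord => // i; rewrite !mxE; apply: sqr_le => //.
  apply: le_trans (sum_sq_le _ (fun i => z0 ord0 i - s ord0 i) i) (le_trans z0s _).
  rewrite exprMn; lra.
have [z zin zmin] := pexp_min Ph s r3.
have Phz : pev Ph z <= 6 * eps ^+ 2 by apply: le_trans (zmin _ z0in) Phz0.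
rewrite PhE in Phz.
have S1 : 0 <= \sum_j (pev (p j) z - y ord0 j) ^+ 2 by apply: sumr_ge0 => j _; exact: sqr_ge0.
have S2 : 0 <= \sum_i (z ord0 i - s ord0 i) ^+ 2 by apply: sumr_ge0 => j _; exact: sqr_ge0.
have S3 := h_ge0 z.
have S2' : 0 <= (eps / rho) ^+ 2 * \sum_i (z ord0 i - s ord0 i) ^+ 2 by rewrite mulr_ge0// ltW.
have S3' : 0 <= eps ^+ 2 * pev h z by rewrite mulr_ge0// ltW.
have zs : \sum_i (z ord0 i - s ord0 i) ^+ 2 <= 6 * rho ^+ 2.
  rewrite -(ler_pM2l er20) mulrCA er; lra.
have zint : `|z - s| < 3 * rho.
  rewrite lt_neqAle zin andbT; apply/negP => /eqP zr.
  have zs0 : z - s != 0 by rewrite -normr_eq0 zr gt_eqF// mulr_gt0.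
  have [i iE] := norm_coord_eq zs0.
  have := le_trans (sum_sq_le _ (fun i => z ord0 i - s ord0 i) i) zs.
  have -> : (z ord0 i - s ord0 i) ^+ 2 = 9 * rho ^+ 2.
    by rewrite -[LHS]real_normK ?num_real//; rewrite zr !mxE in iE; rewrite iE exprMn; ring.
  lra.
have crit := pexp_crit zint zmin.
exists z; split.
- have : \sum_i (z ord0 i - c0 ord0 i) ^+ 2 <=
      \sum_i (3 / 2 * (z ord0 i - s ord0 i) ^+ 2 + 3 * (s ord0 i - c0 ord0 i) ^+ 2).
    apply: ler_sum => i _.
    set u := z ord0 i - s ord0 i; set v := s ord0 i - c0 ord0 i.
    have -> : z ord0 i - c0 ord0 i = u + v by rewrite /u /v; ring.
    have := sqr_ge0 (u - 2 * v); nra.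
  rewrite big_split -!mulr_sumr /=; lra.
- by rewrite -(ler_pM2l e20); lra.
- move=> j; apply: sqr_le; first by lra.
  apply: le_trans (sum_sq_le _ (fun j => pev (p j) z - y ord0 j) j) _.
  rewrite exprMn; lra.
- move=> i; have := crit i; rewrite PhdE => H.
  have -> : \sum_j (pev (p j) z - y ord0 j) / eps * pev (pd i (p j)) z =
     (\sum_j (pev (p j) z - y ord0 j) * pev (pd i (p j)) z) / eps.
    by rewrite mulr_suml; apply: eq_bigr => j _; ring.
  move: H; set S := \sum_j _; set d := pev _ _ => H.
  apply/eqP; rewrite -subr_eq0; apply/eqP.
  have -> : z ord0 i + rho ^+ 2 / eps * (S / eps) + rho ^+ 2 / 2 * d - s ord0 i =
     rho ^+ 2 / (2 * eps ^+ 2) * (2 * S + (eps ^+ 2 * d + (eps / rho) ^+ 2 * (2 * (z ord0 i - s ord0 i)))).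
    by field; rewrite !gt_eqF.
  by rewrite H mulr0.
Qed.

(** Written in the centred variable [z - c], so that the region of the count has a radius
    independent of the centre; the last [m] variables are reserved for w. *)
Fixpoint pshift (R : realType) n m (c : 'rV[R]_n) (e : pexp R n) : pexp R (n + m) :=
  match e with
  | PC x => PC x
  | PX i => PAdd (PX (lshift m i)) (PC (c ord0 i))
  | PAdd a b => PAdd (pshift m c a) (pshift m c b)
  | PMul a b => PMul (pshift m c a) (pshift m c b)
  end.

Lemma pev_pshift (R : realType) n m (c : 'rV[R]_n) (e : pexp R n) (z : 'rV[R]_n)
  (w : 'rV[R]_m) : pev (pshift m c e) (row_mx (z - c) w) = pev e z.
Proof.
elim: e => [x|i|a IHa b IHb|a IHa b IHb] //=; last 2 first.
- by rewrite IHa IHb.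
- by rewrite IHa IHb.
- by rewrite row_mxEl !mxE subrK.
Qed.

Lemma pdeg_pshift (R : realType) n m (c : 'rV[R]_n) (e : pexp R n) :
  pdeg (pshift m c e) = pdeg e.
Proof. by elim: e => [x|i|a IHa b IHb|a IHa b IHb] //=; rewrite IHa IHb. Qed.

(* [y t j] differ from [p_j (z t)] by at most O(eps * h) variation, and [p] is
   nearly of rank [nu] at [z t]: the targets of a cluster lie close to a
   [nu]-plate, which is cut into bins of side [eps * h]. *)
Lemma cluster_count (R : realType) n m nu (p : 'I_m -> pexp R n) N B
    (eps M a C1 h : R) (v : 'I_N -> 'rV[R]_m)
    (S : {set 'I_N * {ffun 'I_(n + m) -> 'I_B}})
    (z : 'I_N * {ffun 'I_(n + m) -> 'I_B} -> 'rV[R]_n) :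
  let y (t : 'I_N * {ffun 'I_(n + m) -> 'I_B}) j := v t.1 ord0 j + eps / m%:R * ((t.2 (rshift n j))%:R / B%:R) in
  let del := 2 * (m.+1%:R * h) in
  let c2 := (n%:R * C1 + 1) * (2 * m.+1%:R) + 1 + nu%:R * a in
  let c3 := 2 * c2 + nu%:R * a in
  let c4 := n%:R * M * (2 * m.+1%:R) + 1 in
  (0 < m)%N -> 0 < eps -> eps <= 1 -> 0 < h -> 0 <= a -> 0 <= M -> 0 <= C1 -> c3 * h < 1 ->
  (forall k l, k != l -> exists j, 2 * eps <= `|v k ord0 j - v l ord0 j|) ->
  (forall t, t \in S -> exists (s : 'I_nu -> 'I_m) (A : 'I_m -> 'I_nu -> R),
     [/\ forall j l, `|A j l| <= a, forall i j, `|pev (pd i (p j)) (z t)| <= M &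
      forall i j, `|pev (pd i (p j)) (z t) - \sum_l A j l * pev (pd i (p (s l))) (z t)|
        <= C1 * eps]) ->
  (forall t t', t \in S -> t' \in S -> [/\ `|z t - z t'| <= del,
     forall j, `|(pev (p j) (z t) - y t j) - (pev (p j) (z t') - y t' j)| <= eps * del,
     forall j, `|pev (p j) (z t) - pev (p j) (z t') -
        \sum_i (z t - z t') ord0 i * pev (pd i (p j)) (z t')| <= eps * h &
     forall i, t.2 (lshift m i) = t'.2 (lshift m i)]) ->
  (#|S| <= (Num.truncn (2 * c4 / eps)).+1 ^ nu * (Num.truncn (c3 * m%:R * h * B%:R)).+1 ^ m)%N.
Proof.
move=> y del c2 c3 c4 m_gt0 e0 e1 h0 a0 M0 C10 c3h sep near close.
have [->|[t0 t0S]] := set_0Vmem S; first by rewrite cards0.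
have m1 : 0 <= m.+1%:R :> R by [].
have del0 : 0 <= del by rewrite !mulr_ge0// ltW.
have c20 : 0 <= c2.
  by rewrite !addr_ge0// mulr_ge0// ?addr_ge0 ?mulr_ge0.
have c30 : 0 <= c3 by rewrite addr_ge0// mulr_ge0.
have c40 : 0 <= c4 by rewrite addr_ge0// !mulr_ge0.
have [s [A [Aa dM dA]]] := near t0 t0S.
pose ka t j := pev (p j) (z t) - pev (p j) (z t0).
have eh0 : 0 < eps * h by rewrite mulr_gt0.
have gradE t j : t \in S ->
    `|ka t j - \sum_i (z t - z t0) ord0 i * pev (pd i (p j)) (z t0)| <= eps * h.
  by move=> tS; have [_ _ + _] := close t t0 tS t0S; apply.
have sum_bnd (x : 'rV[R]_n) (f : 'I_n -> R) c d : `|x| <= c -> (forall i, `|f i| <= d) ->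
    `|\sum_i x ord0 i * f i| <= n%:R * (c * d).
  move=> xc fd; rewrite (le_trans (ler_norm_sum _ _ _))//.
  rewrite mulr_natl -[X in _ *+ X]card_ord -sumr_const; apply: ler_sum => i _.
  by rewrite normrM ler_pM// (le_trans (coord_le_norm _ _)).
have kaB t j : t \in S -> `|ka t j| <= c4 * h.
  move=> tS; have [zz _ _ _] := close t t0 tS t0S.
  have h1 := sum_bnd _ (fun i => pev (pd i (p j)) (z t0)) _ _ zz (fun i => dM i j).
  rewrite -(subrK (\sum_i (z t - z t0) ord0 i * pev (pd i (p j)) (z t0)) (ka t j)).
  rewrite (le_trans (ler_normD _ _))// (le_trans (lerD (gradE t j tS) h1))//.
  have h2 : eps * h <= h by rewrite ger_pMl.
  have -> : c4 * h = n%:R * (del * M) + h by rewrite /c4 /del; ring.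
  lra.
(* The increments of [y] and of [p] differ by O(eps h), and the rank condition up to [C1 * eps]
   expresses the latter through the [nu] increments [ka t (s l)]. *)
have yA t j : t \in S -> `|y t j - y t0 j - \sum_l A j l * ka t (s l)| <= c2 * (eps * h).
  move=> tS; have [zz ww _ _] := close t t0 tS t0S.
  set d := z t - z t0 in zz.
  have -> : y t j - y t0 j - \sum_l A j l * ka t (s l) =
    (ka t j - \sum_i d ord0 i * pev (pd i (p j)) (z t0))
    - ((pev (p j) (z t) - y t j) - (pev (p j) (z t0) - y t0 j))
    + \sum_i d ord0 i * (pev (pd i (p j)) (z t0) - \sum_l A j l * pev (pd i (p (s l))) (z t0))
    - \sum_l A j l * (ka t (s l) - \sum_i d ord0 i * pev (pd i (p (s l))) (z t0)).
    have sB k (f g g' : 'I_k -> R) : \sum_i f i * (g i - g' i) =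
        \sum_i f i * g i - \sum_i f i * g' i.
      by rewrite -sumrB; apply: eq_bigr => i _; rewrite mulrBr.
    rewrite !sB.
    have -> : \sum_i d ord0 i * \sum_l A j l * pev (pd i (p (s l))) (z t0) =
      \sum_l A j l * \sum_i d ord0 i * pev (pd i (p (s l))) (z t0).
      under eq_bigr do rewrite mulr_sumr.
      rewrite exchange_big /=; apply: eq_bigr => l _; rewrite mulr_sumr.
      by apply: eq_bigr => i _; rewrite mulrCA.
    rewrite /ka; ring.
  have h1 := gradE t j tS.
  have h2 := ww j.
  have h3 := sum_bnd _ (fun i => pev (pd i (p j)) (z t0) -
      \sum_l A j l * pev (pd i (p (s l))) (z t0)) _ _ zz (fun i => dA i j).
  have h4 : `|\sum_l A j l * (ka t (s l) - \sum_i d ord0 i * pev (pd i (p (s l))) (z t0))|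
     <= nu%:R * (a * (eps * h)).
    rewrite (le_trans (ler_norm_sum _ _ _))//.
    rewrite mulr_natl -[X in _ *+ X]card_ord -sumr_const; apply: ler_sum => l _.
    by rewrite normrM ler_pM//; exact: gradE.
  have -> : c2 * (eps * h) = eps * h + eps * del + n%:R * (del * (C1 * eps)) + nu%:R * (a * (eps * h)).
    rewrite /c2 /del; ring.
  rewrite (le_trans (ler_normB _ _))// lerD// (le_trans (ler_normD _ _))// lerD//.
  by rewrite (le_trans (ler_normB _ _))// lerD.
(* The increments are at most [c4 * h] and the bins have side [eps * h]: [h] cancels in the number
   of bins, which leaves eps^-nu. *)
pose Q := Num.truncn (2 * c4 / eps).
pose u t l := (ka t (s l) + c4 * h) / (eps * h).
have uP t l : t \in S -> 0 <= u t l /\ (Num.truncn (u t l) < Q.+1)%N.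
  move=> tS; have := kaB t (s l) tS; rewrite ler_norml => /andP[l1 l2].
  split; first by rewrite divr_ge0 ?(ltW eh0)//; lra.
  rewrite ltnS le_truncn// /u.
  have -> : 2 * c4 / eps = (2 * c4 * h) / (eps * h) by field; rewrite !gt_eqF.
  by rewrite ler_wpM2r ?invr_ge0 ?(ltW eh0)//; lra.
pose bin t : {ffun 'I_nu -> 'I_Q.+1} := [ffun l => inord (Num.truncn (u t l))].
suff H : (#|S| <= #|{: {ffun 'I_nu -> 'I_Q.+1}}| *
    (Num.truncn (c3 * m%:R * h * B%:R)).+1 ^ m)%N.
  by move: H; rewrite card_ffun !card_ord.
apply: (@card_le_fibers_fin _ _ bin) => g; set Sg := [set x in _ | _]%SET.
have yclose t t' j : t \in Sg -> t' \in Sg -> `|y t j - y t' j| <= c3 * (eps * h).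
  rewrite !inE => /andP[tS /eqP gt] /andP[t'S /eqP gt'].
  have kk l : `|ka t (s l) - ka t' (s l)| <= eps * h.
    have [u1 u2] := uP t l tS; have [u1' u2'] := uP t' l t'S.
    have tE : Num.truncn (u t l) = Num.truncn (u t' l).
      have : bin t l = bin t' l by rewrite gt gt'.
      by rewrite !ffunE => /(congr1 val); rewrite /= !inordK.
    have := truncn_eq_dist u1 u1' tE.
    rewrite /u -mulrBl normrM [X in _ * X]gtr0_norm ?invr_gt0// ler_pdivrMr// mul1r.
    by rewrite (_ : _ - _ = ka t (s l) - ka t' (s l))//; ring.
  have -> : y t j - y t' j = (y t j - y t0 j - \sum_l A j l * ka t (s l))
     - (y t' j - y t0 j - \sum_l A j l * ka t' (s l)) + \sum_l A j l * (ka t (s l) - ka t' (s l)).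
    have -> : \sum_l A j l * (ka t (s l) - ka t' (s l)) =
        \sum_l A j l * ka t (s l) - \sum_l A j l * ka t' (s l).
      by rewrite -sumrB; apply: eq_bigr => l _; rewrite mulrBr.
    ring.
  have h4 : `|\sum_l A j l * (ka t (s l) - ka t' (s l))| <= nu%:R * (a * (eps * h)).
    rewrite (le_trans (ler_norm_sum _ _ _))//.
    rewrite mulr_natl -[X in _ *+ X]card_ord -sumr_const; apply: ler_sum => l _.
    by rewrite normrM ler_pM.
  rewrite (le_trans (ler_normD _ _))//.
  have h5 := le_trans (ler_normB _ _) (lerD (yA t j tS) (yA t' j t'S)).
  rewrite (le_trans (lerD h5 h4))// /c3; lra.
have B_gt0 : (0 < B)%N.
  exact: leq_ltn_trans (leq0n _) (ltn_ord (t0.2 (rshift n (Ordinal m_gt0)))).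
have BR : 0 < B%:R :> R by rewrite ltr0n.
have mR : 0 < m%:R :> R by rewrite ltr0n.
have mR1 : 1 <= m%:R :> R by rewrite ler1n.
have em : 0 < eps / m%:R by rewrite divr_gt0.
(* Targets of one bin differ by less than [eps] and the lattice offsets by at most [eps]; together
   this is less than the separation [2 * eps] of different indices. *)
have same t t' : t \in Sg -> t' \in Sg -> t.1 = t'.1.
  move=> tS t'S; apply/eqP; apply: contraT => /sep[j hj].
  have := yclose t t' j tS t'S; rewrite /y.
  set b := (t.2 _); set b' := (t'.2 _); move=> hy.
  have fr (c : nat) : (c < B)%N -> 0 <= (c%:R / B%:R : R) <= 1.
    by move=> cB; rewrite divr_ge0//= ler_pdivrMr// mul1r ler_nat ltnW.
  have /andP[f1 f2] := fr b (ltn_ord _); have /andP[f1' f2'] := fr b' (ltn_ord _).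
  have e2 : eps / m%:R <= eps by rewrite ler_pdivrMr// ler_peMr// ltW.
  have h1 : `|eps / m%:R * (b%:R / B%:R) - eps / m%:R * (b'%:R / B%:R)| <= eps.
    rewrite -mulrBr normrM gtr0_norm// -[leRHS]mulr1 ler_pM ?(ltW em)//.
    by rewrite ler_norml; apply/andP; split; move: f1 f2 f1' f2'; clear; lra.
  have h2 : c3 * (eps * h) < eps.
    by rewrite mulrCA gtr_pMr.
  suff : 2 * eps < 2 * eps by rewrite ltxx.
  apply: le_lt_trans hj _.
  have -> : v t.1 ord0 j - v t'.1 ord0 j =
    (v t.1 ord0 j + eps / m%:R * (b%:R / B%:R) - (v t'.1 ord0 j + eps / m%:R * (b'%:R / B%:R)))
    - (eps / m%:R * (b%:R / B%:R) - eps / m%:R * (b'%:R / B%:R)) by ring.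
  rewrite (le_lt_trans (ler_normB _ _))//; lra.
pose pr (t : 'I_N * {ffun 'I_(n + m) -> 'I_B}) : {ffun 'I_m -> 'I_B} :=
  [ffun j => t.2 (rshift n j)].
(* The index and the first [n] lattice coordinates are common to a bin, so the last [m] coordinates
   alone tell its targets apart. *)
have prI : {in Sg &, injective pr}.
  move=> t t' tS t'S /ffunP E; have t1 := same _ _ tS t'S.
  have [_ _ _ El] : [/\ True, True, True & forall i, t.2 (lshift m i) = t'.2 (lshift m i)].
    move: tS t'S; rewrite !inE => /andP[tS _] /andP[t'S _].
    by have [_ _ _] := close t t' tS t'S.
  case: t t' t1 El E {tS t'S} => [k b] [k' b'] /= -> El E; congr (_, _).
  apply/ffunP => i; rewrite -(splitK i); case: (fintype.split i) => j /=; first exact: El.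
  by have := E j; rewrite !ffunE.
rewrite -(card_in_imset prI).
apply: leq_trans (@card_box_le _ _ _ (fun=> (Num.truncn (c3 * m%:R * h * B%:R)).+1) _ _) _ => //.
  move=> _ _ /imsetP[t tS ->] /imsetP[t' t'S ->] H; apply/ffunP => j; apply: val_inj.
  apply: (@eq_mod_near R) (H j) _; rewrite !ffunE.
  have q0 : 0 <= c3 * m%:R * h * B%:R by rewrite !mulr_ge0// ltW.
  have /andP[_] := truncn_itv q0; apply: le_lt_trans.
  have := yclose t t' j tS t'S; rewrite /y (same _ _ tS t'S).
  set b := (t.2 _); set b' := (t'.2 _).
  have -> : v t'.1 ord0 j + eps / m%:R * (b%:R / B%:R) - (v t'.1 ord0 j + eps / m%:R * (b'%:R / B%:R))
    = (b%:R - b'%:R) * (eps / (m%:R * B%:R)) by field; rewrite !gt_eqF.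
  have q1 : 0 < eps / (m%:R * B%:R) by rewrite divr_gt0// mulr_gt0.
  rewrite normrM [X in _ * X]gtr0_norm//.
  have -> : c3 * (eps * h) = c3 * m%:R * h * B%:R * (eps / (m%:R * B%:R)).
    by field; rewrite !gt_eqF.
  by rewrite ler_pM2r.
by rewrite prod_nat_const card_ord.
Qed.

(** At least N B^(n+m) / 2 minimisers are nondegenerate. There are B^n values of [Psi], on each
    fibre O(hh^-m) cells, and in each cluster O(eps^-nu (hh B)^m) targets: [B] and [hh] cancel. *)
Lemma almost_critical_count (R : realType) n m nu D N (p : 'I_m -> pexp R n)
    (h : pexp R n) (c0 : 'rV[R]_n) (eps rho M a C1 : R) (zz : 'I_N -> 'rV[R]_n) :
  let r := 4 * rho + 3 in
  let c2 := (n%:R * C1 + 1) * (2 * m.+1%:R) + 1 + nu%:R * a in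
  let c3 := 2 * c2 + nu%:R * a in
  let c4 := n%:R * M * (2 * m.+1%:R) + 1 in
  (0 < m)%N -> 0 < eps -> eps <= 1 -> 0 < rho -> 0 <= a -> 0 <= M -> 0 <= C1 ->
  (forall j, (pdeg (p j) <= D)%N) -> (pdeg h <= D)%N ->
  (forall z, 0 <= pev h z) ->
  (forall z : 'rV[R]_n, \sum_i (z ord0 i - c0 ord0 i) ^+ 2 <= 12 * rho ^+ 2 -> pev h z <= 6 ->
     exists (s : 'I_nu -> 'I_m) (A : 'I_m -> 'I_nu -> R),
     [/\ forall j l, `|A j l| <= a, forall i j, `|pev (pd i (p j)) z| <= M &
      forall i j, `|pev (pd i (p j)) z - \sum_l A j l * pev (pd i (p (s l))) z|
        <= C1 * eps]) ->
  (forall k, \sum_i (zz k ord0 i - c0 ord0 i) ^+ 2 <= rho ^+ 2) ->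
  (forall k, pev h (zz k) <= 1) ->
  (forall k l, k != l -> exists j, 2 * eps <= `|pev (p j) (zz k) - pev (p j) (zz l)|) ->
  N%:R <= 2 * ((n + m)%:R * (2 * r + 1) * (2 * c3 * m%:R)) ^+ m * D.+2%:R ^+ (n + m) *
     ((2 * c4 + 1) / eps) ^+ nu.
Proof.
move=> r c2 c3 c4 m_gt0 e0 e1 rho0 a0 M0 C10 dp dh h_ge0 near zzc zzh sep.
(* Sides of the lattice cubes for the base points and the targets. In the Euclidean norm these stay
   within [rho] of [c0] and within [eps] of the value, since sqrt n <= n + 1 and sqrt m <= m. *)
pose ls := rho / (n%:R + 1); pose ly := eps / m%:R.
have n1 : 0 < n%:R + 1 :> R by rewrite ltr_wpDl.
have mR : 0 < m%:R :> R by rewrite ltr0n.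
have ls0 : 0 < ls by rewrite divr_gt0.
have ly0 : 0 < ly by rewrite divr_gt0.
(* The critical point equation in the variables (z - c0, w). Division by [ls], and by [ly] in [Y],
   gives the lattice the mesh 1 / B of [lattice_sard]. *)
pose Psi (i : 'I_n) : pexp R (n + m) := PMul (PC ls^-1)
  (PAdd (PAdd (PX (lshift m i)) (PMul (PC (rho ^+ 2 / eps))
     (psumI (fun j => PMul (PX (rshift n j)) (pshift m c0 (pd i (p j)))))))
   (PMul (PC (rho ^+ 2 / 2)) (pshift m c0 (pd i h)))).
pose Y (j : 'I_m) : pexp R (n + m) := PMul (PC ly^-1)
  (PAdd (pshift m c0 (p j)) (PMul (PC (- eps)) (PX (rshift n j)))).
have dPsi i : (pdeg (Psi i) <= D.+1)%N.
  rewrite /= add0n !geq_max /= !add0n pdeg_pshift (leq_trans (pdeg_pd _ _))//; last first.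
    exact: leq_trans dh _.
  rewrite andbT; apply: pdeg_psumI => j /=.
  by rewrite pdeg_pshift add1n ltnS (leq_trans (pdeg_pd _ _)).
have m1_0 : 0 < m.+1%:R :> R by [].
have c2_1 : 1 <= c2.
  rewrite /c2 -addrA addrCA lerDl addr_ge0 ?mulr_ge0// ?addr_ge0 ?mulr_ge0//.
have nua : 0 <= nu%:R * a by rewrite mulr_ge0.
have c3_2 : 2 <= c3 by rewrite /c3; lra.
have c4_1 : 1 <= c4 by rewrite /c4 lerDr !mulr_ge0.
have r0 : 0 < r by rewrite /r; lra.
pose G := join_map Psi Y.
have [eta eta0 [B0 sard]] := lattice_sard G r0.
have [h0 h00 fib] := fiber_count Y r eta0 (ltn0Sn D) dPsi.
have [K K0 taylor] := polymap_taylor p (`|c0| + r).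
(* Through [big], [hh] becomes so small that [c3 * hh < 1] and that the Taylor remainder of [p] on a
   cluster is at most [eps * hh]. *)
pose big := 1 + c3 + K * (2 * m.+1%:R) ^+ 2 / eps.
have big1' : 0 <= K * (2 * m.+1%:R) ^+ 2 / eps.
  by rewrite !mulr_ge0 ?exprn_ge0 ?invr_ge0 ?mulr_ge0// ltW.
have big0 : 0 < big + 1 by rewrite /big; lra.
pose hh := Num.min h0 (big + 1)^-1.
have hh0 : 0 < hh by rewrite lt_min h00 invr_gt0.
have hhh0 : hh <= h0 by rewrite ge_min lexx.
have hhb : hh * (big + 1) <= 1 by rewrite -ler_pdivlMr// div1r ge_min lexx orbT.
have hhx x : 0 <= x -> x + 1 <= big + 1 -> hh * x < 1.
  move=> x0 xb; apply: lt_le_trans hhb; rewrite ltr_pM2l//; lra.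
have hh1 : hh <= 1 by rewrite -[hh]mulr1 ltW// hhx//; rewrite /big; lra.
have c3hh : c3 * hh < 1 by rewrite mulrC hhx//; rewrite /big; lra.
have Khh : K * (2 * m.+1%:R) ^+ 2 * hh <= eps.
  have : hh * (K * (2 * m.+1%:R) ^+ 2 / eps) < 1 by apply: hhx => //; rewrite /big; lra.
  by rewrite mulrA ltr_pdivrMr// mul1r mulrC => /ltW.
clearbody hh.
pose B := (B0 + (Num.truncn (c3 * m%:R * hh)^-1).+1)%N.
have B_gt0 : (0 < B)%N by rewrite /B addnS.
have BR : 0 < B%:R :> R by rewrite ltr0n.
have cB : 1 <= c3 * m%:R * hh * B%:R.
  have p0 : 0 < c3 * m%:R * hh by rewrite !mulr_gt0//; lra.
  rewrite -ler_pdivrMl// mulr1.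
  have hi : 0 <= (c3 * m%:R * hh)^-1 by rewrite invr_ge0 ltW.
  have /andP[_ /ltW/le_trans] := truncn_itv hi; apply.
  by rewrite ler_nat /B leq_addl.
have B0B : (B0 <= B)%N by rewrite /B leq_addr.
clearbody B.
pose T := ('I_N * {ffun 'I_(n + m) -> 'I_B})%type.
pose v k := polymap p (zz k).
pose s (t : T) : 'rV[R]_n := \row_i (c0 ord0 i + ls * ((t.2 (lshift m i))%:R / B%:R)).
pose y (t : T) j := v t.1 ord0 j + ly * ((t.2 (rshift n j))%:R / B%:R).
have pw (x x' : R) k : 0 <= x -> x <= x' -> x ^+ k <= x' ^+ k.
  by move=> x0 xy; rewrite lerXn2r// nnegrE// (le_trans x0).
have fr (c : nat) : (c < B)%N -> 0 <= (c%:R / B%:R : R) <= 1.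
  by move=> cB'; rewrite divr_ge0//= ler_pdivrMr// mul1r ler_nat ltnW.
have sum_le k (f : 'I_k -> R) c : 0 <= c -> (forall i, 0 <= f i <= c / (k%:R + 1) ^+ 2) -> \sum_i f i <= c.
  move=> c_ge0 H.
  have k1 : 0 < k%:R + 1 :> R by rewrite ltr_wpDl.
  apply: (@le_trans _ _ (\sum_(i < k) c / (k%:R + 1) ^+ 2)).
    by apply: ler_sum => i _; have /andP[] := H i.
  rewrite sumr_const card_ord -[leLHS]mulr_natl mulrCA -[leRHS]mulr1 ler_wpM2l//.
  rewrite ler_pdivrMr ?exprn_gt0// mul1r.
  by have := ler0n R k; move: (k%:R : R) => x; clear; nra.
have zP t : exists z : 'rV[R]_n, [/\ \sum_i (z ord0 i - c0 ord0 i) ^+ 2 <= 12 * rho ^+ 2,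
    pev h z <= 6, forall j, `|pev (p j) z - y t j| <= 3 * eps &
    forall i, z ord0 i + rho ^+ 2 / eps *
      (\sum_j (pev (p j) z - y t j) / eps * pev (pd i (p j)) z) +
      rho ^+ 2 / 2 * pev (pd i h) z = s t ord0 i].
  have := @penalized_min R n m p h eps rho c0 (s t) (zz t.1) (\row_j y t j)
    e0 rho0 h_ge0 (zzc t.1) _ _ (zzh t.1).
  case=> [||z [z1 z2 z3 z4]].
  - apply: sum_le => [|i]; first by rewrite exprn_ge0 ?ltW.
    rewrite mxE addrC addKr sqr_ge0 /=.
    have /andP[f1 f2] := fr _ (ltn_ord (t.2 (lshift m i))).
    rewrite -[rho ^+ 2 / _]expr_div_n -/ls; apply: pw; first by rewrite mulr_ge0// ltW.
    by rewrite ger_pMr.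
  - have -> : \sum_j (pev (p j) (zz t.1) - (\row_j0 y t j0) ord0 j) ^+ 2 =
       \sum_j (ly * ((t.2 (rshift n j))%:R / B%:R)) ^+ 2.
      by apply: eq_bigr => j _; rewrite mxE /y mxE opprD addNKr sqrrN.
    apply: (@le_trans _ _ (\sum_(j < m) ly ^+ 2)).
      apply: ler_sum => j _; have /andP[f1 f2] := fr _ (ltn_ord (t.2 (rshift n j))).
      by apply: pw; [rewrite mulr_ge0// ltW | rewrite ger_pMr].
    rewrite sumr_const card_ord -[leLHS]mulr_natl /ly expr_div_n mulrCA -[leRHS]mulr1.
    rewrite ler_wpM2l ?exprn_ge0 ?(ltW e0)// ler_pdivrMr ?exprn_gt0// mul1r expr2.
    by rewrite ler_peMl// ler1n.
  - exists z; split=> // [j|i]; first by have := z3 j; rewrite mxE.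
    rewrite -z4; congr (_ + _ * _ + _); apply: eq_bigr => j _.
    by rewrite mxE.
have {zP} [z zP] := choice zP.
pose w t : 'rV[R]_m := \row_j ((pev (p j) (z t) - y t j) / eps).
pose P t := row_mx (z t - c0) (w t).
have Pr t : `|P t| <= r.
  have [z1 _ z3 _] := zP t.
  apply: norm_le_coord => [|i]; first exact: ltW.
  rewrite mxE; case: (fintype.split i) => j.
    rewrite !mxE; apply: (@le_trans _ _ (4 * rho)); last by rewrite /r; move: rho0; clear; lra.
    rewrite -(@ler_pXn2r _ 2) ?nnegrE ?mulr_ge0 ?(ltW rho0)// real_normK ?num_real//.
    apply: (@le_trans _ _ (12 * rho ^+ 2)).
      apply: le_trans z1; rewrite (bigD1 j)//= lerDl sumr_ge0// => l _.
      exact: sqr_ge0.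
    by rewrite exprMn ler_wpM2r ?exprn_ge0 ?(ltW rho0)//; clear; lra.
  rewrite mxE normrM [X in _ * X]gtr0_norm ?invr_gt0// ler_pdivrMr//.
  by apply: le_trans (z3 j) _; rewrite ler_wpM2r ?(ltW e0)// /r; move: rho0; clear; lra.
have PPsi t : polymap Psi (P t) = \row_i ((t.2 (lshift m i))%:R / B%:R).
  have [_ _ _ z4] := zP t.
  apply/rowP => i; rewrite !mxE /= pev_psumI !pev_pshift row_mxEl.
  rewrite (eq_bigr (fun j => (pev (p j) (z t) - y t j) / eps * pev (pd i (p j)) (z t))); last first.
    by move=> j _ /=; rewrite pev_pshift row_mxEr mxE.
  have := z4 i; rewrite [s t ord0 i]mxE => E.
  rewrite [(z t - c0) _ _]mxE [(- c0) _ _]mxE.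
  rewrite [X in _ * X](_ : _ = ls * ((t.2 (lshift m i))%:R / B%:R)); last first.
    by rewrite -[LHS](addrK (c0 ord0 i)) -[RHS](addKr (c0 ord0 i)) -E; ring.
  by rewrite mulKf// gt_eqF.
(* Up to a translation depending on the index only, the values of [G] are the lattice points, so
   [lattice_sard] applies to each index separately. *)
have PG t : polymap G (P t) = \row_i ((row_mx 0 (ly^-1 *: v t.1) : 'rV[R]_(n + m)) ord0 i
     + (t.2 i)%:R / B%:R).
  rewrite polymap_join PPsi; apply/rowP => i; rewrite -(splitK i) [RHS]mxE.
  case: (fintype.split i) => j /=.
    by rewrite !row_mxEl !mxE add0r.
  rewrite !row_mxEr !mxE /= pev_pshift row_mxEr mxE.
  have -> : pev (p j) (z t) + - eps * ((pev (p j) (z t) - y t j) / eps) = y t j.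
    by field; rewrite gt_eqF.
  by rewrite /y !mxE; field; rewrite !gt_eqF.
pose Gs := [set t : T | eta <= `|\det (pjac G (P t))|]%SET.
have bad_card : (2 * #|~: Gs| <= N * B ^ (n + m))%N.
  have H k : (#|[set t in ~: Gs | t.1 == k]%SET| <= (B ^ (n + m))./2)%N.
    have := sard B B0B (row_mx 0 (ly^-1 *: v k)) (fun b => P (k, b)) (fun b => Pr _)
      (fun b => PG (k, b)).
    set S := [set b | _]%SET => hS.
    apply: (@leq_trans #|S|); last by rewrite geq_half_double -mul2n.
    apply: leq_trans (leq_imset_card (pair k) S); apply/subset_leq_card/fintype.subsetP => -[k' b].
    rewrite !inE /= -ltNge => /andP[lt /eqP kE]; apply/imsetP; exists b.
      by rewrite inE -kE.
    by rewrite kE.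
  have := card_le_fibers_fin H; rewrite card_ord => H'.
  apply: leq_trans (leq_mul (leqnn 2) H') _.
  by rewrite mulnCA leq_mul2l mul2n -geq_half_double leqnn orbT.
have good_card : (N * B ^ (n + m) <= 2 * #|Gs|)%N.
  have := cardsC Gs; rewrite card_prod card_ffun !card_ord => E.
  by move: bad_card E; clear; lia.
pose fs (t : T) : {ffun 'I_n -> 'I_B} := [ffun i => t.2 (lshift m i)].
pose X := ((Num.truncn (2 * c4 / eps)).+1 ^ nu * (Num.truncn (c3 * m%:R * hh * B%:R)).+1 ^ m)%N.
have fiber u : (#|[set t in Gs | fs t == u]%SET| <=
   (n + m) ^ m * (Num.truncn (2 * r / hh)).+1 ^ m * (D.+2 ^ (n + m) * X))%N.
  set S := [set t in Gs | _]%SET.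
  apply: (fib hh hh0 hhh0 _ S (\row_i ((u i)%:R / B%:R)) P X) => [t|S' S'S close].
    rewrite !inE => /andP[tG /eqP tu]; split=> //.
    by rewrite PPsi; apply/rowP => i; rewrite !mxE -tu ffunE.
  apply: (@cluster_count R n m nu p N B eps M a C1 hh v S' z) => // [k l /sep[j hj]|t _|t t' tS t'S].
  - by exists j; rewrite !mxE.
  - by have [z1 z2 _ _] := zP t; exact: near.
  - have tt' := close t t' tS t'S.
    have PtE : P t - P t' = row_mx (z t - z t') (w t - w t').
      by rewrite /P opp_row_mx add_row_mx opprB addrA subrK.
    have zd : `|z t - z t'| <= 2 * (m.+1%:R * hh).
      apply: norm_le_coord => [|i]; first by rewrite !mulr_ge0// ltW.
      apply: le_trans tt'; have := coord_le_norm (P t - P t') (lshift m i).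
      by rewrite {1}PtE row_mxEl.
    have wd j : `|w t ord0 j - w t' ord0 j| <= 2 * (m.+1%:R * hh).
      apply: le_trans tt'; have := coord_le_norm (P t - P t') (rshift n j).
      by rewrite {1}PtE row_mxEr [(w t - w t') _ _]mxE [(- w t') _ _]mxE.
    have zb q : `|z q| <= `|c0| + r.
      rewrite -(subrK c0 (z q)) (le_trans (ler_normD _ _))// addrC lerD2l.
      apply: norm_le_coord => [|i]; first exact: ltW.
      by apply: le_trans (Pr q); have := coord_le_norm (P q) (lshift m i); rewrite {1}/P row_mxEl.
    split=> // [j|j|i].
    + have wj := wd j; rewrite !mxE in wj.
      rewrite -(@ler_pM2l _ eps^-1) ?invr_gt0// mulKf ?gt_eqF//.
      apply: le_trans wj; rewrite le_eqVlt; apply/orP; left; apply/eqP.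
      rewrite -[X in X * _]gtr0_norm ?invr_gt0// -normrM; congr (`|_|); rewrite /y /ly; ring.
    + have [_ _ _ tG] := taylor _ _ (zb t') (zb t).
      have := coord_le_norm (polymap p (z t) - polymap p (z t') - (z t - z t') *m pjac p (z t')) j.
      have -> : (polymap p (z t) - polymap p (z t') - (z t - z t') *m pjac p (z t')) ord0 j =
         pev (p j) (z t) - pev (p j) (z t') - \sum_i (z t - z t') ord0 i * pev (pd i (p j)) (z t').
        rewrite [LHS]mxE [X in X + _]mxE [(- _ : 'rV_m) _ _]mxE [(- _ : 'rV_m) _ _]mxE.
        rewrite [polymap _ _ _ _]mxE [polymap _ _ _ _]mxE; congr (_ - _).
        by rewrite mxE; apply: eq_bigr => i _; congr (_ * _); rewrite mxE.
      move/le_trans; apply; apply: le_trans tG _.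
      apply: (@le_trans _ _ (K * (2 * (m.+1%:R * hh)) ^+ 2)).
        rewrite ler_wpM2l ?(ltW K0)//; apply: lerXn2r zd; rewrite nnegrE//.
        by rewrite !mulr_ge0// ltW.
      have -> : K * (2 * (m.+1%:R * hh)) ^+ 2 = (K * (2 * m.+1%:R) ^+ 2 * hh) * hh by ring.
      by rewrite ler_wpM2r// ltW.
    + have q1 : t \in S by apply: (fintype.subsetP S'S).
      have q2 : t' \in S by apply: (fintype.subsetP S'S).
      move: q1 q2; rewrite !inE => /andP[_ /eqP q1] /andP[_ /eqP q2].
      have : fs t i = fs t' i by rewrite q1 q2.
      by rewrite !ffunE.
have := card_le_fibers_fin fiber; rewrite card_ffun !card_ord => tot.
have {tot} : (N * B ^ (n + m) <= 2 * (B ^ n * ((n + m) ^ m * (Num.truncn (2 * r / hh)).+1 ^ m * (D.+2 ^ (n + m) * X))))%N.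
  by apply: leq_trans good_card _; rewrite leq_mul2l tot.
rewrite expnD -(ler_nat R) /X !natrM !natrX => tot.
have Bn : 0 < B%:R ^+ n :> R by rewrite exprn_gt0.
have Bm : 0 < B%:R ^+ m :> R by rewrite exprn_gt0.
have f1 : (Num.truncn (2 * r / hh)).+1%:R <= (2 * r + 1) / hh.
  have q0 : 0 <= 2 * r / hh by rewrite divr_ge0 ?(ltW hh0)// mulr_ge0// ltW.
  have /andP[q1 _] := truncn_itv q0.
  rewrite -natr1 [leRHS]mulrDl lerD// div1r -[leLHS]invr1 lef_pV2 ?posrE//.
have f2 : (Num.truncn (2 * c4 / eps)).+1%:R <= (2 * c4 + 1) / eps.
  have q0 : 0 <= 2 * c4 / eps by rewrite divr_ge0 ?(ltW e0)//; move: c4_1; clear; lra.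
  have /andP[q1 _] := truncn_itv q0.
  rewrite -natr1 [leRHS]mulrDl lerD// div1r -[leLHS]invr1 lef_pV2 ?posrE//.
have f3 : (Num.truncn (c3 * m%:R * hh * B%:R)).+1%:R <= 2 * c3 * m%:R * hh * B%:R.
  have /andP[q1 _] := truncn_itv (le_trans ler01 cB).
  by rewrite -natr1; move: q1 cB; clear; lra.
rewrite -(ler_pM2r (mulr_gt0 Bn Bm)); apply: le_trans tot _.
have -> : 2 * ((n + m)%:R * (2 * r + 1) * (2 * c3 * m%:R)) ^+ m * D.+2%:R ^+ (n + m) *
     ((2 * c4 + 1) / eps) ^+ nu * (B%:R ^+ n * B%:R ^+ m) =
   2 * (B%:R ^+ n * ((n + m)%:R ^+ m * ((2 * r + 1) / hh) ^+ m * (D.+2%:R ^+ (n + m) *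
     (((2 * c4 + 1) / eps) ^+ nu * (2 * c3 * m%:R * hh * B%:R) ^+ m)))).
  have -> : ((2 * r + 1) / hh) ^+ m = (2 * r + 1) ^+ m * (hh ^+ m)^-1.
    by rewrite exprMn exprVn.
  rewrite !exprMn; field.
  by rewrite expf_neq0// gt_eqF.
rewrite ler_wpM2l// ler_wpM2l ?(ltW Bn)// ler_pM ?mulr_ge0 ?exprn_ge0//.
  by rewrite ler_wpM2l ?exprn_ge0// pw.
rewrite ler_wpM2l ?exprn_ge0// ler_pM ?exprn_ge0// pw//.
Qed.

(** * The inner product *)

(** Polarisation: only a norm is given, and the parallelogram law has to supply bilinearity
    (Jordan--von Neumann). *)
Definition inner (V : normedModType RR) (x y : V) : RR :=
  (`|x + y| ^+ 2 - `|x - y| ^+ 2) / 4.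

Lemma innerC (V : normedModType RR) (x y : V) : inner x y = inner y x.
Proof. by rewrite /inner [x + y]addrC [`|x - y|]distrC. Qed.

Lemma innerxx (V : normedModType RR) (x : V) : inner x x = `|x| ^+ 2.
Proof.
rewrite /inner subrr normr0 expr0n subr0 -mulr2n -scaler_nat normrZ exprMn.
by rewrite ger0_norm//; field.
Qed.

(** The parallelogram law is applied to x + x' + y split in two ways, and to x + x' - y likewise; in
    the combination the norms of the differences cancel. *)
Lemma innerDl (V : normedModType RR) : parallelogram_law V ->
  forall x x' y : V, inner (x + x') y = inner x y + inner x' y.
Proof.
move=> PL x x' y; rewrite /inner.
have A := PL (x + y) x'; have B := PL (x' + y) x.
have A' := PL (x - y) x'; have B' := PL (x' - y) x.
have E1 : x + y + x' = x + x' + y by rewrite addrAC.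
have E2 : x' + y + x = x + x' + y by rewrite addrAC [x' + x]addrC.
have E3 : x - y + x' = x + x' - y by rewrite addrAC.
have E4 : x' - y + x = x + x' - y by rewrite addrAC [x' + x]addrC.
have E5 : `|x - y - x'| = `|x' + y - x|.
  by rewrite -normrN; congr (`|_|); rewrite !opprD !opprK addrC addrA addrAC.
have E6 : `|x' - y - x| = `|x + y - x'|.
  by rewrite -normrN; congr (`|_|); rewrite !opprD !opprK addrC addrA addrAC.
rewrite E1 in A; rewrite E2 in B; rewrite E3 E5 in A'; rewrite E4 E6 in B'.
lra.
Qed.

Lemma inner_le (V : normedModType RR) : parallelogram_law V ->
  forall x y : V, `|inner x y| <= (`|x| ^+ 2 + `|y| ^+ 2) / 2.
Proof.
move=> PL x y; have := PL x y; rewrite /inner.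
have := sqr_ge0 `|x + y|; have := sqr_ge0 `|x - y|.
move: (`|x + y| ^+ 2) (`|x - y| ^+ 2) => a b a0 b0 E.
by rewrite ler_norml; apply/andP; split; lra.
Qed.

(* The defect of homogeneity is additive and vanishes at 1, hence it is
   1-periodic and bounded, hence 0. *)
Lemma innerZl (V : normedModType RR) : parallelogram_law V ->
  forall (a : RR) (x y : V), inner (a *: x) y = a * inner x y.
Proof.
move=> PL a x y; pose g a := inner (a *: x) y - a * inner x y.
have gD b c : g (b + c) = g b + g c.
  by rewrite /g scalerDl innerDl//; ring.
have g0 : g 0 = 0 by have := gD 0 0; rewrite addr0; lra.
have gN b : g (- b) = - g b by have := gD b (- b); rewrite subrr g0; lra.
have g1 : g 1 = 0 by rewrite /g scale1r mul1r subrr.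
have gn k b : g (k%:R * b) = k%:R * g b.
  elim: k => [|k IH]; first by rewrite !mul0r g0.
  by rewrite -natr1 mulrDl gD IH mul1r; ring.
pose C := (`|x| ^+ 2 + `|y| ^+ 2) / 2 + `|inner x y|.
have g01 b : 0 <= b <= 1 -> `|g b| <= C.
  move=> /andP[b0 b1]; rewrite /g (le_trans (ler_normB _ _))// lerD//.
    rewrite (le_trans (inner_le PL _ _))// ler_wpM2r// lerD2r.
    by rewrite normrZ ger0_norm// exprMn ler_piMl ?exprn_ge0// exprn_ile1.
  by rewrite normrM ger0_norm// ler_piMl.
have gB b : `|g b| <= C.
  wlog b0 : b / 0 <= b => [W|].
    by case: (lerP 0 b) => [/W//|/ltW b0]; rewrite -normrN -gN W// oppr_ge0.
  have /andP[h1 h2] := truncn_itv b0; rewrite -natr1 in h2.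
  rewrite -(subrK (Num.truncn b)%:R b) gD.
  have -> : g (Num.truncn b)%:R = 0 by rewrite -[_%:R]mulr1 gn g1 mulr0.
  by rewrite addr0 g01//; apply/andP; split; lra.
suff : g a = 0 by rewrite /g => /eqP; rewrite subr_eq0 => /eqP.
apply/eqP; apply: contraT => ga0.
have ga : 0 < `|g a| by rewrite normr_gt0.
have C0 : 0 <= C / `|g a| by rewrite divr_ge0// (le_trans _ (gB 0)).
have := gB ((Num.truncn (C / `|g a|)).+1%:R * a).
rewrite gn normrM ger0_norm// leNgt.
by have /andP[_] := truncn_itv C0; rewrite ltr_pdivrMr// => ->.
Qed.

Lemma inner_suml (V : normedModType RR) : parallelogram_law V ->
  forall k (t : 'I_k -> RR) (b : 'I_k -> V) (y : V),
  inner (\sum_i t i *: b i) y = \sum_i t i * inner (b i) y.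
Proof.
move=> PL k t b y.
have i0 : inner 0 y = 0 by have := innerZl PL 0 0 y; rewrite scale0r mul0r.
rewrite (big_morph (fun x => inner x y) (fun a c => innerDl PL a c y) i0).
by apply: eq_bigr => i _; rewrite innerZl.
Qed.

Lemma orthonormal_norm (V : normedModType RR) : parallelogram_law V ->
  forall k (b : 'I_k -> V), (forall i j, inner (b i) (b j) = (i == j)%:R) ->
  forall t : 'I_k -> RR, `|\sum_i t i *: b i| ^+ 2 = \sum_i t i ^+ 2.
Proof.
move=> PL k b ob t; rewrite -innerxx inner_suml//; apply: eq_bigr => i _.
rewrite innerC inner_suml// (bigD1 i)//= ob eqxx mulr1 big1 ?addr0//.
by move=> j /negPf ji; rewrite ob ji mulr0.
Qed.

(** Gram--Schmidt, where vectors already in the span are dropped, hence [k <= n]. In orthonormal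
    coordinates the Euclidean distance is that of [V], so no constant depends on [e]. *)
Lemma orthonormal_span (V : normedModType RR) : parallelogram_law V ->
  forall n (e : 'I_n -> V), exists k (b : 'I_k -> V),
  [/\ (k <= n)%N, forall t : 'I_k -> RR, `|\sum_i t i *: b i| ^+ 2 = \sum_i t i ^+ 2 &
    forall i, exists t : 'I_k -> RR, e i = \sum_j t j *: b j].
Proof.
move=> PL n e.
suff [k [b [kn ob be]]] : exists k (b : 'I_k -> V),
  [/\ (k <= n)%N, forall i j, inner (b i) (b j) = (i == j)%:R &
    forall i, exists t : 'I_k -> RR, e i = \sum_j t j *: b j].
  by exists k, b; split=> //; exact: orthonormal_norm.
elim: n e => [|n IH] e.
  by exists 0%N, (fun=> 0); split=> // -[].
have [k [b [kn ob be]]] := IH (fun i => e (lift ord0 i)).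
pose u := e ord0; pose r := u - \sum_i inner u (b i) *: b i.
have [r0|r0] := eqVneq r 0.
  exists k, b; split=> // [|i]; first exact: leq_trans kn _.
  case: (unliftP ord0 i) => [j|] -> //.
  by exists (fun i => inner u (b i)); apply/eqP; rewrite -subr_eq0; apply/eqP.
have rb j : inner r (b j) = 0.
  rewrite /r -scaleN1r innerDl// innerZl// inner_suml// (bigD1 j)//= ob eqxx.
  rewrite big1 => [|i /negPf ij]; first by rewrite mulr1n; ring.
  by rewrite ob ij mulr0.
have rn0 : `|r| != 0 by rewrite normr_eq0.
pose c := `|r|^-1 *: r.
have cb j : inner c (b j) = 0 by rewrite innerZl// rb mulr0.
have cc : inner c c = 1.
  by rewrite innerxx normrZ normfV normr_id mulVf// expr1n.
pose b' (i : 'I_k.+1) := oapp b c (unlift ord0 i).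
have b'0 : b' ord0 = c by rewrite /b' unlift_none.
have b'S i : b' (lift ord0 i) = b i by rewrite /b' liftK.
exists k.+1, b'; split=> // [i j|i].
- case: (unliftP ord0 i) => [i'|] ->; case: (unliftP ord0 j) => [j'|] ->;
    rewrite ?b'0 ?b'S//.
  + by rewrite innerC cb.
- case: (unliftP ord0 i) => [j|] ->.
    have [t tE] := be j; exists (fun i => oapp t 0 (unlift ord0 i)).
    rewrite big_ord_recl unlift_none scale0r add0r tE.
    by apply: eq_bigr => l _; rewrite liftK b'S.
  exists (fun i => oapp (fun i => inner u (b i)) `|r| (unlift ord0 i)).
  rewrite big_ord_recl unlift_none b'0 /c scalerA divff// scale1r /=.
  under eq_bigr do rewrite liftK b'S /=.
  by rewrite /r subrK.
Qed.

(** * Localisation in the Hilbert space *)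

Lemma diff_direction (V : normedModType RR) m (f : V -> 'rV[RR]_m) (a v : V) :
  differentiable f a -> forall e : RR, 0 < e -> exists2 del : RR, 0 < del &
  forall t : RR, `|t| < del -> `|f (a + t *: v) - f a - t *: 'd f a v| <= e * `|t|.
Proof.
move=> dfa e e0; have H := @diff_derivable _ _ _ f a v dfa.
have {H} : (fun h : RR => h^-1 *: ((f \o shift a) (h *: v) - f a)) @ (0 : RR)^' --> 'd f a v.
  by rewrite -deriveE//; exact: H.
move=> /cvgrPdist_le /(_ e e0); rewrite near_withinE => /nbhs_ballP[del /= del0 hd].
exists del => // t td.
have [->|t0] := eqVneq t 0.
  by rewrite !scale0r addr0 subrr subr0 !normr0 mulr0.
have {hd} := hd t; rewrite /ball /= sub0r normrN => /(_ td t0).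
rewrite [t *: v + a]addrC => h.
have -> : f (a + t *: v) - f a - t *: 'd f a v =
    t *: - ('d f a v - t^-1 *: (f (a + t *: v) - f a)).
  by rewrite opprB scalerBr scalerA divff// scale1r.
by rewrite normrZ normrN mulrC ler_wpM2r.
Qed.

Lemma mean_value_eps (R : realType) (g dg : R -> R) :
  (forall t e : R, 0 < e -> exists2 del : R, 0 < del &
    forall s : R, `|s| < del -> `|g (t + s) - g t - s * dg t| <= e * `|s|) ->
  exists2 c : R, 0 <= c <= 1 & g 1 - g 0 = dg c.
Proof.
move=> dirg.
have Dg (t : R) : is_derive t 1 g (dg t).
  have H : (fun h : R => h^-1 *: ((g \o shift t) (h *: 1) - g t)) @ (0 : R)^' --> dg t.
    apply/cvgrPdist_le => e e0; rewrite near_withinE; apply/nbhs_ballP.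
    have [del del0 Hd] := dirg t e e0; exists del => // s; rewrite /ball /= sub0r normrN => sd s0.
    rewrite -(@ler_pM2l _ `|s|) ?normr_gt0// -normrM [leRHS]mulrC.
    apply: le_trans (Hd s sd); rewrite mulrBr /GRing.scale /= mulr1 mulVKf// [s + t]addrC.
    by rewrite distrC.
  by apply: DeriveDef; [apply: cvgP H|exact: cvg_lim H].
have cg : {within `[0, 1], continuous g}.
  apply: continuous_subspaceT => t; apply/differentiable_continuous/derivable1_diffP.
  by case: (Dg t).
have [c] := MVT (@ltr01 R) (fun t _ => Dg t) cg.
rewrite subr0 mulr1 in_itv /= => /andP[c0 c1] E.
by exists c => //; rewrite !ltW.
Qed.

(** The norm of the target is the maximum of the coordinates, so the scalar mean value theorem in
    each coordinate loses no constant. *)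
Lemma mean_value_le (V : normedModType RR) m (f : V -> 'rV[RR]_m) (M : RR) (y z : V) :
  0 <= M -> (forall x, differentiable f x) ->
  (forall t : RR, 0 <= t <= 1 -> forall h, `|'d f (z + t *: (y - z)) h| <= M * `|h|) ->
  `|f y - f z| <= M * `|y - z|.
Proof.
move=> M0 df HM; set v := y - z in HM *.
apply: norm_le_coord => [|j]; first by rewrite mulr_ge0.
pose g (t : RR) : RR := f (z + t *: v) ord0 j.
pose dg (t : RR) : RR := ('d f (z + t *: v) v) ord0 j.
have dirg t (e : RR) : 0 < e -> exists2 del : RR, 0 < del &
    forall s : RR, `|s| < del -> `|g (t + s) - g t - s * dg t| <= e * `|s|.
  move=> e0; have [del del0 H] := diff_direction v (df (z + t *: v)) e0.
  exists del => // s sd; apply: le_trans (H s sd).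
  apply: le_trans (coord_le_norm _ j); rewrite /g /dg.
  by rewrite scalerDl addrA !mxE.
have [c c01] := mean_value_eps dirg.
have zv : z + v = y by rewrite /v addrC subrK.
rewrite /g scale1r scale0r addr0 zv => E.
by rewrite !mxE E /dg; apply: le_trans (coord_le_norm _ j) (HM _ _ _).
Qed.

Lemma local_constants (V : normedModType RR) m (f : V -> 'rV[RR]_m) (x0 : V) :
  frechet_C1 f -> locally_lipschitz_diff f ->
  exists r L M : RR, [/\ 0 < r, 0 <= L, 0 <= M,
    forall y h, `|y - x0| < r -> `|'d f y h| <= M * `|h| &
    forall y z h, `|y - x0| < r -> `|z - x0| < r ->
      `|'d f y h - 'd f z h| <= L * `|y - z| * `|h|].
Proof.
move=> [df _] /(_ x0)[r [L [r0 HL]]].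
have [k k0 Hk] := linear_lipschitz (diff_continuous (df x0)).
(* The given Lipschitz constant has no sign, hence the absolute value; [k] bounds the differential
   at [x0], and the second summand its variation on the ball. *)
exists r, `|L|, (k + `|L| * r); split=> //; first by rewrite addr_ge0 ?mulr_ge0// ltW.
  move=> y h yr; rewrite -(subrK ('d f x0 h) ('d f y h)) (le_trans (ler_normD _ _))//.
  rewrite mulrDl addrC lerD//.
  have x0r : `|x0 - x0| < r by rewrite subrr normr0.
  apply: le_trans (HL y x0 yr x0r h) _; rewrite ler_wpM2r//.
  apply: (@le_trans _ _ (`|L| * `|y - x0|)); first by rewrite ler_wpM2r// ler_norm.
  by rewrite ler_wpM2l// ltW.
move=> y z h yr zr; apply: le_trans (HL y z yr zr h) _.
by rewrite ler_wpM2r// ler_wpM2r// ler_norm.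
Qed.

(** Identifies the formal derivatives of the polynomial representing [f] on a subspace with the
    differential of [f]: two first-order expansions along a coordinate line agree. *)
Lemma pd_unique (R : realType) n (p : pexp R n) (z : 'rV[R]_n) i (D : R) :
  (forall e : R, 0 < e -> exists2 del : R, 0 < del & forall t : R, `|t| < del ->
     `|pev p (z + t *: delta_mx ord0 i) - pev p z - t * D| <= e * `|t|) ->
  pev (pd i p) z = D.
Proof.
move=> H; apply/eqP; rewrite -subr_eq0; apply/eqP; set g := _ - D.
apply/eqP; apply: contraT => g0; have gp : 0 < `|g| by rewrite normr_gt0.
have [K K0 taylor] := pexp_taylor p (`|z| + 1).
have [del del0 Hd] := H (`|g| / 4) ltac:(by rewrite divr_gt0).
pose t := Num.min (Num.min (del / 2) 1) (`|g| / (4 * (K + 1))).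
have K1 : 0 < 4 * (K + 1) by rewrite mulr_gt0// ltr_wpDl.
have t0 : 0 < t by rewrite !lt_min (divr_gt0 del0)// ltr01 divr_gt0.
have td : t <= del / 2 by rewrite /t !ge_min lexx.
have t1 : t <= 1 by rewrite /t !ge_min lexx orbT.
have tg : t * (4 * (K + 1)) <= `|g| by rewrite -ler_pdivlMr// /t !ge_min lexx orbT.
clearbody t.
set v := t *: delta_mx ord0 i : 'rV[R]_n.
have vE l : v ord0 l = t * (l == i)%:R by rewrite !mxE eqxx.
have vn : `|v| <= t.
  apply: norm_le_coord => [|l]; first exact: ltW.
  by rewrite vE; case: (_ == _); rewrite ?mulr1n ?mulr0n ?mulr1 ?mulr0 ?normr0 ?gtr0_norm// ltW.
have zr : `|z| <= `|z| + 1 by rewrite lerDl.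
have zvr : `|z + v| <= `|z| + 1.
  by rewrite (le_trans (ler_normD _ _))// lerD2l (le_trans vn).
have [_ _] := taylor _ _ zr zvr.
rewrite [z + v - z]addrC addKr (bigD1 i)//= big1 => [|l /negPf li]; last first.
  by rewrite vE li mulr0n mulr0 mul0r.
rewrite addr0 vE eqxx mulr1n mulr1 => h1.
have h2 := Hd t ltac:(by rewrite gtr0_norm//; lra).
have h3 : `|t * g| <= K * `|v| ^+ 2 + `|g| / 4 * `|t|.
  have -> : t * g = (pev p (z + v) - pev p z - t * D)
     - (pev p (z + v) - pev p z - t * pev (pd i p) z) by rewrite /g; ring.
  by rewrite (le_trans (ler_normB _ _))// addrC lerD.
have h4 : K * `|v| ^+ 2 <= K * t ^+ 2.
  by rewrite ler_wpM2l//; apply: lerXn2r vn; rewrite nnegrE// ltW.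
rewrite normrM gtr0_norm// in h3.
have h5 : K * t ^+ 2 <= `|g| / 4 * t.
  rewrite expr2 mulrA ler_wpM2r ?(ltW t0)//; lra.
have : 0 < t * `|g| by rewrite mulr_gt0.
lra.
Qed.

Lemma pexp_of_poly d k n (g : ('I_k -> RR) -> RR) (io : 'I_k -> 'I_n) :
  is_poly_deg_le d g -> exists2 p : pexp RR n, (pdeg p <= d)%N &
    forall z : 'rV[RR]_n, pev p z = g (fun i => z ord0 (io i)).
Proof.
move=> [c [c0 gE]].
pose mon (a : {ffun 'I_k -> 'I_d.+1}) : pexp RR n :=
  pprod (flatten [seq nseq (a i) (PX (io i)) | i <- enum 'I_k]).
have monE a z : pev (mon a) z = \prod_i z ord0 (io i) ^+ a i.
  rewrite pev_pprod big_flatten big_map big_enum; apply: eq_bigr => i _.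
  by rewrite big_nseq iter_mulr_1.
have mond a : pdeg (mon a) = (\sum_i (a i : nat))%N.
  rewrite pdeg_pprod big_flatten big_map big_enum; apply: eq_bigr => i _.
  by rewrite big_nseq /= iter_addn_0 mul1n.
(* The degree bound is syntactic, so the monomials of degree above [d], whose coefficients vanish,
   have to be left out. *)
pose term (a : {ffun 'I_k -> 'I_d.+1}) : pexp RR n :=
  if (d < \sum_(i < k) (a i : nat))%N then PC 0 else PMul (PC (c a)) (mon a).
exists (psum [seq term a | a <- enum {ffun 'I_k -> 'I_d.+1}]).
  elim: (enum _) => //= a s IH; rewrite geq_max IH andbT /term.
  by case: ltnP => // h; rewrite /= mond add0n.
move=> z; rewrite gE pev_psum big_map big_enum; apply: eq_bigr => a _.
by rewrite /term; case: ltnP => [/c0 ->|_] /=; rewrite ?mul0r// monE.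
Qed.

(** The columns [s] carry the largest minor. By Cramer's rule each coefficient is a quotient of
    another minor by this one; the resulting bound 1 keeps the additional variables a_jl in a fixed
    region. *)
Lemma max_minor_coords (r m : nat) (w : 'M[RR]_(r, m)) : row_free w ->
  exists (s : 'I_r -> 'I_m) (A : 'I_m -> 'I_r -> RR),
    (forall j l, `|A j l| <= 1) /\ forall j i, w i j = \sum_l A j l * w i (s l).
Proof.
move=> wf.
pose F (s : {ffun 'I_r -> 'I_m}) : RR := `|\det (\matrix_(i, l) w i (s l))|.
have [s0 s0P] : exists s0 : {ffun 'I_r -> 'I_m}, 0 < F s0.
  have wTf : row_full w^T by rewrite /row_full mxrank_tr; exact: wf.
  exists [ffun i => fullrankfun wTf i]; rewrite /F normr_gt0.
  have := mxrank_fullrowsub wTf => rk.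
  have U : rowsub (fullrankfun wTf) w^T \in unitmx.
    by rewrite -row_free_unit /row_free rk.
  move: U; rewrite -unitmx_tr unitmxE unitfE; congr (\det _ != 0).
  by apply/matrixP => i l; rewrite !mxE ?ffunE.
have [s _ sP] := @arg_maxP _ _ _ s0 xpredT F isT.
have Fs : 0 < F s by apply: lt_le_trans s0P (sP s0 isT).
pose B := \matrix_(i, l) w i (s l).
have Bu : B \in unitmx by rewrite unitmxE unitfE -normr_gt0.
exists s, (fun j l => (invmx B *m w) l j); split=> [j l|j i]; last first.
  have := congr1 (fun N : 'M[RR]_(r, m) => N i j) (mulKVmx Bu w).
  by rewrite mxE => <-; apply: eq_bigr => l _; rewrite mulrC [B i l]mxE.
pose s' : {ffun 'I_r -> 'I_m} := [ffun k => if k == l then j else s k].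
have E : \det (\matrix_(i, k) w i (s' k)) = \det B * (invmx B *m w) l j.
  rewrite (expand_det_col _ l) [(invmx B *m w) l j]mxE mulr_sumr; apply: eq_bigr => i _.
  have invE : invmx B l i = (\det B)^-1 * cofactor B i l by rewrite /invmx Bu !mxE.
  have dB : \det B != 0 by rewrite -normr_gt0.
  rewrite invE [(\matrix_(i, k) w i (s' k)) i l]mxE ffunE eqxx.
  have -> : cofactor (\matrix_(i, k) w i (s' k)) i l = cofactor B i l.
    rewrite /cofactor; congr (_ * \det _).
    by apply/matrixP => a b; rewrite !mxE ffunE eq_sym (negPf (neq_lift _ _)).
  by rewrite -mulrA mulVKf// mulrC.
have := sP s' isT; rewrite /F E normrM -/B => h.
by rewrite -(ler_pM2l Fs) mulr1; exact: h.
Qed.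

Lemma crit_coords (V : normedModType RR) m (f : V -> 'rV[RR]_m) (x : V) nu :
  (0 < m)%N -> rank_diff_le f x nu ->
  exists (s : 'I_nu -> 'I_m) (A : 'I_m -> 'I_nu -> RR), (forall j l, `|A j l| <= 1) /\
    forall h j, 'd f x h ord0 j = \sum_l A j l * 'd f x h ord0 (s l).
Proof.
move=> m0 [w Hw]; pose W : 'M[RR]_(nu, m) := \matrix_i w i.
have [s [A [A1 AE]]] := max_minor_coords (row_base_free W).
have rW : (\rank W <= nu)%N by exact: rank_leq_row.
pose s' (l : 'I_nu) : 'I_m := oapp s (Ordinal m0) (insub (val l)).
pose A' j (l : 'I_nu) : RR := oapp (A j) 0 (insub (val l)).
exists s', A'; split=> [j l|h j].
  by rewrite /A'; case: insubP => [k _ _|_] /=; rewrite ?normr0.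
have : ('d f x h <= row_base W)%MS.
  rewrite eq_row_base; have [t ->] := Hw h.
  by apply: summx_sub => i _; apply: scalemx_sub; rewrite -(rowK w i) row_sub.
case/submxP => D DE.
have -> : \sum_l A' j l * 'd f x h ord0 (s' l) = \sum_l A j l * 'd f x h ord0 (s l).
  pose F (i : nat) : RR := oapp (fun k : 'I_(\rank W) => A j k * 'd f x h ord0 (s k)) 0 (insub i).
  have -> : \sum_l A j l * 'd f x h ord0 (s l) = \sum_(k < \rank W) F k.
    by apply: eq_bigr => k _; rewrite /F valK.
  rewrite (big_ord_widen nu F rW) [RHS]big_mkcond; apply: eq_bigr => i _.
  by rewrite /A' /s' /F; case: insubP => [k -> _|/negPf ->] //=; rewrite mul0r.
rewrite DE mxE; under [RHS]eq_bigr do rewrite mxE mulr_sumr.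
rewrite exchange_big /=; apply: eq_bigr => i _.
by rewrite AE mulr_sumr; apply: eq_bigr => l _; rewrite mulrCA.
Qed.

(** The factors independent of [n] and [eps]. Here [k2], [k3], [k4] are the constants [c2], [c3],
    [c4] of [almost_critical_count] in dimension 1, and the last factor pays for the [m * nu]
    additional variables. *)
Definition count_const (R : realType) (d m nu : nat) (rho M a C1 : R) : R :=
  let r := 4 * rho + 3 in
  let k2 := C1 * (2 * m.+1%:R) + 2 * m.+1%:R + 1 + nu%:R * a in
  let k3 := 2 * k2 + nu%:R * a in
  let k4 := M * (2 * m.+1%:R) + 1 in
  2 * (m.+1%:R * (2 * r + 1) * (2 * k3 * m%:R)) ^+ m * (2 * k4 + 1) ^+ nu *
     d.+2%:R ^+ m * (2 ^+ (3 * m) * d.+2%:R) ^+ (m * nu).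

Lemma count_const_ge0 (R : realType) (d m nu : nat) (rho M a C1 : R) :
  0 < rho -> 0 <= M -> 0 <= a -> 0 <= C1 -> 0 <= count_const d m nu rho M a C1.
Proof.
move=> rho0 M0 a0 C10.
have m2 : 0 <= 2 * m.+1%:R :> R by rewrite mulr_ge0.
have nua : 0 <= nu%:R * a by rewrite mulr_ge0.
have h1 : 0 <= 2 * (4 * rho + 3) + 1.
  by rewrite !addr_ge0// mulr_ge0// addr_ge0// mulr_ge0// ltW.
have h2 : 0 <= C1 * (2 * m.+1%:R) + 2 * m.+1%:R + 1 + nu%:R * a.
  by rewrite !addr_ge0// mulr_ge0.
have h3 : 0 <= 2 * (M * (2 * m.+1%:R) + 1) + 1.
  by rewrite addr_ge0// mulr_ge0// addr_ge0// mulr_ge0.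
have h4 : 0 <= 2 * (C1 * (2 * m.+1%:R) + 2 * m.+1%:R + 1 + nu%:R * a) + nu%:R * a.
  by rewrite addr_ge0// mulr_ge0.
rewrite /count_const !mulr_ge0 ?exprn_ge0// ?mulr_ge0 ?exprn_ge0//.
Qed.

(** With [s] standing for n' + 1, the polynomial dependence on the dimension is at most s^(2m + nu)
    <= s^(3m); since s <= 2^n', it becomes exponential. This is the origin of [2 ^+ (3 * m)] in the
    base. *)
Lemma count_bound_crude (R : realType) (d m nu n n' N : nat) (rho M a C1 eps : R) :
  let r := 4 * rho + 3 in
  let k2 := C1 * (2 * m.+1%:R) + 2 * m.+1%:R + 1 + nu%:R * a in
  let k3 := 2 * k2 + nu%:R * a in
  let k4 := M * (2 * m.+1%:R) + 1 in
  let c2 := (n'%:R * C1 + 1) * (2 * m.+1%:R) + 1 + nu%:R * a in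
  let c3 := 2 * c2 + nu%:R * a in
  let c4 := n'%:R * M * (2 * m.+1%:R) + 1 in
  let b := 2 ^+ (3 * m) * d.+2%:R in
  0 < rho -> 0 <= M -> 0 <= a -> 0 <= C1 -> 0 < eps -> (nu <= m)%N -> (n' <= n + m * nu)%N ->
  N%:R <= 2 * ((n' + m)%:R * (2 * r + 1) * (2 * c3 * m%:R)) ^+ m * d.+2%:R ^+ (n' + m) *
     ((2 * c4 + 1) / eps) ^+ nu ->
  N%:R <= count_const d m nu rho M a C1 * b ^+ n / eps ^+ nu.
Proof.
move=> r k2 k3 k4 c2 c3 c4 b rho0 M0 a0 C10 e0 num n'n /le_trans; apply.
rewrite /count_const -/r -/k2 -/k3 -/k4 -/b.
pose s : R := n'.+1%:R.
have s1 : 1 <= s by rewrite /s ler1n.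
have sE : n'%:R = s - 1 :> R by rewrite /s -natr1; ring.
have m1 : 0 <= m.+1%:R :> R by [].
have nua : 0 <= nu%:R * a by rewrite mulr_ge0.
have m2 : 0 <= 2 * m.+1%:R :> R by rewrite mulr_ge0.
have n'0 : 0 <= n'%:R :> R by [].
have s0 : 0 <= s by exact: le_trans s1.
have nuas : nu%:R * a <= s * (nu%:R * a) by rewrite ler_peMl.
have Cm0 : 0 <= C1 * (2 * m.+1%:R) by rewrite mulr_ge0.
have Mm0 : 0 <= M * (2 * m.+1%:R) by rewrite mulr_ge0.
have c2s : c2 <= s * k2.
  have -> : c2 = n'%:R * (C1 * (2 * m.+1%:R)) + 2 * m.+1%:R + 1 + nu%:R * a by rewrite /c2; ring.
  rewrite /k2 !mulrDr mulr1 lerD// lerD// lerD//; last by rewrite ler_peMl.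
  by rewrite ler_wpM2r// sE; lra.
have c3s : c3 <= s * k3 by rewrite /c3 /k3; lra.
have c4s : 2 * c4 + 1 <= s * (2 * k4 + 1).
  rewrite /c4 /k4 sE.
  have -> : (s - 1) * M * (2 * m.+1%:R) = s * (M * (2 * m.+1%:R)) - M * (2 * m.+1%:R) by ring.
  by clear -s1 Mm0; lra.
have c20 : 0 <= c2 by rewrite /c2 !addr_ge0// mulr_ge0// addr_ge0// mulr_ge0.
have c30 : 0 <= c3 by rewrite /c3 addr_ge0// mulr_ge0.
have c40 : 0 <= 2 * c4 + 1 by rewrite /c4 !addr_ge0// mulr_ge0// addr_ge0// !mulr_ge0.
have r0 : 0 <= 2 * r + 1 by rewrite /r; clear -rho0; lra.
have nm : (n' + m)%:R <= s * m.+1%:R.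
  by rewrite /s -natrM ler_nat; clear; nia.
have pw (x x' : R) k : 0 <= x -> x <= x' -> x ^+ k <= x' ^+ k.
  by move=> x0 xy; rewrite lerXn2r// nnegrE// (le_trans x0).
have k30 : 0 <= k3.
  by rewrite /k3 /k2 addr_ge0// mulr_ge0// !addr_ge0.
have k40 : 0 <= 2 * k4 + 1 by rewrite /k4 !addr_ge0// mulr_ge0// addr_ge0.
have A1 : ((n' + m)%:R * (2 * r + 1) * (2 * c3 * m%:R)) ^+ m <=
    (s ^+ 2) ^+ m * (m.+1%:R * (2 * r + 1) * (2 * k3 * m%:R)) ^+ m.
  rewrite -exprMn; apply: pw; first by rewrite !mulr_ge0.
  have -> : s ^+ 2 * (m.+1%:R * (2 * r + 1) * (2 * k3 * m%:R)) =
     (s * m.+1%:R) * (2 * r + 1) * (2 * (s * k3) * m%:R) by ring.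
  apply: ler_pM; rewrite ?mulr_ge0//; first by rewrite ler_wpM2r.
  by rewrite ler_wpM2r// ler_wpM2l.
have A2 : ((2 * c4 + 1) / eps) ^+ nu <= s ^+ nu * (2 * k4 + 1) ^+ nu / eps ^+ nu.
  by rewrite -!exprMn -expr_div_n; apply: pw; rewrite ?divr_ge0 ?(ltW e0)// ler_wpM2r ?invr_ge0 ?(ltW e0).
have s2 : s <= 2 ^+ n' by rewrite /s -natrX ler_nat ltn_expl.
have A3 : (s ^+ 2) ^+ m * s ^+ nu <= (2 ^+ (3 * m)) ^+ n'.
  rewrite -exprM -exprD; apply: (@le_trans _ _ (s ^+ (3 * m))).
    by rewrite ler_weXn2l//; clear -num; lia.
  by rewrite -[leRHS]exprM [(3 * m * n')%N]mulnC [leRHS]exprM; apply: pw.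
have b1 : 1 <= b.
  by rewrite /b -[leLHS]mulr1 ler_pM// ?exprn_ege1 ?ler1n.
have A4 : d.+2%:R ^+ (n' + m) * ((2 ^+ (3 * m)) ^+ n') <= d.+2%:R ^+ m * b ^+ (m * nu) * b ^+ n.
  rewrite exprD mulrAC -exprMn [d.+2%:R * _]mulrC -/b [leLHS]mulrC -mulrA -exprD.
  rewrite ler_wpM2l ?exprn_ge0//; apply: ler_weXn2l => //.
  by rewrite addnC.
have q1 : 0 <= (m.+1%:R * (2 * r + 1) * (2 * k3 * m%:R)) ^+ m.
  by rewrite exprn_ge0// !mulr_ge0.
have q2 : 0 <= (2 * k4 + 1) ^+ nu by rewrite exprn_ge0.
have q3 : 0 <= (eps ^+ nu)^-1 by rewrite invr_ge0 exprn_ge0// ltW.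
have q4 : 0 <= d.+2%:R ^+ (n' + m) :> R by rewrite exprn_ge0.
set Q1 := (m.+1%:R * (2 * r + 1) * (2 * k3 * m%:R)) ^+ m in A1 q1 *.
set Q2 := (2 * k4 + 1) ^+ nu in A2 q2 *.
apply: (@le_trans _ _ (2 * ((s ^+ 2) ^+ m * Q1) * d.+2%:R ^+ (n' + m) * (s ^+ nu * Q2 / eps ^+ nu))).
  have p1 : 0 <= ((n' + m)%:R * (2 * r + 1) * (2 * c3 * m%:R)) ^+ m.
    by rewrite exprn_ge0// !mulr_ge0.
  have p2 : 0 <= ((2 * c4 + 1) / eps) ^+ nu by rewrite exprn_ge0// divr_ge0// ltW.
  apply: ler_pM => //; first by rewrite !mulr_ge0.
  by rewrite ler_wpM2r// ler_wpM2l.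
have -> : 2 * ((s ^+ 2) ^+ m * Q1) * d.+2%:R ^+ (n' + m) * (s ^+ nu * Q2 / eps ^+ nu) =
  2 * Q1 * Q2 / eps ^+ nu * (d.+2%:R ^+ (n' + m) * ((s ^+ 2) ^+ m * s ^+ nu)) by ring.
have -> : 2 * Q1 * Q2 * d.+2%:R ^+ m * b ^+ (m * nu) * b ^+ n / eps ^+ nu =
  2 * Q1 * Q2 / eps ^+ nu * (d.+2%:R ^+ m * b ^+ (m * nu) * b ^+ n) by ring.
rewrite ler_wpM2l ?mulr_ge0//.
by apply: le_trans A4; rewrite ler_wpM2l.
Qed.

(** The variables are [k <= n] orthonormal coordinates and the [m * nu] coefficients a_jl.
    [M * del <= eps] keeps the values separated after projection, the condition on [L * del] makes
    [h] at most 1 at the projected points. *)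
Lemma local_count (V : normedModType RR) d m nu (f : V -> 'rV[RR]_m) (x0 : V)
    (rho L M : RR) : parallelogram_law V -> in_Pmd d f -> (0 < m)%N -> (nu <= m)%N ->
  0 < rho -> 0 <= L -> 0 <= M ->
  (forall y h, `|y - x0| < 6 * rho -> `|'d f y h| <= M * `|h|) ->
  (forall y z h, `|y - x0| < 6 * rho -> `|z - x0| < 6 * rho ->
      `|'d f y h - 'd f z h| <= L * `|y - z| * `|h|) ->
  exists2 C : RR, 0 <= C & forall n (e : 'I_n -> V) (del eps : RR) (s : 'I_nu -> 'I_m) N (X : 'I_N -> V),
  0 <= del -> del <= rho / 8 -> 0 < eps -> eps <= 1 -> M * del <= eps ->
  L * del * m.+1%:R * (n%:R * m%:R + 1) <= eps ->
  (exists t : 'I_n -> RR, `|x0 - \sum_i t i *: e i| <= del) ->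
  (forall k, exists t : 'I_n -> RR, `|X k - \sum_i t i *: e i| <= del) ->
  (forall k, `|X k - x0| <= rho / 4) ->
  (forall k, exists A : 'I_m -> 'I_nu -> RR, (forall j l, `|A j l| <= 1) /\
     forall h j, 'd f (X k) h ord0 j = \sum_l A j l * 'd f (X k) h ord0 (s l)) ->
  (forall k l, k != l -> exists j, 4 * eps <= `|f (X k) ord0 j - f (X l) ord0 j|) ->
  N%:R <= C * (2 ^+ (3 * m) * (2 * d).+4%:R) ^+ n / eps ^+ nu.
Proof.
move=> PL [[df _] _ _ fpoly] m0 num rho0 L0 M0 HM HL.
(* 2d + 2 is the degree of [h], [8 * m%:R] is [tau] times the bound [4 * rho] on the variables, and
   3 > sqrt 6 comes from the bound 6 on [h]. *)
exists (count_const (2 * d).+2 m nu rho M (8 * m%:R) 3).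
  by apply: count_const_ge0 => //; rewrite mulr_ge0.
move=> n e del eps s N X del0 delr e0 e1 Mdel Ldel [te0 hte0] hX Xx0 XA Xsep.
have [k [b [kn bnorm be]]] := orthonormal_span PL e.
pose xt (t : 'I_k -> RR) : V := \sum_i t i *: b i.
have to_b (x : V) : (exists t : 'I_n -> RR, `|x - \sum_i t i *: e i| <= del) ->
    exists t : 'I_k -> RR, `|x - xt t| <= del.
  move=> [t ht]; have [T HT] := choice be.
  exists (fun j => \sum_i t i * T i j); rewrite /xt.
  under eq_bigr do rewrite scaler_suml.
  rewrite exchange_big /=; move: ht; congr (`|_ - _| <= _).
  apply: eq_bigr => i _; rewrite HT scaler_sumr; apply: eq_bigr => j _.
  by rewrite scalerA.
have [t0 ht0] := to_b _ (ex_intro _ te0 hte0).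
have [tk htk] := choice (fun q => to_b _ (hX q)).
have [A HA] := choice XA.
have bli : lin_indep b.
  move=> t tb i; have := bnorm t; rewrite tb normr0 expr0n /= => E.
  apply/eqP; rewrite -sqrf_eq0; apply/eqP/le_anti; rewrite sqr_ge0 andbT.
  apply: (@le_trans _ _ (\sum_i t i ^+ 2)); last by rewrite -E.
  by rewrite (bigD1 i)//= lerDl sumr_ge0// => j _; exact: sqr_ge0.
have b1 i : `|b i| = 1.
  have := bnorm (fun j => (j == i)%:R).
  rewrite (bigD1 i)//= eqxx scale1r big1 => [|j /negPf ->]; last by rewrite scale0r.
  rewrite addr0 (bigD1 i)//= eqxx big1 => [|j /negPf ->]; last by rewrite expr0n.
  rewrite addr0 expr1n => /eqP; rewrite sqrf_eq1 => /orP[/eqP//|/eqP E].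
  by have := normr_ge0 (b i); rewrite E lerNr oppr0 ler10.
pose io (i : 'I_k) : 'I_(k + m * nu) := lshift (m * nu) i.
pose ia (j : 'I_m) (l : 'I_nu) : 'I_(k + m * nu) := rshift k (mxvec_index j l).
pose pt (z : 'rV[RR]_(k + m * nu)) : V := xt (fun i => z ord0 (io i)).
have [p0 hp0] := choice (fun j => ex2_ex (pexp_of_poly io (fpoly k b bli j))).
have pdeg0 j : (pdeg (p0 j) <= d)%N by case: (hp0 j).
have pE j z : pev (p0 j) z = f (pt z) ord0 j by case: (hp0 j).
have ptD z i (t : RR) : pt (z + t *: delta_mx ord0 (io i)) = pt z + t *: b i.
  rewrite /pt /xt (bigD1 i)//= [in RHS](bigD1 i)//= !mxE !eqxx mulr1 scalerDl.
  rewrite -!addrA; congr (_ + _); rewrite addrC; congr (_ + _).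
  apply: eq_bigr => j /negPf ji; rewrite !mxE eqxx /=.
  by rewrite /io (inj_eq (@lshift_inj _ _)) ji mulr0 addr0.
have pdE i j z : pev (pd (io i) (p0 j)) z = 'd f (pt z) (b i) ord0 j.
  apply: pd_unique => ee ee0; have [dl dl0 Hd] := diff_direction (b i) (df (pt z)) ee0.
  exists dl => // t td; rewrite !pE ptD; apply: le_trans (Hd t td).
  by apply: le_trans (coord_le_norm _ j); rewrite !mxE.
have pd0 q j z : pev (pd (rshift k q) (p0 j)) z = 0.
  apply: pd_unique => ee ee0; exists 1 => // t _; rewrite !pE mulr0 subr0.
  rewrite [X in f X](_ : _ = pt z) ?subrr ?normr0 ?mulr_ge0// ?(ltW ee0)//.
  rewrite /pt /xt; apply: eq_bigr => i _; rewrite !mxE eqxx /=.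
  by rewrite /io eq_lrshift mulr0 addr0.
(* Rescales the coefficients, which are bounded by 1, to variables of size at most rho / (2m): all
   [m * nu] of them contribute at most rho^2 / 4 to the squared distance from [c0]. *)
pose tau : RR := 2 * m%:R / rho.
have mR : 0 < m%:R :> RR by rewrite ltr0n.
have tau0 : 0 < tau by rewrite !mulr_gt0// invr_gt0.
pose gx (i : 'I_k) (j : 'I_m) : pexp RR (k + m * nu) :=
  PAdd (pd (io i) (p0 j)) (PMul (PC (- tau))
    (psumI (fun l => PMul (PX (ia j l)) (pd (io i) (p0 (s l)))))).
have gxE i j z : pev (gx i j) z = 'd f (pt z) (b i) ord0 j -
    \sum_l (tau * z ord0 (ia j l)) * 'd f (pt z) (b i) ord0 (s l).
  rewrite /= pdE pev_psumI mulNr mulr_sumr; congr (_ - _); apply: eq_bigr => l _ /=.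
  by rewrite pdE mulrA.
pose h : pexp RR (k + m * nu) := PMul (PC (eps ^+ 2)^-1)
  (psumI (fun i : 'I_k => psumI (fun j : 'I_m => psq (gx i j)))).
have hE z : pev h z = (eps ^+ 2)^-1 * \sum_i \sum_j pev (gx i j) z ^+ 2.
  by rewrite /= pev_psumI; congr (_ * _); apply: eq_bigr => i _; rewrite pev_psumI.
have e20 : 0 < eps ^+ 2 by rewrite exprn_gt0.
have h_ge0 z : 0 <= pev h z.
  rewrite hE mulr_ge0 ?invr_ge0 ?(ltW e20)// sumr_ge0// => i _.
  by rewrite sumr_ge0// => j _; exact: sqr_ge0.
have hdeg : (pdeg h <= (2 * d).+2)%N.
  rewrite /= add0n; apply: pdeg_psumI => i; apply: pdeg_psumI => j /=.
  have : (pdeg (gx i j) <= d.+1)%N.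
    rewrite /= geq_max (leq_trans (pdeg_pd _ _)) ?(leq_trans (pdeg0 j))//= add0n.
    apply: pdeg_psumI => l /=; rewrite add1n ltnS.
    exact: leq_trans (pdeg_pd _ _) (pdeg0 _).
  by rewrite /=; clear; lia.
pose c0 : 'rV[RR]_(k + m * nu) := row_mx (\row_i t0 i) 0.
pose zz q : 'rV[RR]_(k + m * nu) :=
  row_mx (\row_i tk q i) (mxvec (\matrix_(j, l) (A q j l / tau))).
have ptzz q : pt (zz q) = xt (tk q).
  by rewrite /pt /xt; apply: eq_bigr => i _; rewrite row_mxEl mxE.
have zzia q j l : tau * zz q ord0 (ia j l) = A q j l.
  by rewrite row_mxEr mxvecE mxE mulrC divfK// gt_eqF.
have xtB t t' : `|xt t - xt t'| ^+ 2 = \sum_i (t i - t' i) ^+ 2.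
  rewrite -bnorm /xt -sumrB; congr (`|_| ^+ 2); apply: eq_bigr => i _.
  by rewrite scalerBl.
have Xxt q : `|xt (tk q) - X q| <= del by rewrite distrC.
have xtx0 q : `|xt (tk q) - x0| <= rho / 2.
  rewrite -(subrK (X q) (xt (tk q))) -addrA (le_trans (ler_normD _ _))//.
  by have := Xxt q; have := Xx0 q; clear -delr rho0; lra.
have zzc q : \sum_i (zz q ord0 i - c0 ord0 i) ^+ 2 <= rho ^+ 2.
  rewrite big_split_ord /=.
  have S1 : \sum_(i < k) (zz q ord0 (lshift (m * nu) i) - c0 ord0 (lshift (m * nu) i)) ^+ 2 <=
      rho ^+ 2 / 2.
    rewrite (eq_bigr (fun i => (tk q i - t0 i) ^+ 2)); last first.
      by move=> i _; rewrite !row_mxEl !mxE.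
    rewrite -xtB; have : `|xt (tk q) - xt t0| <= 5 / 8 * rho.
      rewrite -(subrK x0 (xt (tk q))) -addrA (le_trans (ler_normD _ _))//.
      by have := xtx0 q; clear -delr rho0 ht0; lra.
    move=> h1; have : `|xt (tk q) - xt t0| ^+ 2 <= (5 / 8 * rho) ^+ 2.
      by apply: lerXn2r h1; rewrite nnegrE// mulr_ge0// ltW.
    by have := sqr_ge0 rho; rewrite exprMn; clear; lra.
  have S2 : \sum_(i < m * nu) (zz q ord0 (rshift k i) - c0 ord0 (rshift k i)) ^+ 2 <=
      (m * nu)%:R * (tau^-1 ^+ 2).
    rewrite mulr_natl -[X in _ *+ X]card_ord -sumr_const; apply: ler_sum => i _.
    rewrite !row_mxEr mxE subr0; case/mxvec_indexP: i => j l; rewrite mxvecE mxE.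
    rewrite -[leLHS]real_normK ?num_real//; apply: lerXn2r; rewrite ?nnegrE ?invr_ge0 ?(ltW tau0)//.
    rewrite normrM [X in _ * X]gtr0_norm ?invr_gt0// ler_piMl ?invr_ge0 ?(ltW tau0)//.
    by case: (HA q).
  have S3 : (m * nu)%:R * (tau^-1 ^+ 2) <= rho ^+ 2 / 4.
    apply: (@le_trans _ _ ((m * m)%:R * (tau^-1 ^+ 2))).
      by rewrite ler_wpM2r ?exprn_ge0 ?invr_ge0 ?(ltW tau0)// ler_nat leq_mul2l num orbT.
    rewrite natrM /tau le_eqVlt; apply/orP; left; apply/eqP; field.
    by rewrite !gt_eqF.
  by have := sqr_ge0 rho; clear -S1 S2 S3; lra.
have ball6 q : `|X q - x0| < 6 * rho by have := Xx0 q; clear -rho0; lra.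
have ball6' q : `|xt (tk q) - x0| < 6 * rho by have := xtx0 q; clear -rho0; lra.
(* At [X q] the relation between the derivatives is exact; projecting moves the point by at most
   [del] and changes each of the nu + 1 derivatives involved by at most [L * del]. *)
have gdat q i j : `|pev (gx i j) (zz q)| <= m.+1%:R * (L * del).
  rewrite gxE ptzz; under eq_bigr do rewrite zzia.
  have [A1 A2] := HA q.
  have dd j' : `|'d f (xt (tk q)) (b i) ord0 j' - 'd f (X q) (b i) ord0 j'| <= L * del.
    have := HL _ _ (b i) (ball6' q) (ball6 q); rewrite b1 mulr1 => H.
    have := coord_le_norm ('d f (xt (tk q)) (b i) - 'd f (X q) (b i)) j'; rewrite !mxE => /le_trans; apply.
    by apply: le_trans H _; rewrite ler_wpM2l.
  have -> : 'd f (xt (tk q)) (b i) ord0 j - \sum_l A q j l * 'd f (xt (tk q)) (b i) ord0 (s l) =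
    ('d f (xt (tk q)) (b i) ord0 j - 'd f (X q) (b i) ord0 j) -
    \sum_l A q j l * ('d f (xt (tk q)) (b i) ord0 (s l) - 'd f (X q) (b i) ord0 (s l)).
    have -> : \sum_l A q j l * ('d f (xt (tk q)) (b i) ord0 (s l) - 'd f (X q) (b i) ord0 (s l)) =
      \sum_l A q j l * 'd f (xt (tk q)) (b i) ord0 (s l) - 'd f (X q) (b i) ord0 j.
      by rewrite A2 -sumrB; apply: eq_bigr => l _; rewrite mulrBr.
    ring.
  rewrite (le_trans (ler_normB _ _))// -natr1 mulrDl addrC mul1r lerD//.
  rewrite (le_trans (ler_norm_sum _ _ _))//.
  apply: (@le_trans _ _ (\sum_(l < nu) L * del)).
    apply: ler_sum => l _; rewrite normrM -[leRHS]mul1r ler_pM//.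
  by rewrite sumr_const card_ord -[leLHS]mulr_natl ler_wpM2r ?mulr_ge0// ler_nat.
have zzh q : pev h (zz q) <= 1.
  rewrite hE mulrC ler_pdivrMr// mul1r.
  set G := m.+1%:R * (L * del) in gdat.
  have G0 : 0 <= G by rewrite !mulr_ge0.
  apply: (@le_trans _ _ (\sum_(i < k) \sum_(j < m) G ^+ 2)).
    apply: ler_sum => i _; apply: ler_sum => j _; rewrite -[leLHS]real_normK ?num_real//.
    by apply: lerXn2r; rewrite ?nnegrE.
  rewrite !sumr_const !card_ord -mulrnA -[leLHS]mulr_natl natrM.
  have Ge : G * (n%:R * m%:R + 1) <= eps.
    by apply: le_trans Ldel; rewrite /G le_eqVlt; apply/orP; left; apply/eqP; ring.
  have Ge2 : (G * (n%:R * m%:R + 1)) ^+ 2 <= eps ^+ 2.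
    by apply: lerXn2r Ge; rewrite nnegrE ?(ltW e0)// mulr_ge0// addr_ge0// mulr_ge0.
  apply: le_trans Ge2; rewrite [leRHS]exprMn [leLHS]mulrC ler_wpM2l ?exprn_ge0//.
  have kn' : m%:R * k%:R <= n%:R * m%:R :> RR by rewrite mulrC ler_wpM2r// ler_nat.
  have nm0 : 0 <= n%:R * m%:R :> RR by rewrite mulr_ge0.
  apply: le_trans kn' _; move: (n%:R * m%:R) nm0 => u u0; clear -u0.
  by rewrite sqrrD expr1n mulr1; have := sqr_ge0 u; lra.
have sep q l : q != l -> exists j, 2 * eps <= `|pev (p0 j) (zz q) - pev (p0 j) (zz l)|.
  move=> /Xsep[j hj]; exists j; rewrite !pE !ptzz.
  have close q' : `|f (xt (tk q')) ord0 j - f (X q') ord0 j| <= eps.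
    have := coord_le_norm (f (xt (tk q')) - f (X q')) j; rewrite !mxE => /le_trans; apply.
    apply: le_trans Mdel; apply: (@le_trans _ _ (M * `|xt (tk q') - X q'|)).
      apply: mean_value_le => // t /andP[t_0 t_1] hh; apply: HM.
      rewrite addrAC (le_lt_trans (ler_normD _ _))//.
      have : `|t *: (xt (tk q') - X q')| <= del.
        by rewrite normrZ ger0_norm// -[leRHS]mul1r ler_pM.
      by have := Xx0 q'; clear -rho0 delr; lra.
    by rewrite ler_wpM2l.
  have h1 := close q; have h2 := close l.
  have : `|f (X q) ord0 j - f (X l) ord0 j| <=
     `|f (xt (tk q)) ord0 j - f (xt (tk l)) ord0 j| + eps + eps.
    have -> : f (X q) ord0 j - f (X l) ord0 j = (f (xt (tk q)) ord0 j - f (xt (tk l)) ord0 j)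
      - (f (xt (tk q)) ord0 j - f (X q) ord0 j) + (f (xt (tk l)) ord0 j - f (X l) ord0 j) by ring.
    by rewrite (le_trans (ler_normD _ _))// lerD// (le_trans (ler_normB _ _))// lerD.
  by move: hj; clear; lra.
have near (z : 'rV[RR]_(k + m * nu)) : \sum_i (z ord0 i - c0 ord0 i) ^+ 2 <= 12 * rho ^+ 2 -> pev h z <= 6 ->
     exists (s : 'I_nu -> 'I_m) (A : 'I_m -> 'I_nu -> RR),
     [/\ forall j l, `|A j l| <= 8 * m%:R, forall i j, `|pev (pd i (p0 j)) z| <= M &
      forall i j, `|pev (pd i (p0 j)) z - \sum_l A j l * pev (pd i (p0 (s l))) z|
        <= 3 * eps].
  move=> zc zh; exists s, (fun j l => tau * z ord0 (ia j l)).
  have sqle (x c : RR) : 0 <= c -> x ^+ 2 <= c ^+ 2 -> `|x| <= c.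
    by move=> c_ge0 H; rewrite -(@ler_pXn2r _ 2) ?nnegrE// real_normK// num_real.
  have r4 : 0 <= 4 * rho by rewrite mulr_ge0// ltW.
  have r16 : 12 * rho ^+ 2 <= (4 * rho) ^+ 2.
    by rewrite exprMn; have := sqr_ge0 rho; clear; lra.
  have ptz : `|pt z - x0| < 6 * rho.
    rewrite -(subrK (xt t0) (pt z)) -addrA (le_lt_trans (ler_normD _ _))//.
    have : `|pt z - xt t0| <= 4 * rho.
      apply: le_trans (real_ler_norm (num_real _)) _; apply: sqle => //.
      apply: le_trans r16; apply: le_trans zc; rewrite /pt xtB big_split_ord /=.
      rewrite (eq_bigr (fun i => (z ord0 (lshift (m * nu) i) - c0 ord0 (lshift (m * nu) i)) ^+ 2)).
        by rewrite lerDl sumr_ge0// => i _; exact: sqr_ge0.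
      by move=> i _; rewrite row_mxEl mxE.
    by move: ht0; rewrite distrC; clear -delr rho0; lra.
  split=> [j l|i j|i j].
  - rewrite normrM gtr0_norm//.
    have : `|z ord0 (ia j l)| <= 4 * rho.
      apply: sqle => //; apply: le_trans r16; apply: le_trans zc.
      rewrite (bigD1 (ia j l))//= row_mxEr mxE subr0 lerDl sumr_ge0// => i _.
      exact: sqr_ge0.
    move/(ler_wpM2l (ltW tau0))/le_trans; apply.
    rewrite /tau le_eqVlt; apply/orP; left; apply/eqP; field.
    by rewrite gt_eqF.
  - rewrite -(splitK i); case: (fintype.split i) => q /=; last by rewrite pd0 normr0.
    rewrite pdE; apply: le_trans (coord_le_norm _ j) _.
    by have := HM _ (b q) ptz; rewrite b1 mulr1.
  - rewrite -(splitK i); case: (fintype.split i) => q /=; last first.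
      rewrite pd0 big1 => [|l _]; last by rewrite pd0 mulr0.
      by rewrite subr0 normr0 mulr_ge0// ltW.
    have := gxE q j z; rewrite -pdE => E.
    rewrite (eq_bigr (fun l => tau * z ord0 (ia j l) * 'd f (pt z) (b q) ord0 (s l))) -?E; last first.
      by move=> l _; rewrite pdE.
    apply: sqle; first by rewrite mulr_ge0// ltW.
    have : \sum_i \sum_j pev (gx i j) z ^+ 2 <= 6 * eps ^+ 2.
      by move: zh; rewrite hE mulrC ler_pdivrMr.
    rewrite (bigD1 q)//= (bigD1 j)//=; set u := pev (gx q j) z ^+ 2.
    set s1 := \sum_(i0 | _) _; set s2 := \sum_(i0 | _) _.
    have s10 : 0 <= s1 by apply: sumr_ge0 => ? _; exact: sqr_ge0.
    have s20 : 0 <= s2 by apply: sumr_ge0 => ? _; apply: sumr_ge0 => ? _; exact: sqr_ge0.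
    by rewrite [(3 * eps) ^+ 2]exprMn; move: e20; clear -s10 s20; lra.
have pdeg1 j : (pdeg (p0 j) <= (2 * d).+2)%N.
  by apply: leq_trans (pdeg0 j) _; clear; lia.
have a0 : 0 <= 8 * m%:R :> RR by rewrite mulr_ge0.
have c10 : 0 <= 3 :> RR by [].
have := almost_critical_count m0 e0 e1 rho0 a0 M0 c10 pdeg1 hdeg h_ge0 near zzc zzh sep.
move/(count_bound_crude (n := n)); apply => //.
  by rewrite leq_add2r.
Qed.

(** * Covers of the critical values *)

(** Pigeonhole over the pairs of a ball of a finite subcover and a choice of rows, with
    [local_count] for each pair. Sums over the subcover take the place of maxima, which also serves
    when it is empty. *)
Lemma separated_count (V : normedModType RR) d m nu (f : V -> 'rV[RR]_m) (K : set V) :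
  parallelogram_law V -> in_Pmd d f -> (0 < m)%N -> (nu <= m)%N -> compact K ->
  exists C c d0 : RR, [/\ 0 <= C, 1 <= c, 0 < d0 & 
  forall n (e : 'I_n -> V) (del eps : RR) N (y : 'I_N -> 'rV[RR]_m),
  0 <= del -> del <= d0 -> 0 < eps -> eps <= 1 -> c * del * n.+1%:R <= eps ->
  (forall u, K u -> exists t : 'I_n -> RR, `|u - \sum_i t i *: e i| <= del) ->
  (forall k, (f @` (Crit_nu f nu `&` K)) (y k)) ->
  (forall k l, k != l -> exists j, 4 * eps <= `|y k ord0 j - y l ord0 j|) ->
  N%:R <= C * (2 ^+ (3 * m) * (2 * d).+4%:R) ^+ n / eps ^+ nu].
Proof.
move=> PL fP m0 num cK; have [fC1 _ fLip _] := fP.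
pose good x (q : RR * RR * RR * RR) :=
  let: (rho, L, M, C) := q in
  [/\ 0 < rho, 0 <= L, 0 <= M, 0 <= C &
   forall n (e : 'I_n -> V) (del eps : RR) (s : 'I_nu -> 'I_m) N (X : 'I_N -> V),
  0 <= del -> del <= rho / 8 -> 0 < eps -> eps <= 1 -> M * del <= eps ->
  L * del * m.+1%:R * (n%:R * m%:R + 1) <= eps ->
  (exists t : 'I_n -> RR, `|x - \sum_i t i *: e i| <= del) ->
  (forall k, exists t : 'I_n -> RR, `|X k - \sum_i t i *: e i| <= del) ->
  (forall k, `|X k - x| <= rho / 4) ->
  (forall k, exists A : 'I_m -> 'I_nu -> RR, (forall j l, `|A j l| <= 1) /\
     forall h j, 'd f (X k) h ord0 j = \sum_l A j l * 'd f (X k) h ord0 (s l)) ->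
  (forall k l, k != l -> exists j, 4 * eps <= `|f (X k) ord0 j - f (X l) ord0 j|) ->
  N%:R <= C * (2 ^+ (3 * m) * (2 * d).+4%:R) ^+ n / eps ^+ nu].
have goodP x : exists q, good x q.
  have [r [L [M [r0 L0 M0 HM HL]]]] := local_constants x fC1 fLip.
  have rho0 : 0 < r / 6 by rewrite divr_gt0.
  have r6 : 6 * (r / 6) = r by field.
  rewrite -r6 in HM HL.
  have [C C0 HC] := local_count PL fP m0 num rho0 L0 M0 HM HL.
  by exists (r / 6, L, M, C).
have [q qP] := choice goodP.
pose rho x := (q x).1.1.1; pose L x := (q x).1.1.2; pose M x := (q x).1.2; pose C x := (q x).2.
have HP x : good x (rho x, L x, M x, C x).
  by have := qP x; rewrite /rho /L /M /C; case: (q x) => [[[]]].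
have rho0 x : 0 < rho x by case: (HP x).
have L0 x : 0 <= L x by case: (HP x).
have M0 x : 0 <= M x by case: (HP x).
have C0 x : 0 <= C x by case: (HP x).
have : cover_compact K by rewrite -compact_cover.
case/(_ V K (fun x => ball x (rho x / 4))).
- by move=> x _; apply: ball_open; rewrite divr_gt0.
- by move=> x Kx; exists x => //; apply: ballxx; rewrite divr_gt0.
move=> F FK Fcov.
pose s : seq V := finmap.enum_fset F.
have sK x : x \in s -> K x by move=> xs; apply/set_mem/FK.
have scov x : K x -> exists2 i : 'I_(size s), `|x - nth 0 s i| < rho (nth 0 s i) / 4 & True.
  move=> /Fcov[z /= zF]; rewrite -ball_normE /= distrC => xz.
  have zs : z \in s by [].
  by have/nthP-/(_ 0)[i lti iz] := zs; exists (Ordinal lti) => //=; rewrite iz.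
pose Ci (i : 'I_(size s)) := C (nth 0 s i).
pose Mi (i : 'I_(size s)) := M (nth 0 s i).
pose Li (i : 'I_(size s)) := L (nth 0 s i).
pose ri (i : 'I_(size s)) := rho (nth 0 s i).
pose U := ('I_(size s) * {ffun 'I_nu -> 'I_m})%type.
have sum_ge (g : 'I_(size s) -> RR) i : (forall i, 0 <= g i) -> g i <= \sum_j g j.
  by move=> g0; rewrite (bigD1 i)//= lerDl sumr_ge0.
have m1 : 1 <= m.+1%:R :> RR by rewrite ler1n.
have m10 : 0 <= m.+1%:R :> RR by [].
exists (#|{: U}|%:R * \sum_i Ci i), (1 + \sum_i Mi i + (\sum_i Li i) * m.+1%:R ^+ 2),
  (\sum_i 8 / ri i + 1)^-1.
have SM0 : 0 <= \sum_i Mi i by apply: sumr_ge0 => i _; exact: M0.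
have SL0 : 0 <= \sum_i Li i by apply: sumr_ge0 => i _; exact: L0.
have Sr0 : 0 <= \sum_i 8 / ri i.
  by apply: sumr_ge0 => i _; rewrite divr_ge0// ltW// /ri.
have SLm0 : 0 <= (\sum_i Li i) * m.+1%:R ^+ 2 by rewrite mulr_ge0// exprn_ge0.
split.
- by rewrite mulr_ge0// sumr_ge0// => i _; exact: C0.
- by rewrite -addrA lerDl addr_ge0.
- by rewrite invr_gt0 ltr_wpDl.
move=> n e del eps N y del0 deld e0 e1 cdel He Hy Hsep.
have del_r i : del <= ri i / 8.
  apply: le_trans deld _.
  have ri0 : 0 < ri i by exact: rho0.
  rewrite -[leRHS]invrK lef_pV2 ?posrE ?invr_gt0 ?divr_gt0// ?ltr_wpDl// invf_div.
  apply: le_trans (sum_ge (fun i => 8 / ri i) i _) _; last by rewrite lerDl.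
  by move=> j; rewrite divr_ge0// ltW// /ri.
set c := 1 + _ + _ in cdel.
have n1 : 1 <= n.+1%:R :> RR by rewrite ler1n.
have cM i : Mi i * del <= eps.
  apply: le_trans cdel; apply: (@le_trans _ _ (c * del)).
    apply: ler_wpM2r => //; apply: le_trans (sum_ge Mi i (fun=> M0 _)) _.
    by rewrite /c [1 + _]addrC -addrA lerDl addr_ge0.
  by rewrite ler_peMr// mulr_ge0// /c !addr_ge0.
have cL i : Li i * del * m.+1%:R * (n%:R * m%:R + 1) <= eps.
  apply: le_trans cdel.
  have nm : n%:R * m%:R + 1 <= m.+1%:R * n.+1%:R :> RR.
    by rewrite -!natrM natr1 ler_nat; clear; nia.
  apply: (@le_trans _ _ (Li i * m.+1%:R ^+ 2 * del * n.+1%:R)).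
    have -> : Li i * m.+1%:R ^+ 2 * del * n.+1%:R = Li i * del * m.+1%:R * (m.+1%:R * n.+1%:R) by ring.
    by apply: ler_wpM2l nm; rewrite !mulr_ge0// /Li.
  apply: ler_wpM2r => //; apply: ler_wpM2r => //.
  apply: (@le_trans _ _ ((\sum_i Li i) * m.+1%:R ^+ 2)).
    by rewrite ler_wpM2r ?exprn_ge0// sum_ge// => j; exact: L0.
  by rewrite /c lerDr addr_ge0.
have pick k : exists a : V * U, [/\ K a.1, y k = f a.1,
    `|a.1 - nth 0 s a.2.1| < rho (nth 0 s a.2.1) / 4 &
    exists A : 'I_m -> 'I_nu -> RR, (forall j l, `|A j l| <= 1) /\
     forall h j, 'd f (a.1) h ord0 j = \sum_l A j l * 'd f (a.1) h ord0 (a.2.2 l)].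
  have [x [xC xK] xy] := Hy k; have [i xi _] := scov x xK.
  have [sg [A [A1 A2]]] := crit_coords m0 xC.
  exists (x, (i, [ffun l => sg l])); split=> //=; exists A; split=> // h j.
  by rewrite A2; apply: eq_bigr => l _; rewrite ffunE.
have [a aP] := choice pick.
pose R0 : RR := (\sum_i Ci i) * (2 ^+ (3 * m) * (2 * d).+4%:R) ^+ n / eps ^+ nu.
have R00 : 0 <= R0.
  have SC : 0 <= \sum_i Ci i by apply: sumr_ge0 => i _; exact: C0.
  by rewrite /R0 divr_ge0 ?exprn_ge0 ?(ltW e0)// mulr_ge0// exprn_ge0// mulr_ge0// exprn_ge0.
have fib u : (#|[set k in [set: 'I_N] | (a k).2 == u]%SET| <= Num.truncn R0)%N.
  set S := [set k in _ | _]%SET; rewrite truncn_ge_nat//.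
  pose X (k : 'I_#|S|) := (a (enum_val k)).1.
  have uE (k : 'I_#|S|) : (a (enum_val k)).2 = u.
    by have := enum_valP k; rewrite inE => /andP[_ /eqP].
  have [_ _ _ _ H] := HP (nth 0 s u.1).
  have : #|S|%:R <= C (nth 0 s u.1) * (2 ^+ (3 * m) * (2 * d).+4%:R) ^+ n / eps ^+ nu.
    apply: (H n e del eps u.2 #|S| X) => //.
    + exact: del_r.
    + exact: cM.
    + exact: cL.
    + by apply/He/sK/mem_nth.
    + by move=> k; apply: He; have [] := aP (enum_val k).
    + by move=> k; rewrite -(uE k) ltW//; have [] := aP (enum_val k).
    + by move=> k; rewrite -(uE k); have [] := aP (enum_val k).
    + move=> k l kl; have [|j hj] := Hsep (enum_val k) (enum_val l).
        by apply: contra_neq kl => /enum_val_inj.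
      exists j; have [_ E1 _ _] := aP (enum_val k); have [_ E2 _ _] := aP (enum_val l).
      by rewrite E1 E2 in hj.
  move/le_trans; apply; rewrite /R0 -!mulrA; apply: ler_wpM2r.
    by rewrite divr_ge0 ?exprn_ge0 ?(ltW e0)// exprn_ge0// mulr_ge0// exprn_ge0.
  exact: (sum_ge Ci u.1 (fun=> C0 _)).
have := card_le_fibers_fin fib; rewrite cardsT card_ord => tot.
have : N%:R <= #|{: U}|%:R * R0.
  apply: (@le_trans _ _ (#|{: U}| * Num.truncn R0)%:R); first by rewrite ler_nat.
  by rewrite natrM ler_wpM2l// truncn_le.
by rewrite /R0 !mulrA.
Qed.

(** A separated family of maximal cardinality is a net: a point far from all its members could be
    added to it. *)
Lemma separated_cover (R : realType) m (S : set 'rV[R]_m) (r : R) X : 0 < r ->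
  (forall N (y : 'I_N -> 'rV[R]_m), (forall k, S (y k)) ->
     (forall k l, k != l -> exists j, r <= `|y k ord0 j - y l ord0 j|) -> (N <= X)%N) ->
  exists k, (k <= X)%N /\ exists c : 'I_k -> 'rV[R]_m,
    forall z, S z -> exists i, forall j, `|c i ord0 j - z ord0 j| < r.
Proof.
move=> r0 H.
pose P N := `[< exists y : 'I_N -> 'rV[R]_m, (forall k, S (y k)) /\
     (forall k l, k != l -> exists j, r <= `|y k ord0 j - y l ord0 j|) >].
have P0 : exists N, P N.
  by exists 0%N; apply/asboolP; exists (fun=> 0); split=> -[].
have PX N : P N -> (N <= X)%N by move=> /asboolP[y [y1 y2]]; exact: H y1 y2.
case: (ex_maxnP P0 PX) => N PN Nmax.
exists N; split; first exact: PX.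
move/asboolP: PN => [y [y1 y2]]; exists y => z Sz.
apply: contrapT => /forallNP nz.
have zfar i : exists j, r <= `|y i ord0 j - z ord0 j|.
  by have /existsNP[j /negP] := nz i; rewrite -leNgt => ?; exists j.
have /Nmax : P N.+1; last by rewrite ltnn.
apply/asboolP; exists (fun i => oapp y z (unlift ord0 i)); split=> [i|i j].
  by case: (unliftP ord0 i) => [j|] _ /=; [exact: y1|].
case: (unliftP ord0 i) => [i'|] ->; case: (unliftP ord0 j) => [j'|] ->;
  rewrite ?liftK ?unlift_none /=.
- by rewrite (inj_eq lift_inj); exact: y2.
- by move=> _; have [l hl] := zfar i'; exists l.
- by move=> _; have [l hl] := zfar j'; exists l; rewrite distrC.
- by [].
Qed.

Lemma eucl_dist_le m (x y : 'rV[RR]_m) (r : RR) : 0 <= r ->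
  (forall j, `|x ord0 j - y ord0 j| <= r) -> eucl_dist x y <= m%:R * r.
Proof.
move=> r0 H; have mr : 0 <= m%:R * r by rewrite mulr_ge0.
rewrite /eucl_dist -[leRHS]ger0_norm// -sqrtr_sqr ler_sqrt ?sqr_ge0//.
apply: (@le_trans _ _ (m%:R * r ^+ 2)).
  rewrite mulr_natl -[X in _ *+ X]card_ord -sumr_const; apply: ler_sum => i _.
  by rewrite -[leLHS]real_normK ?num_real//; apply: lerXn2r (H i); rewrite nnegrE.
rewrite exprMn ler_wpM2r ?exprn_ge0// -natrX ler_nat.
by case: (m) => // k; rewrite expnS leq_pmulr.
Qed.

(** * Kolmogorov widths and the choice of the dimension *)

Lemma width_approx (V : normedModType RR) (K : set V) (q q' : RR) : compact K ->
  0 < q' -> q' < q ->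
  (limn_esup (fun n : nat => (powR (kolmogorov_width K n) (n%:R^-1))%:E) <= (q^-1)%:E)%E ->
  exists n0 : nat, forall n, (n0 <= n)%N -> exists e : 'I_n -> V,
    forall u, K u -> exists t : 'I_n -> RR, `|u - \sum_i t i *: e i| <= q'^-1 ^+ n.
Proof.
move=> cK q'0 q'q H.
(* The gap between [q'] and [q] makes the inequalities for the limsup, and then for the infima over
   [e] and [t], strict, so that actual vectors and coefficients can be chosen. *)
have lt : (limn_esup (fun n : nat => (powR (kolmogorov_width K n) (n%:R^-1))%:E) < (q'^-1)%:E)%E.
  by apply: le_lt_trans H _; rewrite lte_fin ltf_pV2// posrE// (lt_trans q'0).
have [_ [A [N _ NA] <-] supA] := ereal_inf_lt lt.
(* [n] is kept positive because the n-th root of the width has to be undone. *)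
exists (maxn N 1) => n; rewrite geq_max => /andP[Nn n0].
(* A real [sup] is an upper bound only for a bounded set; boundedness of [K] provides this. *)
have Kb : exists b : RR, forall u, K u -> `|u| <= b.
  have [M [_ HM]] := compact_bounded cK.
  by exists (M + 1) => u Ku; apply: (HM (M + 1)) => //; rewrite ltrDl.
have [b Kb'] := Kb.
have ds_ge0 (e : 'I_n -> V) u : 0 <= dist_span e u.
  by apply: lb_le_inf; [exists `|u - \sum_(i < n) 0 *: e i|; exists (fun=> 0)|move=> _ [t _ <-]].
have ds_le (e : 'I_n -> V) u : dist_span e u <= `|u|.
  apply: ge_inf; first by exists 0 => _ [t _ <-].
  by exists (fun=> 0) => //; rewrite big1 ?subr0// => i _; rewrite scale0r.
set w := kolmogorov_width K n.
have w_ge0 : 0 <= w.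
  apply: lb_le_inf; first by exists (sup [set dist_span ((fun=> 0) : 'I_n -> V) u | u in K]); exists (fun=> 0).
  move=> _ [e _ <-].
  have [->|/set0P[u Ku]] := eqVneq K set0; first by rewrite image_set0 sup0.
  apply: (le_trans (ds_ge0 e u)); apply: sup_upper_bound; last by exists u.
  split; first by exists (dist_span e u); exists u.
  by exists b => _ [v Kv <-]; exact: le_trans (ds_le e v) (Kb' v Kv).
have wq : w < q'^-1 ^+ n.
  have : ((powR w (n%:R^-1))%:E < (q'^-1)%:E)%E.
    by apply: le_lt_trans supA; apply: ereal_sup_ubound; exists n => //; exact: NA.
  rewrite lte_fin => h.
  have -> : w = (powR w (n%:R^-1)) ^+ n.
    by rewrite -powR_mulrn ?powR_ge0// -powRrM mulVf ?powRr1// pnatr_eq0 -lt0n.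
  by rewrite ltrXn2r ?powR_ge0// -?lt0n// ?nnegrE ?invr_ge0 ?(ltW q'0).
have [|_ [e _ <-] he] := inf_lt _ wq.
  by exists (sup [set dist_span ((fun=> 0) : 'I_n -> V) u | u in K]); exists (fun=> 0).
exists e => u Ku.
have lt2 : dist_span e u < q'^-1 ^+ n.
  apply: le_lt_trans he; apply: sup_upper_bound; last by exists u.
  split; first by exists (dist_span e u); exists u.
  by exists b => _ [v Kv <-]; exact: le_trans (ds_le e v) (Kb' v Kv).
have [|_ [t _ <-] ht] := inf_lt _ lt2.
  by exists `|u - \sum_(i < n) 0 *: e i|; exists (fun=> 0).
by exists t; exact: ltW.
Qed.

(** [n] is about ln (D / r) / a1, so b^n is about (1 / r)^(l / a1); as l / a1 < La / Q, a positive
    power of 1 / r is left to absorb the constants. The gap between [a1] and [a2], the logarithm of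
    [q2], absorbs the factor [n.+1]. *)
Lemma width_asymptotics (R : realType) (b beta q : R) : 1 < b -> b < beta -> 1 < q ->
  exists q2 : R, [/\ 0 < q2, q2 < q &
  forall (C c d0 kap : R) (n0 nu : nat), 0 <= C -> 1 <= c -> 0 < d0 -> 0 < kap ->
  exists r1 : R, [/\ 0 < r1, r1 <= 1, r1 <= kap &
  forall r : R, 0 < r -> r < r1 -> exists n : nat, [/\ (n0 <= n)%N,
    q2^-1 ^+ n <= d0, c * q2^-1 ^+ n * n.+1%:R <= r / kap &
    C * b ^+ n / (r / kap) ^+ nu <= expR ((nu%:R + ln beta / ln q) * ln r^-1)]]].
Proof.
move=> b1 bb q1.
have b0 : 0 < b by exact: lt_trans b1.
have beta0 : 0 < beta by exact: lt_trans bb.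
have q0 : 0 < q by exact: lt_trans q1.
have l0 : 0 < ln b by rewrite ln_gt0.
have lb : ln b < ln beta by rewrite ltr_ln ?posrE.
have Q0 : 0 < ln q by rewrite ln_gt0.
set l := ln b in l0 lb *; set La := ln beta in lb *; set Q := ln q in Q0 *.
have La0 : 0 < La by exact: lt_trans lb.
(* They divide the interval from l Q / La to Q into thirds; it is nondegenerate because
   [b < beta]. *)
pose a1 := (2 * (l * Q / La) + Q) / 3; pose a2 := (l * Q / La + 2 * Q) / 3.
have sQ : l * Q / La < Q by rewrite ltr_pdivrMr// mulrC ltr_pM2l.
have sQ0 : 0 < l * Q / La by rewrite divr_gt0// mulr_gt0.
have a10 : 0 < a1 by rewrite /a1; move: sQ0 Q0; clear; lra.
have a12 : a1 < a2 by rewrite /a1 /a2; move: sQ; clear; lra.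
have a2Q : a2 < Q by rewrite /a2; move: sQ; clear; lra.
have sa1 : l * Q / La < a1 by rewrite /a1; move: sQ; clear; lra.
have th : l / a1 < La / Q.
  rewrite ltr_pdivrMr// mulrAC ltr_pdivlMr//.
  by move: sa1; rewrite ltr_pdivrMr// [La * _]mulrC.
move: (a1) (a2) (a10) (a12) (a2Q) (th) => {sa1 a1 a2 a10 a12 a2Q th}.
move=> a1 a2 a10 a12 a2Q th.
exists (expR a2); split; first exact: expR_gt0.
  by rewrite -[q]lnK ?posrE// ltr_expR.
move=> C c d0 kap n0 nu C0 c1 d00 kap0.
have c0 : 0 < c by exact: lt_le_trans c1.
pose dl := a2 - a1; have dl0 : 0 < dl by rewrite subr_gt0.
(* Bounds (n + 1) exp (- n dl), since exp x >= 1 + x. *)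
pose C2 := 1 + dl^-1.
have C20 : 0 < C2 by rewrite addr_gt0 ?invr_gt0.
pose D := c * C2 * kap.
have D0 : 0 < D by rewrite !mulr_gt0.
pose G := C * kap ^+ nu * expR (l + l / a1 * ln D).
have G0 : 0 <= G by rewrite !mulr_ge0 ?expR_ge0// exprn_ge0// ltW.
have th0 : 0 < La / Q - l / a1 by rewrite subr_gt0.
(* The last three bounds give, in order, the estimate by [d0], [n0 <= n], and the absorption of the
   constant [G]. *)
pose r1 := Num.min 1 (Num.min kap (Num.min (d0 * D)
  (Num.min (D * expR (- (n0%:R * a1))) (expR (- (G / (La / Q - l / a1))))))).
exists r1; split.
- by rewrite /r1 !lt_min ltr01 kap0 mulr_gt0// mulr_gt0 ?expR_gt0.
- by rewrite /r1 ge_min lexx.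
- by rewrite /r1 !ge_min lexx orbT.
move=> r r0; rewrite /r1 !lt_min => /and5P[rlt1 rk rd rn rG].
pose T := D / r.
have T0 : 0 < T by rewrite divr_gt0.
have lnT : ln T = ln D + ln r^-1 by rewrite /T lnM// posrE ?invr_gt0.
have Tn : n0%:R * a1 <= ln T.
  rewrite -ler_expR lnK ?posrE// /T ler_pdivlMr// mulrC -ler_pdivlMr ?expR_gt0//.
  by rewrite -expRN ltW.
have lnT0 : 0 <= ln T by apply: le_trans Tn; rewrite mulr_ge0// ltW.
have x0 : 0 <= ln T / a1 by rewrite divr_ge0// ltW.
pose n := (Num.truncn (ln T / a1)).+1.
have xn : ln T <= n%:R * a1.
  by rewrite -ler_pdivrMr// ltW// /n truncnS_gt.
have nx : n%:R * l <= l + l / a1 * ln T.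
  have : n%:R <= 1 + ln T / a1 by rewrite /n -nat1r lerD2l truncn_le.
  by move=> /(ler_wpM2r (ltW l0)) /le_trans; apply; rewrite mulrDl mul1r -mulrA mulrC [_^-1 * _]mulrC; rewrite mulrC.
have q2n : (expR a2)^-1 ^+ n = expR (- (n%:R * a2)).
  by rewrite -expRN -expRM_natl mulrN.
have e1T : expR (- (n%:R * a1)) <= r / D.
  by rewrite expRN -[r / D]invf_div lef_pV2 ?posrE ?expR_gt0// -[X in X <= _]lnK ?posrE// ler_expR.
have ge0n : 0 <= n%:R :> R by [].
exists n; split.
- have : n0%:R <= n%:R :> R.
    by rewrite -(ler_pM2r a10); exact: le_trans xn.
  by rewrite ler_nat.
- rewrite q2n; apply: (@le_trans _ _ (r / D)).
    by apply: le_trans e1T; rewrite ler_expR lerN2 ler_wpM2l// ltW.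
  by rewrite ler_pdivrMr// ltW.
- have -> : (expR a2)^-1 ^+ n = expR (- (n%:R * a1)) * expR (- (n%:R * dl)).
    by rewrite q2n -exp.expRD /dl; congr expR; ring.
  have h1 : n.+1%:R * expR (- (n%:R * dl)) <= C2.
    rewrite expRN ler_pdivrMr ?expR_gt0//.
    apply: (@le_trans _ _ (C2 * (1 + n%:R * dl))).
      have -> : C2 * (1 + n%:R * dl) = 1 + n%:R * dl + dl^-1 + n%:R.
        by rewrite /C2; field; rewrite gt_eqF.
      rewrite -natr1 [n%:R + 1]addrC lerD2r -addrA lerDl addr_ge0 ?invr_ge0 ?mulr_ge0// ltW//.
    by rewrite ler_wpM2l ?(ltW C20)// expR_ge1Dx.
  apply: (@le_trans _ _ (c * (r / D) * C2)).
    rewrite mulrA -mulrA; apply: ler_pM.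
    + by rewrite mulr_ge0 ?expR_ge0// ltW.
    + by rewrite mulr_ge0 ?expR_ge0.
    + by rewrite ler_wpM2l// ltW.
    + by rewrite mulrC.
  have -> // : c * (r / D) * C2 = r / kap.
  by rewrite /D; field; rewrite !gt_eqF.
have lnr : expR (nu%:R * ln r^-1) = r^-1 ^+ nu.
  by rewrite expRM_natl lnK// posrE invr_gt0.
have bn : b ^+ n = expR (n%:R * l) by rewrite expRM_natl /l lnK.
have -> : C * b ^+ n / (r / kap) ^+ nu = C * kap ^+ nu * expR (n%:R * l) * r^-1 ^+ nu.
  by rewrite bn -exprVn invf_div exprMn; ring.
rewrite mulrDl exp.expRD lnr [leRHS]mulrC; apply: ler_wpM2r.
  by rewrite exprn_ge0// invr_ge0 ltW.
apply: (@le_trans _ _ (G * expR (l / a1 * ln r^-1))).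
  rewrite /G -[leRHS]mulrA; apply: ler_wpM2l; first by rewrite mulr_ge0// exprn_ge0// ltW.
  by rewrite -exp.expRD ler_expR -addrA -mulrDr -lnT.
have -> : La / Q * ln r^-1 = (La / Q - l / a1) * ln r^-1 + l / a1 * ln r^-1 by ring.
rewrite exp.expRD; apply: ler_wpM2r; first exact: expR_ge0.
have Gr : G <= (La / Q - l / a1) * ln r^-1.
  rewrite mulrC -ler_pdivrMr// -[leLHS]opprK lnV ?posrE// lerN2 -ler_expR lnK ?posrE//.
  exact: ltW.
apply: le_trans Gr _.
by apply: le_trans (expR_ge1Dx _); rewrite lerDr.
Qed.

Lemma critical_values_cover (V : normedModType RR) d m nu (f : V -> 'rV[RR]_m) (K : set V)
    (beta q : RR) :
  parallelogram_law V -> in_Pmd d f -> (0 < m)%N -> (nu <= m)%N -> compact K ->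
  2 ^+ (3 * m) * (2 * d).+4%:R < beta -> 1 < q ->
  (limn_esup (fun n : nat => (powR (kolmogorov_width K n) (n%:R^-1))%:E) <= (q^-1)%:E)%E ->
  exists r1 : RR, [/\ 0 < r1, r1 <= 1 & forall r : RR, 0 < r -> r < r1 ->
    exists2 k : nat, k%:R <= expR ((nu%:R + ln beta / ln q) * ln r^-1) &
    exists c : 'I_k -> 'rV[RR]_m, forall z, (f @` (Crit_nu f nu `&` K)) z ->
      exists i, forall j, `|c i ord0 j - z ord0 j| <= r / m%:R].
Proof.
move=> PL fP m0 num cK bb q1 wK.
have [C [c [d0 [C0 c1 d00 cnt]]]] := separated_count PL fP m0 num cK.
set b := 2 ^+ _ * _ in bb cnt.
have b1 : 1 < b.
  rewrite /b -natrX -natrM ltr1n; apply: (@leq_trans (1 * (2 * d).+4)); first by [].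
  by rewrite leq_mul2r expn_gt0 orbT.
have [q2 [q20 q2q H]] := width_asymptotics b1 bb q1.
have [n0 app] := width_approx cK q20 q2q wK.
have mR0 : 0 < m%:R :> RR by rewrite ltr0n.
have kap0 : 0 < 4 * m%:R :> RR by rewrite mulr_gt0.
have [r1 [r10 r11 r1k {}H]] := H C c d0 (4 * m%:R) n0 nu C0 c1 d00 kap0.
exists r1; split=> // r r0 rr1.
have [n [nn0 dn cn Cn]] := H r r0 rr1.
have [e He] := app n nn0.
(* The 4 matches the separation [4 * eps] of [separated_count]; the [m] prepares for the passage
   from the maximum norm to Euclidean balls of radius [r]. *)
set eps := r / _ in cn Cn.
have eps0 : 0 < eps by rewrite divr_gt0.
have eps1 : eps <= 1 by rewrite ler_pdivrMr// mul1r (le_trans (ltW rr1)).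
have e4 : 4 * eps = r / m%:R by rewrite /eps; field; rewrite gt_eqF.
have del0 : 0 <= q2^-1 ^+ n by rewrite exprn_ge0// invr_ge0 ltW.
have [|N y y1 y2|k [kX [cc ccP]]] :=
  @separated_cover _ m (f @` (Crit_nu f nu `&` K)) (r / m%:R)
     (Num.truncn (C * b ^+ n / eps ^+ nu)).
- by rewrite divr_gt0.
- rewrite truncn_ge_nat; first by
    apply: (cnt n e (q2^-1 ^+ n) eps N y) => // k l /y2[j]; exists j; rewrite e4.
  by rewrite divr_ge0 ?exprn_ge0 ?(ltW eps0)// mulr_ge0// exprn_ge0// ltW// (lt_trans _ b1).
exists k.
  apply: le_trans Cn; rewrite -truncn_ge_nat//.
  by rewrite divr_ge0 ?exprn_ge0 ?(ltW eps0)// mulr_ge0// exprn_ge0// ltW// (lt_trans _ b1).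
by exists cc => z /ccP[i iP]; exists i => j; exact: ltW.
Qed.

(** * Entropy dimension and Lebesgue measure *)

Lemma entropy_dim_le m (S : set 'rV[RR]_m) (a r1 : RR) : 0 < r1 -> r1 <= 1 ->
  (forall r : RR, 0 < r -> r < r1 ->
     exists2 k : nat, k%:R <= expR (a * ln r^-1) & exists c : 'I_k -> 'rV[RR]_m,
       S `<=` \bigcup_(i in [set: 'I_k]) closed_eball (c i) r) ->
  0 <= a -> (entropy_dim S <= a%:E)%E.
Proof.
move=> r10 r11 H a0; rewrite /entropy_dim /limf_esup.
apply: ge_ereal_inf => /=.
(* The upper limit is an infimum over neighbourhoods, for which the interval from 0 to [r1] is
   taken. *)
exists (ereal_sup [set (match covering_number eps S with
                            | EFin M => (ln M / ln (eps^-1))%:E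
                            | _ => +oo%E end) | eps in [set r : RR | 0 < r < r1]]).
  exists [set r : RR | 0 < r < r1] => //.
  near=> r => /=; apply/andP; split.
    by near: r; exact: nbhs_right_gt.
  by near: r; exact: nbhs_right_lt.
apply: ge_ereal_sup => _ [r /andP[r0 rr1] <-].
have [k kle [c cP]] := H r r0 rr1.
have Mk : (covering_number r S <= (k%:R : RR)%:E)%E.
  by apply: ereal_inf_lbound; exists k => //; exists c.
have M0 : (0 <= covering_number r S)%E.
  by apply: le_ereal_inf_tmp => _ [j _ <-]; rewrite lee_fin.
case: covering_number Mk M0 => [M|//|//]; rewrite !lee_fin => Mk M0.
have lnr : 0 < ln r^-1 by rewrite ln_gt0// invf_gt1// (lt_le_trans rr1).
rewrite ler_pdivrMr//.
(* The covering number of an empty set is 0, and [ln 0] is 0. *)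
have [->|Mn] := eqVneq M 0; first by rewrite ln0// mulr_ge0// ltW.
have Mp : 0 < M by rewrite lt_neqAle eq_sym Mn.
by rewrite -ler_expR lnK ?posrE//; exact: le_trans kle.
Unshelve. all: by end_near.
Qed.

Lemma lebesgue_null_cover m (S : set 'rV[RR]_m) : (0 < m)%N ->
  (forall eps : RR, 0 < eps -> exists (k : nat) (r : RR) (c : 'I_k -> 'rV[RR]_m),
     [/\ 0 <= r, k%:R * (2 * r) ^+ m <= eps &
       forall z, S z -> exists i, forall j, `|c i ord0 j - z ord0 j| <= r]) ->
  lebesgue_null S.
Proof.
move=> m0 H eps e0; have [k [r [c [r0 kr cP]]]] := H eps e0.
(* The finite family is continued by degenerate boxes, whose volume is 0 because [0 < m]. *)
pose ctr (n : nat) := oapp c 0 (insub n).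
pose rad (n : nat) : RR := if (n < k)%N then r else 0.
exists (fun n => \row_j (ctr n ord0 j - rad n)), (fun n => \row_j (ctr n ord0 j + rad n)).
have vol n : \prod_(i < m) ((\row_j (ctr n ord0 j + rad n)) ord0 i -
    (\row_j (ctr n ord0 j - rad n)) ord0 i) = (2 * rad n) ^+ m.
  rewrite -[in RHS](card_ord m) -prodr_const; apply: eq_bigr => i _; rewrite !mxE; ring.
split.
- move=> n i; rewrite !mxE; apply: (@le_trans _ _ (ctr n ord0 i)).
    by rewrite gerBl /rad; case: ifP.
  by rewrite lerDl /rad; case: ifP.
- move=> z /cP[i hi]; exists i => // j; rewrite !mxE /ctr /rad ltn_ord valK /=.
  by have := hi j; rewrite distrC ler_distl.
rewrite (eq_eseriesr (g := fun n => ((2 * rad n) ^+ m)%:E)); last by move=> n _; rewrite vol.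
rewrite (nneseries_split 0 k); last first.
  by move=> n _; rewrite lee_fin exprn_ge0// mulr_ge0// /rad; case: ifP.
rewrite [X in (_ + X)%E]eseries0 ?adde0; last first.
  by move=> n + _; rewrite add0n => kn; rewrite /rad ltnNge kn /= mulr0 expr0n gtn_eqF.
rewrite add0n sumEFin lee_fin; apply: le_trans kr.
rewrite (eq_big_nat _ _ (F2 := fun=> (2 * r) ^+ m)); last by move=> n /andP[_ nk]; rewrite /rad nk.
by rewrite sumr_const_nat subn0 [leRHS]mulr_natl.
Qed.

Theorem theoremA :
  forall d m : nat, (0 < m)%N ->
  exists2 beta0 : RR, 1 < beta0 &
  forall (V : completeNormedModType RR), parallelogram_law V ->
  forall (K : set V), compact K ->
  forall q : RR, 1 < q ->
  (limn_esup (fun n : nat => (powR (kolmogorov_width K n) (n%:R^-1))%:E)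
     <= (q^-1)%:E)%E ->
  forall f : V -> 'rV[RR]_m, in_Pmd d f ->
    (forall nu : nat, (nu <= m - 1)%N ->
       (entropy_dim (f @` (Crit_nu f nu `&` K))
          <= (nu%:R + ln beta0 / ln q)%:E)%E)
    /\ (beta0 < q -> lebesgue_null (f @` (Crit f `&` K))).
Proof.
move=> d m m0; have mR0 : 0 < m%:R :> RR by rewrite ltr0n.
(* The added 1 makes the growth rate of the count strictly smaller than the constant, as
   [width_asymptotics] requires. *)
exists (2 ^+ (3 * m) * (2 * d).+4%:R + 1).
  by rewrite ltrDr mulr_gt0// exprn_gt0.
set beta := _ + 1; have bb : 2 ^+ (3 * m) * (2 * d).+4%:R < beta by rewrite ltrDl.
have beta1 : 1 < beta by rewrite ltrDr mulr_gt0// exprn_gt0.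
clearbody beta.
move=> V PL K cK q q1 wK f fP; split=> [nu num|bq].
  have num' : (nu <= m)%N by apply: leq_trans num (leq_subr _ _).
  have [r1 [r10 r11 H]] := critical_values_cover PL fP m0 num' cK bb q1 wK.
  apply: (entropy_dim_le r10 r11) => [r r0 rr1|].
    have [k kle [c cP]] := H r r0 rr1; exists k => //; exists c => z /cP[i hi].
    exists i => //; rewrite /closed_eball /=.
    apply: le_trans (eucl_dist_le _ hi) _; first by rewrite divr_ge0 ?ltW.
    by rewrite mulrCA divff ?mulr1// gt_eqF.
  by rewrite addr_ge0// divr_ge0// ltW// ln_gt0.
have th1 : ln beta / ln q < 1.
  by rewrite ltr_pdivrMr ?ln_gt0// mul1r ltr_ln// posrE (lt_trans _ beta1, lt_trans _ q1).
set th := ln beta / ln q in th1.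
have num' : (m.-1 <= m)%N by exact: leq_pred.
have [r1 [r10 r11 H]] := critical_values_cover PL fP m0 num' cK bb q1 wK.
apply: lebesgue_null_cover => // eps e0.
have t0 : 0 < 1 - th by rewrite subr_gt0.
(* The total volume of the cubes is at most 2^m r^(1 - th) with a positive exponent; this [r] makes
   it at most [eps]. *)
pose r := Num.min (r1 / 2) (expR (ln (eps / 2 ^+ m) / (1 - th))).
have r0 : 0 < r by rewrite lt_min expR_gt0 divr_gt0.
have rr1 : r < r1 by rewrite gt_min ltr_pdivrMr// mulr2n mulrDr mulr1 ltrDl r10.
have [k kle [c cP]] := H r r0 rr1.
exists k, r, c; split; first exact: ltW.
  apply: (@le_trans _ _ (expR ((m.-1%:R + th) * ln r^-1) * (2 * r) ^+ m)).
    by rewrite ler_wpM2r// exprn_ge0// mulr_ge0// ltW.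
  rewrite exprMn mulrCA -ler_pdivlMl ?exprn_gt0//.
  have -> : r ^+ m = expR (m%:R * ln r) by rewrite expRM_natl lnK.
  rewrite -exp.expRD lnV ?posrE//.
  have -> : (m.-1%:R + th) * - ln r + m%:R * ln r = (1 - th) * ln r.
    by rewrite -[in m%:R](prednK m0) -natr1; ring.
  have e2 : 0 < eps / 2 ^+ m by rewrite divr_gt0// exprn_gt0.
  rewrite [leRHS]mulrC -[leRHS]lnK ?posrE// ler_expR -ler_pdivlMl// [leRHS]mulrC.
  rewrite -ler_expR lnK ?posrE//.
  by rewrite /r ge_min lexx orbT.
move=> z /cP[i hi]; exists i => j; apply: le_trans (hi j) _.
by rewrite ler_pdivrMr// ler_peMr ?ler1n// ltW.
Qed.
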